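(* Assume that the curvature of $L$ is bounded from below by $\rho\ge0$. Let $h$ be a density of probability w.r.t. $\mu$. Assume that one can find a sequence $(h_n)$ of densities of probability with $n\ge h_n\ge1/2$ such that each $h_n\mu$ satisfies a weak Poincaré inequality with the same function $\beta_{WP}$, and such that $h_n\to(1+h)/2$ in $\mathbb{L}^1(\mu)$ as $n\to+\infty$. Then for all $t>0$ $$\|P_t^*(h\mu)-\mu\|_{TV}\le 2\left(\inf_{s>0}\left\{\frac{\rho\,\beta_{WP}(s)}{e^{\rho t}+\rho\,\beta_{WP}(s)-1}+4s\right\}\right)^{1/2}$$ (for $\rho=0$ the quotient is read as $\beta_{WP}(s)/(t+\beta_{WP}(s))$). In particular (when $\rho>0$), if $s\mapsto\beta_{WP}(s)/s$ is non-increasing (at least for small $s$), define $\theta(u)=\inf\{s\,;\ \beta_{WP}(s)/s\le4u/\rho\}$. Then there exists a constant $C$ such that $$\|P_t^*(h\mu)-\mu\|_{TV}\le C\,\theta^{1/2}(e^{\rho t}).$$ In particular, if $\beta_{WP}(s)\le c\,s^{-q}$ for some $q\ge0$, then $\|P_t^*(h\mu)-\mu\|_{TV}\le C\,e^{-\rho t/(2(1+q))}$ for some constant $C$.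
   Context: Setting: $(X_t,\mathbb{P}_x)$ is a time-continuous Markov process with a unique ergodic invariant probability measure $\mu$, infinitesimal generator $L$, semi-group $P_t$ and dual (adjoint) semi-group $P_t^*$, so that for a density of probability $h$ w.r.t. $\mu$, $P_t^*h\,d\mu$ is the law of $X_t$ with initial law $h\,d\mu$; this law is also denoted $P_t^*(h\mu)$. It is assumed that there is an algebra of uniformly continuous and bounded functions, containing the constants, which is a core for $L$ and on which a carré du champ $\Gamma$ exists: $L(fg)=fLg+gLf+\Gamma(f,g)$. One writes $\Gamma(f)=\Gamma(f,f)$ (note the normalization: $\Gamma(f)=|\nabla f|^2$ when $L=\frac12\Delta$). Moreover $\Gamma$ comes from a derivation: $\Gamma(fg,h)=f\Gamma(g,h)+g\Gamma(f,h)$. Consequently, for smooth $\Psi$, $L\Psi(f)=\Psi'(f)Lf+\frac12\Psi''(f)\Gamma(f)$ and $\Gamma(\Psi(f))=(\Psi'(f))^2\Gamma(f)$. Replacing $L$ by $L^*$ does not change $\Gamma$. Curvature: $\Gamma_2(f,g)=\frac12\left(L\Gamma(f,g)-\Gamma(Lf,g)-\Gamma(f,Lg)\right)$, $\Gamma_2(f)=\Gamma_2(f,f)$; the curvature of $L$ is bounded from below by $\rho$ if $\Gamma_2(f)\ge\rho\,\Gamma(f)$ for all nice $f$. A probability measure $\nu$ satisfies a weak Poincaré inequality with the (non-increasing) function $\beta_{WP}:(0,+\infty)\to(0,+\infty)$ if for all $s>0$ and all bounded $f$ in the domain, $\mathrm{Var}_\nu(f)\le\beta_{WP}(s)\int\Gamma(f)\,d\nu+s\,\mathrm{Osc}^2(f)$,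 where $\mathrm{Osc}(f)=\sup f-\inf f$. Total variation is normalized as $\|g\mu-\mu\|_{TV}=\int|g-1|\,d\mu$. *)

(* Defs.v *)
From HB Require Import structures.
From mathcomp Require Import all_boot all_order all_algebra.
From mathcomp Require Import all_classical all_reals all_analysis.

Set Implicit Arguments.
Unset Strict Implicit.
Unset Printing Implicit Defensive.

Import Order.TTheory GRing.Theory Num.Theory.
Import numFieldNormedType.Exports.

Local Open Scope classical_set_scope.
Local Open Scope ring_scope.

(* A uniform space is enough for "uniformly continuous" to make sense; it
   carries its Borel sigma-algebra. *)
Notation borel E := (g_sigma_algebraType (@open E)).

Section MarkovProcess.
Context {R : realType} {E : puniformType} {d : measure_display}
  {Omega : measurableType d}.
Variables (P : R.-pker (borel E) ~> Omega) (X : R -> Omega -> borel E).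

Definition past (s : R) : set (set Omega) :=
  <<s [set F | exists u B, [/\ 0 <= u <= s, measurable B & F = X u @^-1` B]] >>.

(* P x is the law of the process started at x.  Times are the t >= 0: the
   values of X at negative times are never used. *)
Record markov_process : Prop := MarkovProcess {
  mp_measurable : forall t, 0 <= t -> measurable_fun setT (X t);
  mp_start : forall x (B : set (borel E)), measurable B ->
    P x (X 0 @^-1` B) = \d_x B;
  mp_markov : forall x s t F (B : set (borel E)), 0 <= s -> 0 <= t ->
    past s F -> measurable B ->
    P x (F `&` X (s + t) @^-1` B) =
      (\int[P x]_(w in F) P (X s w) (X t @^-1` B))%E }.

Definition semigroup (t : R) (f : E -> R) (x : E) : R :=
  \int[P x]_w f (X t w).

Definition invariant (nu : probability (borel E) R) : Prop :=
  forall t (B : set (borel E)), 0 <= t -> measurable B ->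
    (\int[nu]_x P x (X t @^-1` B))%E = nu B.

Definition ergodic (nu : probability (borel E) R) : Prop :=
  forall B : set (borel E), measurable B ->
    (forall t, 0 <= t ->
       {ae nu, forall x, P x (X t @^-1` B) = (\1_B x)%:E}) ->
    nu B = 0%E \/ nu B = 1%E.

Variable mu : probability (borel E) R.

Definition L2norm (f : borel E -> R) : \bar R := ('N[mu]_2[EFin \o f])%E.
Local Notation L2 := (Lfun (mu : {measure set (borel E) -> \bar R}) 2%:E).

Definition strongly_continuous : Prop :=
  forall f : borel E -> R, f \in L2 ->
    L2norm (fun x => semigroup t f x - f x) @[t --> 0^'+] --> 0%E.

(* The generator is that of the semigroup on L^2(mu); functions stand for
   their mu-classes.  [gen_rel f g] is "f is in the domain and Lf = g",
   and [gen f] is a chosen version of Lf (junk outside the domain). *)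
Definition gen_rel (f g : borel E -> R) : Prop :=
  [/\ f \in L2, g \in L2
    & L2norm (fun x => (semigroup t f x - f x) / t - g x)
        @[t --> 0^'+] --> 0%E].

Definition gen_dom (f : E -> R) : Prop := exists g, gen_rel f g.

Definition gen (f : E -> R) : E -> R := xget (cst 0) [set g | gen_rel f g].

Definition core (A : set (E -> R)) : Prop :=
  (forall f, A f -> gen_dom f) /\
  (forall f g, gen_rel f g -> exists u : nat -> E -> R,
     [/\ forall n, A (u n),
         L2norm (u n \- f) @[n --> \oo] --> 0%E
       & L2norm (gen (u n) \- g) @[n --> \oo] --> 0%E]).

(* Normalized so that Gamma(f, f) = |grad f|^2 when L is half the
   Laplacian. *)
Definition carre (f g : E -> R) : E -> R :=
  fun x => gen (f \* g) x - f x * gen g x - g x * gen f x.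

Definition carre_dom (f g : E -> R) : Prop :=
  [/\ gen_dom f, gen_dom g & gen_dom (f \* g)].

Definition carre2 (f g : E -> R) : E -> R :=
  fun x => 2^-1 *
    (gen (carre f g) x - carre (gen f) g x - carre f (gen g) x).

Definition carre2_dom (f g : E -> R) : Prop :=
  [/\ carre_dom f g, gen_dom (carre f g), carre_dom (gen f) g
    & carre_dom f (gen g)].

Definition bounded_function (f : E -> R) : Prop :=
  exists M, forall x, `|f x| <= M.

Definition algebra_with_constants (A : set (E -> R)) : Prop :=
  [/\ forall c, A (cst c),
      forall f g, A f -> A g -> A (f \+ g)
    & forall f g, A f -> A g -> A (f \* g)].

Definition is_derivation (A : set (E -> R)) : Prop :=
  forall f g k, A f -> A g -> A k ->
    {ae mu, forall x,
      carre (f \* g) k x = f x * carre g k x + g x * carre f k x}.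

Record markov_setting (A : set (E -> R)) : Prop := MarkovSetting {
  ms_process : markov_process;
  ms_invariant : invariant mu;
  ms_unique : forall nu : probability (borel E) R, invariant nu ->
    forall B : set (borel E), measurable B -> nu B = mu B;
  ms_ergodic : ergodic mu;
  ms_continuous : strongly_continuous;
  ms_algebra : algebra_with_constants A;
  ms_unif_continuous : forall f, A f -> unif_continuous (f : E -> R);
  ms_bounded : forall f, A f -> bounded_function f;
  ms_core : core A;
  ms_derivation : is_derivation A }.

(* The "nice" functions of the curvature condition: Gamma_2 must make sense
   on them, and they must be stable under the semigroup.  Without the
   stability (for instance with Neumann reflection on a non convex boundary)
   the inequality Gamma_2 >= rho Gamma carries no information on the
   semigroup. *)
Record nice_class (N : set (E -> R)) : Prop := NiceClass {
  nice_algebra : algebra_with_constants N;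
  nice_measurable : forall f : borel E -> R, N f -> measurable_fun setT f;
  nice_bounded : forall f, N f -> bounded_function f;
  nice_core : core N;
  nice_semigroup : forall t f, 0 <= t -> N f -> N (semigroup t f);
  nice_carre2 : forall f, N f -> carre2_dom f f }.

Definition curvature_ge (rho : R) : Prop :=
  exists2 N : set (E -> R), nice_class N &
    forall f, N f -> {ae mu, forall x, rho * carre f f x <= carre2 f f x}.

Definition osc (f : E -> R) : R := sup (range f) - inf (range f).

Definition wp_function (beta : R -> R) : Prop :=
  (forall s, 0 < s -> 0 < beta s) /\
  (forall s s', 0 < s -> s <= s' -> beta s' <= beta s).

Definition weak_poincare (nu : probability (borel E) R) (beta : R -> R)
    : Prop :=
  forall (s : R) (f : borel E -> R), 0 < s -> measurable_fun setT f ->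
    bounded_function f -> carre_dom f f ->
    (variance nu f <=
       (beta s)%:E * \int[nu]_x (carre f f x)%:E + (s * osc f ^+ 2)%:E)%E.

Definition density (h : borel E -> R) : Prop :=
  [/\ measurable_fun setT h, forall x, 0 <= h x
    & (\int[mu]_x (h x)%:E = 1)%E].

(* nu is the probability measure h mu. *)
Definition has_density (nu : probability (borel E) R) (h : E -> R) : Prop :=
  forall B : set (borel E), measurable B ->
    nu B = (\int[mu]_(x in B) (h x)%:E)%E.

(* P_t^* h, the adjoint on L^1(mu) of the semigroup acting on bounded
   functions; it exists and is unique mu-a.e. when mu is invariant, t >= 0 and
   h is integrable.  For a density h, it is the density of the law of X_t when
   X_0 has law h mu. *)
Definition dual_semigroup (t : R) (h : E -> R) : E -> R :=
  xget (cst 0) [set g : borel E -> R |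
    g \in Lfun (mu : {measure set (borel E) -> \bar R}) 1 /\
    forall f : borel E -> R, measurable_fun setT f -> bounded_function f ->
      \int[mu]_x (f x * g x) = \int[mu]_x (semigroup t f x * h x)].

(* || g mu - mu ||_TV *)
Definition tv_dist (g : E -> R) : \bar R := (\int[mu]_x `|g x - 1|%:E)%E.

End MarkovProcess.

(* rho b / (e^(rho t) + rho b - 1), extended by continuity at rho = 0. *)
Definition decay_quotient {R : realType} (rho t b : R) : R :=
  if rho == 0 then b / (t + b) else rho * b / (expR (rho * t) + rho * b - 1).

Definition wp_rate {R : realType} (rho : R) (beta : R -> R) (t : R) : R :=
  inf [set decay_quotient rho t (beta s) + 4 * s | s in [set s | 0 < s]].

Definition theta {R : realType} (rho : R) (beta : R -> R) (u : R) : R :=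
  inf [set s | 0 < s /\ beta s / s <= 4 * u / rho].

(* Main.v *)
Require Import Defs.
From HB Require Import structures.
From mathcomp Require Import all_boot all_order all_algebra.
From mathcomp Require Import all_classical all_reals all_analysis.
From mathcomp Require Import measurable_realfun giry.
From mathcomp Require Import ring lra.

Set Implicit Arguments.
Unset Strict Implicit.
Unset Printing Implicit Defensive.

Import Order.TTheory GRing.Theory Num.Theory.
Import numFieldNormedType.Exports.

Local Open Scope classical_set_scope.
Local Open Scope ring_scope.

(** Fix a nice function [f] with [|f| <= 1] and a probability [nu] whose density
    [k] with respect to [mu] satisfies [1/2 <= k <= c]. Write [nu P_s] for the law
    at time [s] of the process started from [nu].

    Between times 0 and [t], the integral [psi s] of [(P_{t-s} f)^2] for [nu P_s]
    goes from [nu ((P_t f)^2)] to [nu P_t (f^2)]. Its derivative [phi s] is the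
    integral of [Gamma (P_{t-s} f)] for the same law, and the derivative of [phi]
    is twice the integral of [Gamma_2 (P_{t-s} f)], so that the curvature bound
    makes [phi] grow at least like [e^(rho s)]. Integrating gives the reverse local Poincare
    inequality [reverse_poincare],
      [kappa * nu (Gamma (P_t f)) <= nu P_t (f^2) - nu ((P_t f)^2)],
    with [kappa = (e^(rho t) - 1) / rho], or [kappa = t] if [rho = 0]: the gradient
    of [P_t f] is small when [t] is large. The weak Poincare inequality of [nu] controls the variance
    of [P_t f] by this gradient. Eliminating the gradient between the two
    inequalities yields
      [Var_nu (P_t f) <= beta s / (kappa + beta s) + 4 s],
    which is [variance_bound].

    Next, [(k - 1) mu = (1 - 1/k) nu] with [|1 - 1/k| <= 1], so the Cauchy-Schwarz
    inequality in L2(nu) bounds the integral of [P_t f (k - 1)] for [mu] by the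
    square root of this variance ([density_covariance]). Taking [k = h_n] and
    letting [n] go to infinity gives the same bound for [P_t f ((1 + h)/2 - 1)],
    hence twice this bound for [P_t f (h - 1)]; the latter integrates to the
    integral of [f (P_t^* h - 1)]. The total variation is the supremum of these
    integrals over the nice [f] with [|f| <= 1] ([nrm1_le_test]).

    Two points ask for care. First, nothing says that [Gamma (P_u f)] depends
    smoothly on [u], so [phi] is never differentiated. What holds is a second
    order expansion of [psi] to the left of each point, obtained in L1(mu) from
    the second order Taylor formula of the semigroup in L2(mu) ([taylor2],
    [second_order]), together with a first order expansion to the right; the
    maximum principle [comparison] shows that these two are enough. Second, the
    nice functions have to be dense in L2(mu) even when truncated to [-1, 1]. They
    form a core, the domain of the generator is dense ([domain_dense]), and
    truncation is compatible with an algebra of bounded functions because the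
    absolute value is a uniform limit of polynomials ([clip_approx]).

    The two explicit rates come from a choice of [s] when [e^(rho t) >= 2]; for
    smaller [t] the rate is at most 1 and both target functions are bounded below
    by a positive constant. *)

(** * A comparison principle for one-sided expansions *)

Section RealAnalysis.
Context {R : realType}.
Implicit Types (f y psi phi : R -> R) (t rho e d : R).

Lemma near_right0P (A : R -> Prop) :
  (\forall d \near 0^'+, A d) <->
  exists2 e : R, 0 < e & forall d : R, 0 < d -> d < e -> A d.
Proof.
split=> [[e /= e0 Ae]|[e e0 Ae]].
  exists e => // d d0 de; apply: Ae => //=.
  by rewrite distrC subr0 gtr0_norm.
exists e => //= d /=; rewrite distrC subr0 => de d0.
by apply: Ae => //; rewrite -[d]gtr0_norm.
Qed.

Lemma near_right0_min (A B : R -> Prop) :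
  (\forall d \near 0^'+, A d) -> (\forall d \near 0^'+, B d) ->
  forall e : R, 0 < e -> exists d, [/\ 0 < d, d < e, A d & B d].
Proof.
move=> /near_right0P[a a0 Aa] /near_right0P[b b0 Bb] e e0.
pose m := Num.min e (Num.min a b).
have m0 : 0 < m by rewrite !lt_min e0 a0 b0.
have [me [ma mb]] : m <= e /\ (m <= a /\ m <= b).
  by rewrite !ge_min !lexx ?orbT.
by exists (m / 2); split; [lra|lra|apply: Aa; lra|apply: Bb; lra].
Qed.

Lemma half_pow_lt (e : R) : 0 < e -> exists n, (2 ^+ n)^-1 < e.
Proof.
move=> e0; have [N _ HN] := near_infty_natSinv_lt (PosNum e0).
exists N; have /= := HN N (leqnn N); apply: le_lt_trans.
by rewrite lef_pV2 ?posrE ?exprn_gt0// -natrX ler_nat ltn_expl.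
Qed.

(** Iterating [d, d/2, d/4, ...] turns the quasi-additivity
    [F d <= 2 F (d/2) + O(d^2)] and the first order bound [F d = o(d)] into a
    second order bound: the errors add up to a geometric series. *)
Lemma halving_second_order f e :
  0 <= e ->
  (\forall d \near 0^'+, f d <= 2 * f (d / 2) + 3 / 8 * e * d ^+ 2) ->
  (forall e' : R, 0 < e' -> \forall d \near 0^'+, f d <= e' * d) ->
  \forall d \near 0^'+, f d <= e * d ^+ 2.
Proof.
move=> e_ge0 /near_right0P[a a0 Ha] first.
apply/near_right0P; exists a => // d d0 da.
have iter n : f d <= 2 ^+ n * f (d / 2 ^+ n) + e * d ^+ 2 * (1 - (2 ^+ n)^-1).
  elim: n => [|n IH]; first by rewrite expr0 invr1 subrr mulr0 mulr1 mul1r addr0.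
  apply: (le_trans IH).
  have p0 : 0 < (2 : R) ^+ n by rewrite exprn_gt0.
  have dn0 : 0 < d / 2 ^+ n by rewrite divr_gt0.
  have dna : d / 2 ^+ n < a.
    apply: le_lt_trans da; rewrite ler_pdivrMr//.
    apply: ler_peMr; first exact: ltW.
    by rewrite exprn_ege1// ler1n.
  have := Ha _ dn0 dna.
  rewrite (exprS 2 n); set p := 2 ^+ n in p0 dn0 *.
  rewrite -(ler_pM2l p0).
  have -> : d / p / 2 = d / (2 * p) by field; rewrite gt_eqF.
  have -> : p * (2 * f (d / (2 * p)) + 3 / 8 * e * (d / p) ^+ 2)
    = 2 * p * f (d / (2 * p)) + 3 / 8 * (e * d ^+ 2 * p^-1).
    by field; rewrite gt_eqF.
  have -> : e * d ^+ 2 * (1 - p^-1) = e * d ^+ 2 - e * d ^+ 2 * p^-1 by ring.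
  have -> : e * d ^+ 2 * (1 - (2 * p)^-1)
    = e * d ^+ 2 - 2^-1 * (e * d ^+ 2 * p^-1) by field; rewrite gt_eqF.
  have : 0 <= e * d ^+ 2 * p^-1.
    by rewrite divr_ge0 ?mulr_ge0 ?sqr_ge0// ltW.
  lra.
apply/ler_addgt0Pr => e' e'0.
have /near_right0P[b b0 Hb] := first (e' / d) (divr_gt0 e'0 d0).
have [n nb] : exists n, d / 2 ^+ n < b.
  have [n] := half_pow_lt (divr_gt0 b0 d0).
  by rewrite ltr_pdivlMr// mulrC => nb; exists n.
have p0 : 0 < (2 : R) ^+ n by rewrite exprn_gt0.
apply: (le_trans (iter n)).
have := Hb _ (divr_gt0 d0 p0) nb.
rewrite -(ler_pM2l p0).
have -> : 2 ^+ n * (e' / d * (d / 2 ^+ n)) = e' by field; rewrite !gt_eqF.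
have : 0 <= e * d ^+ 2 * (2 ^+ n)^-1.
  by rewrite divr_ge0 ?mulr_ge0 ?sqr_ge0// ltW.
have -> : e * d ^+ 2 * (1 - (2 ^+ n)^-1)
    = e * d ^+ 2 - e * d ^+ 2 * (2 ^+ n)^-1 by ring.
lra.
Qed.

(** Formally [psi' = phi] and [phi' >= 2 * rho * phi]. The second order part is
    only asked for towards the left, where it does not involve any regularity
    of [phi]. *)
Definition left_superquadratic rho psi phi t :=
  forall s : R, 0 < s <= t -> forall e : R, 0 < e -> \forall d \near 0^'+,
    psi s - d * phi s + d ^+ 2 * (rho * phi s - e) <= psi (s - d).

Definition right_derivable psi phi t :=
  forall s : R, 0 <= s < t -> forall e : R, 0 < e -> \forall d \near 0^'+,
    psi s + d * (phi s - e) <= psi (s + d).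

Definition continuous_upto psi t :=
  forall s : R, 0 <= s <= t -> forall e : R, 0 < e -> exists2 d : R, 0 < d &
    forall u : R, 0 <= u <= t -> `|u - s| < d -> `|psi u - psi s| <= e.

(** At an interior maximum of [psi - y] both one-sided derivatives vanish, so
    [phi] equals the derivative [y1] of [y] there, and the left second order
    expansions of [psi] and [y] contradict each other. *)
Lemma comparison rho psi phi y y1 t :
  0 < t ->
  left_superquadratic rho psi phi t -> right_derivable psi phi t ->
  continuous_upto psi t -> continuous_upto y t ->
  (forall s : R, 0 <= s < t -> forall e : R, 0 < e -> \forall d \near 0^'+,
     y (s + d) <= y s + d * (y1 s + e)) ->
  (forall s : R, 0 < s < t -> exists2 k : R, k < rho * y1 s &
     \forall d \near 0^'+, y (s - d) <= y s - d * y1 s + d ^+ 2 * k) ->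
  y1 0 < phi 0 -> y t - y 0 <= psi t - psi 0.
Proof.
move=> t0 psiL psiR psiC yC yR yL y1phi; rewrite leNgt; apply/negP => neg.
pose m s := psi s - y s.
have mC : {within `[0, t], continuous m}.
  apply/continuous_within_itvP => //.
  have H (s : R) : 0 <= s <= t -> forall e : R, 0 < e -> exists2 d : R, 0 < d &
      forall u : R, 0 <= u <= t -> `|u - s| < d -> `|m u - m s| < e.
    move=> st e e0; have e4 : 0 < e / 4 by rewrite divr_gt0.
    have [a a0 Ha] := psiC s st _ e4; have [b b0 Hb] := yC s st _ e4.
    exists (Num.min a b) => [|u ut]; first by rewrite lt_min a0.
    rewrite lt_min => /andP[/(Ha u ut) A /(Hb u ut) B].
    have -> : m u - m s = (psi u - psi s) - (y u - y s) by rewrite /m; ring.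
    apply: le_lt_trans (ler_normB _ _) _; lra.
  split.
  - move=> s; rewrite in_itv/= => /andP[s0 st].
    apply/cvgrPdist_lt => e e0.
    have [|d d0 Hd] := H s _ e e0; first by rewrite !ltW.
    exists (Num.min d (Num.min s (t - s))) => /=.
      by rewrite !lt_min d0 s0 subr_gt0.
    move=> u /=; rewrite !lt_min distrC => /andP[us /andP[A B]].
    rewrite distrC; apply: Hd => //.
    by move: A B; rewrite !ltr_norml; lra.
  - apply/cvgrPdist_lt => e e0.
    have [|d d0 Hd] := H 0 _ e e0; first by rewrite lexx ltW.
    exists (Num.min d t) => /=; first by rewrite lt_min d0.
    move=> u /=; rewrite lt_min distrC subr0 => /andP[ud ut] u0.
    by rewrite distrC; apply: Hd; rewrite ?subr0// ltW//= ltW// -(gtr0_norm u0).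
  - apply/cvgrPdist_lt => e e0.
    have [|d d0 Hd] := H t _ e e0; first by rewrite lexx ltW.
    exists (Num.min d t) => /=; first by rewrite lt_min d0.
    move=> u /=; rewrite lt_min => /andP[ud uT] ut.
    rewrite distrC; apply: Hd; last by rewrite distrC.
    by rewrite (ltW ut) andbT; move: uT; rewrite ltr_norml; lra.
have [s /[!in_itv]/= /andP[s0 st] maxs] := EVT_max (ltW t0) mC.
have maxm (u : R) : 0 <= u -> u <= t -> m u <= m s.
  by move=> *; apply: maxs; rewrite in_itv/=; apply/andP.
have e10 : 0 < (phi 0 - y1 0) / 4 by rewrite divr_gt0// subr_gt0.
have t0' : 0 <= (0 : R) < t by apply/andP.
have [d [d0 dt A B]] := near_right0_min (psiR 0 t0' _ e10) (yR 0 t0' _ e10) t0.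
have ms0 : m 0 < m s.
  apply: lt_le_trans (maxm d (ltW d0) (ltW dt)).
  rewrite /m; rewrite add0r in A B.
  have : 0 < d * ((phi 0 - y1 0) / 2) by rewrite mulr_gt0//; lra.
  nra.
have mt : m t < m 0 by rewrite /m; lra.
have spos : 0 < s by rewrite lt_neqAle s0 andbT; apply/eqP => E; move: ms0;
  rewrite -E ltxx.
have slt : s < t by rewrite lt_neqAle st andbT; apply/eqP => E; move: mt;
  rewrite -E; lra.
(* Expansions to the right of the maximum. *)
have le1 : phi s <= y1 s.
  rewrite leNgt; apply/negP => lt1.
  have ts0 : 0 < t - s by rewrite subr_gt0.
  have e20 : 0 < (phi s - y1 s) / 4 by rewrite divr_gt0// subr_gt0.
  have st' : 0 <= s < t by rewrite s0.
  have [c [c0 ct C D]] :=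
    near_right0_min (psiR s st' _ e20) (yR s st' _ e20) ts0.
  have : m (s + c) <= m s by apply: maxm; lra.
  rewrite /m; have : 0 < c * ((phi s - y1 s) / 2) by rewrite mulr_gt0//; lra.
  nra.
have [|k klt yLs] := yL s; first by rewrite spos.
have st' : 0 < s <= t by rewrite spos.
pose a := y1 s - phi s.
(* Expansions to its left, divided by the step. *)
have L e : 0 < e -> forall r, 0 < r -> exists d, [/\ 0 < d, d < r &
    a + d * (rho * phi s - e - k) <= 0].
  move=> e0 r r0; have rs0 : 0 < Num.min r s by rewrite lt_min r0.
  have [c [c0 cr C D]] := near_right0_min (psiL s st' e e0) yLs rs0.
  move: cr; rewrite lt_min => /andP[cr cs].
  exists c; split=> //; have : m (s - c) <= m s by apply: maxm; lra.
  by rewrite /m -(pmulr_rle0 _ c0) /a => ?; nra.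
have a0 : a = 0.
  apply/eqP; rewrite eq_le subr_ge0 le1 andbT leNgt; apply/negP => a0.
  set c := rho * phi s - 1 - k in L.
  pose r := a / (1 + `|c|).
  have r0 : 0 < r by rewrite divr_gt0// ltr_pwDl.
  have [b [b0 br]] := L 1 ltr01 r r0; rewrite -/c.
  have c1 : 0 < 1 + `|c| by rewrite ltr_pwDl.
  have {}br : b * (1 + `|c|) < a by rewrite -ltr_pdivlMr.
  have : b * - c <= b * `|c| by rewrite ler_pM2l// -normrN ler_norm.
  lra.
have phiy : phi s = y1 s by move: a0; rewrite /a; lra.
pose e := (rho * y1 s - k) / 2.
have e0 : 0 < e by rewrite divr_gt0// subr_gt0.
have [b [b0 _]] := L e e0 1 ltr01.
rewrite a0 phiy add0r pmulr_rle0// /e; lra.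
Qed.

Definition kappa rho t := if rho == 0 then t else (expR (rho * t) - 1) / rho.

Lemma kappa_gt0 rho t : 0 <= rho -> 0 < t -> 0 < kappa rho t.
Proof.
move=> rho0 t0; rewrite /kappa; case: eqVneq => // rhoN.
have rho_gt0 : 0 < rho by rewrite lt_neqAle eq_sym rhoN.
by rewrite divr_gt0// subr_gt0 expR_gt1 mulr_gt0.
Qed.

Lemma expRN_le d : 0 <= d <= 1 -> expR (- d) <= 1 - d + 3 / 4 * d ^+ 2.
Proof.
move=> /andP[d0 d1].
have A : 1 + d / 2 <= expR (d / 2) by exact: expR_ge1Dx.
have B : (1 + d / 2) ^+ 2 <= expR d.
  have -> : expR d = expR (d / 2) ^+ 2 by rewrite expr2 -expRD -splitr.
  by rewrite ler_sqr ?nnegrE ?expR_ge0//; lra.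
have pos : 0 < expR d by exact: expR_gt0.
rewrite expRN -[leLHS]mul1r ler_pdivrMr//.
have q0 : 0 <= 1 - d + 3 / 4 * d ^+ 2 by nra.
apply: le_trans (ler_wpM2l q0 B).
have : 0 <= d ^+ 3 by rewrite exprn_ge0.
have : 0 <= d ^+ 4 by rewrite exprn_ge0.
lra.
Qed.

(** The two comparison functions: an exponential when [rho > 0], where the
    second order slack comes from the gap between [rho / 2] and [rho], and a
    slightly concave parabola when [rho = 0]. *)
Lemma growth_of_left_superquadratic rho psi phi t :
  0 <= rho -> 0 < t ->
  left_superquadratic rho psi phi t -> right_derivable psi phi t ->
  continuous_upto psi t -> psi 0 <= psi t ->
  kappa rho t * phi 0 <= psi t - psi 0.
Proof.
move=> rho0 t0 psiL psiR psiC psi0t; have k0 := kappa_gt0 rho0 t0.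
have [phi0|phi0] := leP (phi 0) 0.
  by rewrite (le_trans (y := 0)) ?subr_ge0// pmulr_rle0.
have cont (y : R -> R) : continuous y -> continuous_upto y t.
  move=> yc s _ e e0; have /cvgrPdist_le/(_ e e0)[d /= d0 Hd] := yc s.
  by exists d => // u _ us; rewrite distrC; apply: Hd; rewrite /= distrC.
rewrite mulrC; apply/ler_addgt0Pr => e e0.
have [rho1|rhoN] := eqVneq rho 0.
  rewrite /kappa rho1 eqxx.
  pose h := Num.min 1 (e / (t * (1 + t))).
  have tt : 0 < t * (1 + t) by rewrite mulr_gt0//; lra.
  have h0 : 0 < h by rewrite lt_min ltr01 divr_gt0.
  have hle : h * (t * (1 + t)) <= e by rewrite -ler_pdivlMr// ge_min lexx orbT.
  pose y s := (phi 0 - h) * s - h * s ^+ 2.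
  pose y1 s := (phi 0 - h) - 2 * h * s.
  have : y t - y 0 <= psi t - psi 0.
    apply: (@comparison rho psi phi y y1) => //.
    - apply: cont => s; apply: cvgB; apply: cvgM; [exact: cvg_cst| exact: cvg_id
      | exact: cvg_cst | exact: exprn_continuous].
    - move=> s st e1 e10; apply/near_right0P; exists 1 => // d d0 _.
      rewrite /y /y1; have : 0 <= h * d ^+ 2 by rewrite mulr_ge0 ?sqr_ge0 ?ltW.
      have : 0 <= d * e1 by rewrite mulr_ge0 ?ltW.
      lra.
    - move=> s st; exists (- h); first by rewrite rho1 mul0r oppr_lt0.
      apply/near_right0P; exists 1 => // d d0 _.
      by rewrite /y /y1 le_eqVlt; apply/orP; left; apply/eqP; ring.
    - by rewrite /y1; lra.
  by rewrite /y; lra.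
have rho_gt0 : 0 < rho by rewrite lt_neqAle eq_sym rhoN.
pose c := Num.max (phi 0 / 2) (phi 0 - e / kappa rho t).
have c0 : 0 < c by rewrite lt_max divr_gt0.
have clt : c < phi 0.
  by rewrite gt_max ltrBlDr ltrDl divr_gt0// andbT; lra.
have cge : phi 0 * kappa rho t - e <= c * kappa rho t.
  have : (phi 0 - e / kappa rho t) * kappa rho t <= c * kappa rho t.
    by rewrite ler_pM2r// le_max lexx orbT.
  by rewrite mulrBl divfK ?gt_eqF.
pose y s := c * (expR (rho * s) / rho).
pose y1 s := c * expR (rho * s).
have y1_gt0 s : 0 < y1 s by rewrite mulr_gt0 ?expR_gt0.
have yE s d : y (s + d) = y1 s * (expR (rho * d) / rho).
  by rewrite /y /y1 mulrDr expRD; ring.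
have yE0 s : y s = y1 s / rho by rewrite /y /y1 mulrA.
have : y t - y 0 <= psi t - psi 0.
  apply: (@comparison rho psi phi y y1) => //.
  - apply: cont => s; apply: cvgM; first exact: cvg_cst.
    apply: cvgM; last exact: cvg_cst.
    apply: (@continuous_comp _ _ _ (fun s => rho * s) (@expR R)).
      by apply: cvgM; [exact: cvg_cst|exact: cvg_id].
    exact: continuous_expR.
  - move=> s st e1 e10; pose r := Num.min (1 / (2 * rho)) (e1 / (2 * rho * y1 s)).
    have r1 : 0 < 2 * rho by rewrite mulr_gt0.
    have r2 : 0 < 2 * rho * y1 s by rewrite mulr_gt0.
    apply/near_right0P; exists r; first by rewrite lt_min !divr_gt0.
    move=> d d0; rewrite lt_min !ltr_pdivlMr// => /andP[d1 d2].
    have lo : 0 < 1 - rho * d by nra.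
    have up : expR (rho * d) <= 1 + rho * d + 2 * (rho * d) ^+ 2.
      have A : 1 - rho * d <= expR (- (rho * d)) by exact: expR_ge1Dx.
      rewrite -[rho * d]opprK expRN opprK -[leLHS]mul1r ler_pdivrMr ?expR_gt0//.
      have B : 0 <= 1 + rho * d + 2 * (rho * d) ^+ 2.
        by rewrite !addr_ge0 ?mulr_ge0 ?sqr_ge0// ltW.
      apply: le_trans (ler_wpM2l B A).
      have : 0 <= (rho * d) ^+ 2 * (1 - 2 * (rho * d)).
        by rewrite mulr_ge0 ?sqr_ge0//; lra.
      lra.
    rewrite yE yE0.
    have : y1 s / rho * expR (rho * d)
        <= y1 s / rho * (1 + rho * d + 2 * (rho * d) ^+ 2).
      by rewrite ler_pM2l ?divr_gt0.
    have -> : y1 s / rho * (1 + rho * d + 2 * (rho * d) ^+ 2)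
        = y1 s / rho + d * y1 s + d * (d * (2 * rho * y1 s)).
      by field; rewrite gt_eqF.
    have : d * (d * (2 * rho * y1 s)) <= d * e1 by rewrite ler_pM2l// ltW.
    lra.
  - move=> s st; exists (3 / 4 * (rho * y1 s)).
      have := mulr_gt0 rho_gt0 (y1_gt0 s); lra.
    apply/near_right0P; exists (1 / rho); first by rewrite divr_gt0.
    move=> d d0; rewrite ltr_pdivlMr// => d1.
    have /expRN_le up : 0 <= rho * d <= 1.
      by rewrite mulr_ge0 ?ltW//= mulrC.
    rewrite yE yE0 mulrN.
    have : y1 s / rho * expR (- (rho * d))
        <= y1 s / rho * (1 - rho * d + 3 / 4 * (rho * d) ^+ 2).
      by rewrite ler_pM2l ?divr_gt0.
    have -> : y1 s / rho * (1 - rho * d + 3 / 4 * (rho * d) ^+ 2)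
        = y1 s / rho - d * y1 s + d ^+ 2 * (3 / 4 * (rho * y1 s)).
      by field; rewrite gt_eqF.
    lra.
  - by rewrite /y1 mulr0 expR0 mulr1.
have -> : y t - y 0 = c * kappa rho t.
  by rewrite /y /kappa (negbTE rhoN) mulr0 expR0; field.
lra.
Qed.

End RealAnalysis.

(** * Integrable and square integrable functions *)

Section Pointwise.
Context {T : Type} {R : realType}.
Implicit Types f g : T -> R.
Lemma fun_addE f g x : (f + g) x = f x + g x. Proof. by []. Qed.
Lemma fun_oppE f x : (- f) x = - f x. Proof. by []. Qed.
Lemma fun_mulE f g x : (f * g) x = f x * g x. Proof. by []. Qed.
Lemma fun_scaleE c f x : (c *: f) x = c * f x. Proof. by []. Qed.
Lemma fun_cstE c (x : T) : cst c x = c :> R. Proof. by []. Qed.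
Definition pointwiseE := (fun_addE, fun_oppE, fun_mulE, fun_scaleE, fun_cstE).
End Pointwise.

Section RealIntegrable.
Context {d} {T : measurableType d} {R : realType}.
Variable m : {measure set T -> \bar R}.
Implicit Types (f g : T -> R) (c : R).

Definition rint f := m.-integrable setT (EFin \o f).

Lemma rint_measurable f : rint f -> measurable_fun setT f.
Proof. by case/integrableP => /measurable_EFinP. Qed.

Lemma rint_le f g : measurable_fun setT f -> rint g ->
  (forall x, `|f x| <= `|g x|) -> rint f.
Proof.
move=> mf ig fg; apply: le_integrable ig => //; first exact/measurable_EFinP.
by move=> x _; rewrite /= lee_fin.
Qed.

Lemma rintD f g : rint f -> rint g -> rint (f + g).
Proof. by move=> /integrableD h /h; exact. Qed.

Lemma rintZ c f : rint f -> rint (c *: f).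
Proof. by move=> /(integrableZl measurableT c). Qed.

Lemma rintN f : rint f -> rint (- f).
Proof. by move=> /(rintZ (-1)); rewrite scaleN1r. Qed.

Lemma rintB f g : rint f -> rint g -> rint (f - g).
Proof. by move=> h /rintN; exact: rintD. Qed.

Lemma rint_norm f : rint f -> rint (fun x => `|f x|).
Proof. exact: integrable_norm. Qed.

Lemma rintE f : rint f -> (\int[m]_x (f x)%:E = (\int[m]_x f x)%:E)%E.
Proof. by move=> rf; rewrite /Rintegral fineK//; exact: integrable_fin_num. Qed.

Lemma Rint_add f g : rint f -> rint g ->
  \int[m]_x (f + g) x = \int[m]_x f x + \int[m]_x g x.
Proof. exact: RintegralD. Qed.

Lemma Rint_sub f g : rint f -> rint g ->
  \int[m]_x (f - g) x = \int[m]_x f x - \int[m]_x g x.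
Proof. exact: RintegralB. Qed.

Lemma Rint_scale c f : rint f -> \int[m]_x (c *: f) x = c * \int[m]_x f x.
Proof. exact: RintegralZl. Qed.

Lemma Rint_norm_le f : rint f -> `|\int[m]_x f x| <= \int[m]_x `|f x|.
Proof. exact: le_normr_Rintegral. Qed.

Lemma Rint_le f g : rint f -> rint g -> (forall x, f x <= g x) ->
  \int[m]_x f x <= \int[m]_x g x.
Proof. by move=> rf rg fg; exact: le_Rintegral. Qed.

Lemma Rint_le_ae f g : rint f -> rint g -> {ae m, forall x, f x <= g x} ->
  \int[m]_x f x <= \int[m]_x g x.
Proof.
move=> rf rg fg; rewrite -lee_fin -!rintE//.
have mg := measurable_int m rg; have mf := measurable_int m rf.
have rgf := rintB rg rf; have mgf := measurable_int m rgf.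
suff : (0 <= \int[m]_x ((g - f) x)%:E)%E.
  by rewrite (rintE rgf) (Rint_sub rg rf) lee_fin subr_ge0 (rintE rf) (rintE rg).
have -> : (\int[m]_x ((g - f) x)%:E = \int[m]_x (`|(g - f) x|)%:E)%E.
  apply: ae_eq_integral => //.
    by apply/measurable_EFinP; apply: measurableT_comp => //; exact/measurable_EFinP.
  by apply: filterS fg => x fgx _; rewrite ger0_norm// subr_ge0.
exact: integral_ge0.
Qed.

Lemma Rint_eq_ae f g : measurable_fun setT f -> measurable_fun setT g ->
  {ae m, forall x, f x = g x} -> \int[m]_x f x = \int[m]_x g x.
Proof.
move=> mf mg fg; congr fine; apply: ae_eq_integral => //.
- exact/measurable_EFinP.
- exact/measurable_EFinP.
- by apply: filterS fg => x -> _.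
Qed.

End RealIntegrable.

Section SquareIntegrable.
Context {d} {T : measurableType d} {R : realType} (mu : probability T R).
Implicit Types (f g : T -> R) (c M : R).

Definition sqint f := measurable_fun setT f /\ rint mu (fun x => f x ^+ 2).

Definition nrm f : R := Num.sqrt (\int[mu]_x f x ^+ 2).

Definition bounded_by M f := measurable_fun setT f /\ forall x, `|f x| <= M.

Lemma rint_cst (p : {finite_measure set T -> \bar R}) c : rint p (cst c).
Proof. exact: finite_measure_integrable_cst. Qed.

Lemma rint_bounded (p : {finite_measure set T -> \bar R}) M f :
  bounded_by M f -> rint p f.
Proof.
move=> [mf bf]; apply: rint_le (rint_cst p M) _ => // x.
by rewrite (le_trans (bf x))// ler_norm.
Qed.

Lemma rintM (p : {measure set T -> \bar R}) M f g :
  bounded_by M f -> rint p g -> rint p (f * g).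
Proof.
move=> [mf fM] rg; apply: rint_le (rintZ M rg) _.
  by apply: measurable_funM => //; exact: rint_measurable rg.
move=> x; rewrite !pointwiseE !normrM ler_wpM2r//.
by rewrite (le_trans (fM x))// ler_norm.
Qed.

Lemma bounded_sqint M f : bounded_by M f -> sqint f.
Proof.
move=> [mf bf]; split=> //; apply: (@rint_bounded _ (M ^+ 2)); split.
  exact: measurable_funX.
by move=> x; rewrite normrX lerXn2r ?nnegrE// (le_trans _ (bf x)).
Qed.

Lemma sqint_measurable f : sqint f -> measurable_fun setT f.
Proof. by case. Qed.

Lemma sqint_sqr f : sqint f -> rint mu (fun x => f x ^+ 2).
Proof. by case. Qed.

Lemma sqint_cst c : sqint (cst c).
Proof. by apply: (@bounded_sqint `|c|); split. Qed.

Lemma sqint_rint f : sqint f -> rint mu f.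
Proof.
move=> [mf if2]; apply: rint_le (rintD if2 (rint_cst mu 1)) _ => // x.
rewrite !pointwiseE [leRHS]ger0_norm ?addr_ge0 ?sqr_ge0//.
rewrite -(real_normK (num_real (f x))).
have := sqr_ge0 (`|f x| - 1); have := normr_ge0 (f x); nra.
Qed.

Lemma sqint_mul f g : sqint f -> sqint g -> rint mu (f * g).
Proof.
move=> [mf if2] [mg ig2]; apply: rint_le (rintD if2 ig2) _.
  exact: measurable_funM.
move=> x; rewrite !pointwiseE [leRHS]ger0_norm ?addr_ge0 ?sqr_ge0//.
rewrite normrM -(real_normK (num_real (f x))) -(real_normK (num_real (g x))).
have := sqr_ge0 (`|f x| - `|g x|).
have := normr_ge0 (f x); have := normr_ge0 (g x); nra.
Qed.

Lemma sqintD f g : sqint f -> sqint g -> sqint (f + g).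
Proof.
move=> sf sg; split; first by apply: measurable_funD; [case: sf|case: sg].
rewrite (_ : (fun _ => _) = (fun x => f x ^+ 2) + (fun x => g x ^+ 2)
    + 2 *: (f * g)).
  by apply: rintD; [apply: rintD; [case: sf|case: sg]|
                    apply: rintZ; exact: sqint_mul].
by apply/funext => x; rewrite !pointwiseE; ring.
Qed.

Lemma sqintZ c f : sqint f -> sqint (c *: f).
Proof.
move=> [mf if2]; split; first exact: measurable_funM.
rewrite (_ : (fun _ => _) = c ^+ 2 *: (fun x => f x ^+ 2)); first exact: rintZ.
by apply/funext => x; rewrite !pointwiseE exprMn.
Qed.

Lemma sqintN f : sqint f -> sqint (- f).
Proof. by move=> /(sqintZ (-1)); rewrite scaleN1r. Qed.

Lemma sqintB f g : sqint f -> sqint g -> sqint (f - g).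
Proof. by move=> sf /sqintN; exact: sqintD. Qed.

Lemma sqintM M f g : bounded_by M f -> sqint g -> sqint (f * g).
Proof.
move=> [mf bf] [mg ig2]; split; first exact: measurable_funM.
apply: rint_le (rintZ (M ^+ 2) ig2) _.
  by apply: measurable_funX; exact: measurable_funM.
move=> x; rewrite !pointwiseE.
rewrite exprMn !normrM; apply: ler_wpM2r => //.
by apply: ler_pM => //; rewrite (le_trans (bf x))// ler_norm.
Qed.

Lemma nrm_ge0 f : 0 <= nrm f. Proof. exact: sqrtr_ge0. Qed.

Lemma nrm_sqr f : nrm f ^+ 2 = \int[mu]_x f x ^+ 2.
Proof. by rewrite sqr_sqrtr// Rintegral_ge0// => x _; exact: sqr_ge0. Qed.

Lemma LnormE f : sqint f -> ('N[mu]_2[EFin \o f])%E = (nrm f)%:E.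
Proof.
move=> [mf if2]; rewrite unlock /Lnorm.
under eq_integral.
  move=> x _.
  rewrite (_ : (_ `^ _)%E = (f x ^+ 2)%:E); last first.
    by rewrite /= powR_mulrn// real_normK// num_real.
  over.
rewrite rintE//= powR12_sqrt//.
by apply: Rintegral_ge0 => x _; exact: sqr_ge0.
Qed.

Lemma sqint_Lfun f : f \in Lfun mu 2%:E <-> sqint f.
Proof.
split=> [fL|[mf if2]].
  split; last exact: Lfun2_integrable_sqr.
  by move: fL; rewrite inE => /andP[/[!inE]].
rewrite inE; apply/andP; rewrite !inE; split=> //.
by rewrite /finite_norm/= LnormE// ltry.
Qed.

Lemma nrmZ c f : sqint f -> nrm (c *: f) = `|c| * nrm f.
Proof.
move=> [mf if2]; rewrite /nrm -sqrtr_sqr -sqrtrM ?sqr_ge0//; congr Num.sqrt.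
rewrite -Rint_scale//; apply: eq_Rintegral => x _.
by rewrite !pointwiseE exprMn.
Qed.

Lemma nrmN f : nrm (- f) = nrm f.
Proof.
by rewrite /nrm; congr Num.sqrt; apply: eq_Rintegral => x _; exact: sqrrN.
Qed.

Lemma nrmD f g : sqint f -> sqint g -> nrm (f + g) <= nrm f + nrm g.
Proof.
move=> sf sg; rewrite -lee_fin EFinD -!LnormE//; last exact: sqintD.
by apply: minkowski_EFin => //; [case: sf|case: sg|rewrite ler1n].
Qed.

Lemma nrmB f g : sqint f -> sqint g -> nrm (f - g) <= nrm f + nrm g.
Proof. by move=> sf sg; rewrite -(nrmN g); apply: nrmD => //; exact: sqintN. Qed.

Lemma nrmBC f g : nrm (f - g) = nrm (g - f).
Proof. by rewrite -nrmN opprB. Qed.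

Lemma nrm_triangle f g k : sqint f -> sqint g -> sqint k ->
  nrm (f - k) <= nrm (f - g) + nrm (g - k).
Proof.
move=> sf sg sk; rewrite [f - k](_ : _ = (f - g) + (g - k)); last first.
  by rewrite addrA subrK.
by apply: nrmD; apply: sqintB.
Qed.

Lemma nrm_eq_ae f g : measurable_fun setT f -> measurable_fun setT g ->
  {ae mu, forall x, f x = g x} -> nrm f = nrm g.
Proof.
move=> mf mg fg; congr Num.sqrt; apply: Rint_eq_ae; [exact: measurable_funX..|].
by apply: filterS fg => x ->.
Qed.

Lemma nrm_le f g : measurable_fun setT f -> sqint g ->
  (forall x, `|f x| <= `|g x|) -> nrm f <= nrm g.
Proof.
move=> mf [mg ig2] fg.
have le x : f x ^+ 2 <= g x ^+ 2.
  rewrite -(real_normK (num_real (f x))) -(real_normK (num_real (g x))).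
  by rewrite lerXn2r ?nnegrE.
apply: ler_wsqrtr; apply: Rint_le => //; apply: rint_le ig2 _.
  exact: measurable_funX.
by move=> x; rewrite !ger0_norm ?sqr_ge0.
Qed.

Lemma cauchy_schwarz f g : sqint f -> sqint g ->
  \int[mu]_x `|f x * g x| <= nrm f * nrm g.
Proof.
move=> sf sg; have ifg := rint_norm (sqint_mul sf sg).
rewrite -lee_fin -rintE// EFinM -!LnormE//.
apply: le_trans (@hoelder _ _ _ mu f g 2 2 _ _ _ _ _) => //;
  [|exact: (proj1 sf)|exact: (proj1 sg)|].
- by rewrite Lnorm1.
- by lra.
Qed.

End SquareIntegrable.

(** * Transition kernels and the propagation of laws *)

Section Kernels.
Context {d} {T : measurableType d} {R : realType}.
Implicit Types (p : giry T R) (f g : T -> R) (s t c : R).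

Record transition_kernels (Q : R -> T -> giry T R) : Prop := TransitionKernels {
  tk_measurable : forall t, measurable_fun setT (Q t);
  tk_mass : forall t x, Q t x setT = 1%E;
  tk_0 : forall x (B : set T), measurable B -> Q 0 x B = \d_x B;
  tk_add : forall s t x (B : set T), 0 <= s -> 0 <= t -> measurable B ->
    Q (s + t) x B = (\int[Q s x]_y Q t y B)%E }.

Lemma jensen_sqr p f : p setT = 1%E -> measurable_fun setT f ->
  rint p (fun x => f x ^+ 2) ->
  rint p f /\ (\int[p]_x f x) ^+ 2 <= \int[p]_x f x ^+ 2.
Proof.
move=> p1 mf if2.
have pf : rint p f.
  apply: rint_le (rintD if2 (rint_cst p 1)) _ => // x.
  rewrite !pointwiseE [leRHS]ger0_norm ?addr_ge0 ?sqr_ge0//.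
  rewrite -(real_normK (num_real (f x))).
  have := sqr_ge0 (`|f x| - 1); have := normr_ge0 (f x); nra.
split=> //; set a := \int[p]_x f x.
have : 0 <= \int[p]_x (f x - a) ^+ 2.
  by apply: Rintegral_ge0 => x _; exact: sqr_ge0.
rewrite (_ : (fun x => (f x - a) ^+ 2) = (fun x => f x ^+ 2) +
   ((-2 * a) *: f + cst (a ^+ 2))); last first.
  by apply/funext => x; rewrite !pointwiseE; ring.
have r1 := rintZ (-2 * a) pf; have r2 := rint_cst p (a ^+ 2).
rewrite (Rint_add if2 (rintD r1 r2)) (Rint_add r1 r2) Rint_scale// -/a.
rewrite Rintegral_cst// [X in fine X]p1 mulr1; lra.
Qed.

Section Domination.
Context {c : R} {p : giry T R} {mu : probability T R}.

(** Domination by a multiple of [mu] is preserved when laws are propagated, and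
    it is enough to carry null sets and L1 bounds over from [mu] to [p]. *)
Definition majorized (c : R) (p : giry T R) (mu : probability T R) :=
  0 <= c /\ forall B : set T, measurable B -> (p B <= c%:E * mu B)%E.

Hypothesis dom : majorized c p mu.

Lemma majorized_integral (f : T -> \bar R) : measurable_fun setT f ->
  (forall x, 0 <= f x)%E -> (\int[p]_x f x <= c%:E * \int[mu]_x f x)%E.
Proof.
move=> mf f0; have [c0 cB] := dom.
rewrite -[c]/((NngNum c0)%:num) -ge0_integral_mscale//.
by apply: ge0_le_measure_integral => // A mA _; exact: cB.
Qed.

Lemma majorized_ae (A : T -> Prop) :
  {ae mu, forall x, A x} -> {ae p, forall x, A x}.
Proof.
move=> [N [mN N0 AN]]; exists N; split=> //; apply/eqP.
rewrite -measure_le0; have [_ /(_ N mN)] := dom.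
by rewrite [mu N]N0 mule0.
Qed.

Lemma majorized_rint f : rint mu f -> rint p f.
Proof.
move=> /integrableP[mf fy]; apply/integrableP; split=> //.
apply: le_lt_trans (majorized_integral _ _) _ => //.
  exact: measurableT_comp.
by rewrite lte_mul_pinfty// lee_fin; case: dom.
Qed.

Lemma majorized_le f : rint mu f ->
  `|\int[p]_x f x| <= c * \int[mu]_x `|f x|.
Proof.
move=> rf; have pf := majorized_rint rf.
apply: le_trans (Rint_norm_le pf) _.
rewrite -lee_fin EFinM -!rintE; try exact: rint_norm.
apply: majorized_integral => //.
by apply/measurable_EFinP; apply: measurableT_comp => //; exact: rint_measurable rf.
Qed.

End Domination.

Section Semigroup.
Variables (Q : R -> T -> giry T R) (QP : transition_kernels Q).

Definition pt t f x : R := \int[Q t x]_y f y.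

Definition law p t : giry T R := giry_bind p (tk_measurable QP t).

Lemma integral_law p t (f : T -> \bar R) : measurable_fun setT f ->
  (forall x, 0 <= f x)%E ->
  (\int[law p t]_x f x = \int[p]_x \int[Q t x]_y f y)%E.
Proof. exact: giry_int_bind. Qed.

Lemma lawE p t (B : set T) : measurable B ->
  law p t B = (\int[p]_x Q t x B)%E.
Proof.
move=> mB; have := @integral_law p t (EFin \o \1_B).
rewrite integral_indic// setIT => ->//.
- by apply: eq_integral => x _; rewrite integral_indic// setIT.
- exact/measurable_EFinP.
- by move=> x; rewrite /= lee_fin.
Qed.

Lemma law_mass p t : p setT = 1%E -> law p t setT = 1%E.
Proof.
move=> p1; rewrite lawE//.
under eq_integral do rewrite tk_mass//.
by rewrite integral_cst// mul1e.
Qed.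

Lemma measurable_kernel_integral t (f : T -> \bar R) :
  measurable_fun setT f -> (forall x, 0 <= f x)%E ->
  measurable_fun setT (fun x => \int[Q t x]_y f y)%E.
Proof.
move=> mf f0; apply: (@measurableT_comp _ _ _ _ _ _ (fun q : giry T R =>
  \int[q]_y f y)%E); last exact: tk_measurable.
exact: measurable_giry_int.
Qed.

Lemma measurable_pt t f : measurable_fun setT f -> measurable_fun setT (pt t f).
Proof.
move=> mf; apply: measurableT_comp => //.
under eq_fun do rewrite integralE.
apply: emeasurable_funB; apply: measurable_kernel_integral => //.
- by apply: measurable_funepos; exact/measurable_EFinP.
- by apply: measurable_funeneg; exact/measurable_EFinP.
Qed.

Lemma rint_kernel_ae p t f : rint (law p t) f ->
  {ae p, forall x, rint (Q t x) f}.
Proof.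
move=> /integrableP[mf fy]; rewrite integral_law// in fy; last first.
  exact: measurableT_comp.
have /integrable_ae : p.-integrable setT (fun x => \int[Q t x]_y `|(f y)%:E|)%E.
  apply/integrableP; split.
    by apply: measurable_kernel_integral => //; exact: measurableT_comp.
  under eq_integral => x _ do rewrite gee0_abs ?integral_ge0//.
  exact: fy.
move=> /(_ measurableT); apply: filterS => x /(_ I) fin.
apply/integrableP; split=> //.
by rewrite ltey_eq fin.
Qed.

Lemma abs_fine_le (y : \bar R) : (`|fine y|%:E <= `|y|)%E.
Proof. by case: y => [r| |]//=; rewrite leey. Qed.

Lemma rint_pt p t f : rint (law p t) f -> rint p (pt t f).
Proof.
move=> rf; have mf := rint_measurable rf; have [mf' fy] := integrableP _ _ _ rf.
apply/integrableP; split; first by apply/measurable_EFinP; exact: measurable_pt.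
apply: le_lt_trans fy; rewrite integral_law//; last exact: measurableT_comp.
apply: ge0_le_integral => //.
- by apply: measurableT_comp => //; apply/measurable_EFinP; exact: measurable_pt.
- by apply: measurable_kernel_integral => //; exact: measurableT_comp.
- move=> x _; apply: le_trans (abs_fine_le _) _.
  exact: le_abse_integral.
Qed.

(** The positive and negative parts are propagated separately; their difference
    can be taken under the integral where [f] is integrable for [Q t x], which
    is almost everywhere. *)
Lemma integral_pt p t f : rint (law p t) f ->
  \int[p]_x pt t f x = \int[law p t]_x f x.
Proof.
move=> rf; have mf' := measurable_int _ rf; congr fine.
rewrite [RHS]integralE integral_law//; last exact: measurable_funepos.
rewrite integral_law//; last exact: measurable_funeneg.
have mp : measurable_fun setT (fun x => \int[Q t x]_y (EFin \o f)^\+ y)%E.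
  by apply: measurable_kernel_integral => //; exact: measurable_funepos.
have mn : measurable_fun setT (fun x => \int[Q t x]_y (EFin \o f)^\- y)%E.
  by apply: measurable_kernel_integral => //; exact: measurable_funeneg.
have ip : p.-integrable setT (fun x => \int[Q t x]_y (EFin \o f)^\+ y)%E.
  apply/integrableP; split=> //.
  under eq_integral => x _ do rewrite gee0_abs ?integral_ge0//.
  rewrite -integral_law//; last exact: measurable_funepos.
  by rewrite ltey_eq integrable_pos_fin_num.
have inn : p.-integrable setT (fun x => \int[Q t x]_y (EFin \o f)^\- y)%E.
  apply/integrableP; split=> //.
  under eq_integral => x _ do rewrite gee0_abs ?integral_ge0//.
  rewrite -integral_law//; last exact: measurable_funeneg.
  by rewrite ltey_eq integrable_neg_fin_num.
rewrite -integralB//; apply: ae_eq_integral => //.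
- by apply/measurable_EFinP; apply: measurable_pt; exact: rint_measurable rf.
- exact: emeasurable_funB.
apply: filterS (rint_kernel_ae rf) => x rx _.
by rewrite /pt -rintE// integralE.
Qed.

Lemma law_kernel s t x (f : T -> \bar R) : 0 <= s -> 0 <= t ->
  (\int[law (Q s x) t]_y f y = \int[Q (s + t) x]_y f y)%E.
Proof.
move=> s0 t0; apply: eq_measure_integral => B mB _.
by rewrite [LHS]lawE// [RHS](tk_add QP).
Qed.

Lemma law_add p s t (f : T -> \bar R) : 0 <= s -> 0 <= t ->
  (\int[law (law p s) t]_y f y = \int[law p (s + t)]_y f y)%E.
Proof.
move=> s0 t0; apply: eq_measure_integral => B mB _.
rewrite [LHS]lawE// integral_law//; last first.
  apply: (@measurableT_comp _ _ _ _ _ _ (fun q : giry T R => q B)).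
    exact: measurable_giry_ev.
  exact: tk_measurable.
by rewrite [RHS]lawE//; apply: eq_integral => x _; rewrite [RHS](tk_add QP).
Qed.

(** The integrability at time [s + t] makes the iterated integral a genuine one;
    otherwise the convention that [fine] is 0 at infinity may break the equality. *)
Lemma pt_add s t f x : 0 <= s -> 0 <= t -> rint (Q (s + t) x) f ->
  pt (s + t) f x = pt s (pt t f) x.
Proof.
move=> s0 t0 rf; rewrite /pt -/(pt t f) integral_pt.
  by rewrite /Rintegral law_kernel.
have [mf fy] := integrableP _ _ _ rf.
by apply/integrableP; split=> //; rewrite law_kernel.
Qed.

Lemma pt_bounded M t f : bounded_by M f -> bounded_by M (pt t f).
Proof.
move=> [mf bf]; split=> [|x]; first exact: measurable_pt.
have rf : rint (Q t x) f by apply: (@rint_bounded _ _ _ _ M).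
apply: le_trans (Rint_norm_le rf) _.
apply: (@le_trans _ _ (\int[Q t x]_y cst M y)).
  by apply: Rint_le; [exact: rint_norm|exact: rint_cst|].
by rewrite Rintegral_cst// [X in fine X](tk_mass QP) mulr1.
Qed.

Lemma pt0 f x : measurable_fun setT f -> pt 0 f x = f x.
Proof.
move=> mf; rewrite /pt /Rintegral (eq_measure_integral (\d_x)).
  rewrite integral_dirac//; last exact/measurable_EFinP.
  by rewrite diracT mul1e.
by move=> B mB _; rewrite [LHS](tk_0 QP).
Qed.

End Semigroup.
End Kernels.

(** * The semigroup and its generator in L2 *)

Section L1Norm.
Context {d} {T : measurableType d} {R : realType} (mu : probability T R).
Implicit Types (f g : T -> R) (c M : R).

Definition nrm1 f : R := \int[mu]_x `|f x|.

Lemma nrm1D f g : rint mu f -> rint mu g -> nrm1 (f + g) <= nrm1 f + nrm1 g.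
Proof.
move=> rf rg; rewrite /nrm1 -(Rint_add (rint_norm rf) (rint_norm rg)).
apply: Rint_le; [exact/rint_norm/rintD|apply: rintD; exact: rint_norm|].
by move=> x; rewrite !pointwiseE ler_normD.
Qed.

Lemma nrm1Z c f : rint mu f -> nrm1 (c *: f) = `|c| * nrm1 f.
Proof.
move=> rf; rewrite /nrm1 -(Rint_scale _ (rint_norm rf)).
by apply: eq_Rintegral => x _; rewrite !pointwiseE normrM.
Qed.

Lemma nrm1_mul f g : sqint mu f -> sqint mu g -> nrm1 (f * g) <= nrm mu f * nrm mu g.
Proof. exact: cauchy_schwarz. Qed.

Lemma nrm_cst c : nrm mu (cst c) = `|c|.
Proof.
by rewrite /nrm /cst Rintegral_cst// [X in fine X]probability_setT mulr1 sqrtr_sqr.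
Qed.

Lemma nrm1_le_nrm f : sqint mu f -> nrm1 f <= nrm mu f.
Proof.
move=> sf; have := nrm1_mul sf (sqint_cst mu 1).
by rewrite nrm_cst normr1 !mulr1.
Qed.

Lemma nrm1_mulM M f g : bounded_by M f -> rint mu g -> nrm1 (f * g) <= M * nrm1 g.
Proof.
move=> bf rg; rewrite /nrm1 -(Rint_scale _ (rint_norm rg)).
have [mf fM] := bf.
apply: Rint_le; [exact/rint_norm/(rintM bf)|exact/rintZ/rint_norm|].
by move=> x; rewrite !pointwiseE normrM ler_wpM2r.
Qed.

End L1Norm.

Section Operators.
Context {d} {T : measurableType d} {R : realType}.
Variables (Q : R -> T -> giry T R) (QP : transition_kernels Q).
Variable mu : probability T R.
Hypothesis inv : forall t (B : set T), 0 <= t -> measurable B ->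
  (\int[mu]_x Q t x B = mu B)%E.
Implicit Types (f g : T -> R) (s t c : R) (p : giry T R).

Local Notation pt := (pt Q).
Local Notation law := (law QP).
Local Notation nrm := (nrm mu).
Local Notation sqint := (sqint mu).

Lemma law_mu t (f : T -> \bar R) : 0 <= t ->
  (\int[law mu t]_y f y = \int[mu]_y f y)%E.
Proof.
move=> t0; apply: eq_measure_integral => B mB _.
by rewrite [LHS]lawE// inv.
Qed.

Lemma rint_law_mu t f : 0 <= t -> rint mu f -> rint (law mu t) f.
Proof.
move=> t0 /integrableP[mf fy]; apply/integrableP; split=> //.
by rewrite law_mu.
Qed.

Lemma measurable_kernel_set t (B : set T) : measurable B ->
  measurable_fun setT (fun x => Q t x B).
Proof.
move=> mB; apply: (@measurableT_comp _ _ _ _ _ _ (fun q : giry T R => q B)).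
  exact: measurable_giry_ev.
exact: tk_measurable.
Qed.

Lemma majorized_law c p t : 0 <= t -> majorized c p mu ->
  majorized c (law p t) mu.
Proof.
move=> t0 dom; split=> [|B mB]; first by case: dom.
rewrite [leLHS]lawE// -(inv t0 mB).
by apply: (majorized_integral dom) => //; exact: measurable_kernel_set.
Qed.

Lemma rint_kernel_mu t f : 0 <= t -> rint mu f ->
  {ae mu, forall x, rint (Q t x) f}.
Proof. by move=> t0 /(rint_law_mu t0)/rint_kernel_ae. Qed.

Lemma rint_pt_mu t f : 0 <= t -> rint mu f -> rint mu (pt t f).
Proof. by move=> t0 /(rint_law_mu t0)/rint_pt. Qed.

Lemma integral_pt_mu t f : 0 <= t -> rint mu f ->
  \int[mu]_x pt t f x = \int[mu]_x f x.
Proof.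
move=> t0 rf; rewrite (integral_pt (rint_law_mu t0 rf)).
by rewrite /Rintegral law_mu.
Qed.

(** Jensen's inequality, at the points where [f ^+ 2] is integrable for the
    kernel; at the other points the bound by [+oo] is trivial. *)
Lemma sqint_pt t f : 0 <= t -> sqint f -> sqint (pt t f).
Proof.
move=> t0 [mf if2]; split; first exact: measurable_pt.
have mf2 : measurable_fun setT (fun y => (f y ^+ 2)%:E).
  by apply/measurable_EFinP; exact: measurable_funX.
have [_ fy] := integrableP _ _ _ (rint_law_mu t0 if2).
apply/integrableP; split.
  by apply/measurable_EFinP; apply: measurable_funX; exact: measurable_pt.
apply: le_lt_trans fy; rewrite integral_law//; last exact: measurableT_comp.
apply: ge0_le_integral => //.
- apply: measurableT_comp => //; apply/measurable_EFinP; apply: measurable_funX.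
  exact: measurable_pt.
- by apply: measurable_kernel_integral => //; exact: measurableT_comp.
move=> x _; rewrite gee0_abs ?lee_fin ?sqr_ge0//.
have [oo|] := eqVneq (\int[Q t x]_y `|(f y ^+ 2)%:E|)%E +oo%E.
  by rewrite [leRHS]oo leey.
rewrite -ltey => fin; have r2 : rint (Q t x) (fun y => f y ^+ 2).
  exact/integrableP.
have [_ le2] := jensen_sqr (tk_mass QP t x) mf r2.
under eq_integral => y _ do rewrite gee0_abs ?lee_fin ?sqr_ge0//.
by rewrite (rintE r2) lee_fin.
Qed.

Lemma pt_sqr_le_ae t f : 0 <= t -> sqint f ->
  {ae mu, forall x, pt t f x ^+ 2 <= pt t (fun y => f y ^+ 2) x}.
Proof.
move=> t0 [mf if2]; apply: filterS (rint_kernel_mu t0 if2) => x r2.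
by have [] := jensen_sqr (tk_mass QP t x) mf r2.
Qed.

Lemma nrm_pt t f : 0 <= t -> sqint f -> nrm (pt t f) <= nrm f.
Proof.
move=> t0 sf; apply: ler_wsqrtr; have [mf if2] := sf.
rewrite -(integral_pt_mu t0 if2); apply: Rint_le_ae.
- by case: (sqint_pt t0 sf).
- exact: rint_pt_mu.
- exact: pt_sqr_le_ae.
Qed.

(** [pt] is total, so its linearity and the semigroup law hold at the points where
    the functions are integrable for the kernel, that is almost everywhere. *)
Lemma ptD_ae t f g : 0 <= t -> rint mu f -> rint mu g ->
  {ae mu, forall x, pt t (f + g) x = pt t f x + pt t g x}.
Proof.
move=> t0 rf rg.
by apply: filterS2 (rint_kernel_mu t0 rf) (rint_kernel_mu t0 rg) => x; exact: Rint_add.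
Qed.

Lemma ptB_ae t f g : 0 <= t -> rint mu f -> rint mu g ->
  {ae mu, forall x, pt t (f - g) x = pt t f x - pt t g x}.
Proof.
move=> t0 rf rg.
by apply: filterS2 (rint_kernel_mu t0 rf) (rint_kernel_mu t0 rg) => x; exact: Rint_sub.
Qed.

Lemma ptZ_ae t c f : 0 <= t -> rint mu f ->
  {ae mu, forall x, pt t (c *: f) x = c * pt t f x}.
Proof.
by move=> t0 rf; apply: filterS (rint_kernel_mu t0 rf) => x; exact: Rint_scale.
Qed.

Lemma pt_add_ae s t f : 0 <= s -> 0 <= t -> rint mu f ->
  {ae mu, forall x, pt (s + t) f x = pt s (pt t f) x}.
Proof.
move=> s0 t0 rf; apply: filterS (rint_kernel_mu (addr_ge0 s0 t0) rf) => x.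
exact: pt_add.
Qed.

Lemma nrm_ptB t f g : 0 <= t -> sqint f -> sqint g ->
  nrm (pt t f - pt t g) <= nrm (f - g).
Proof.
move=> t0 sf sg; have := nrm_pt t0 (sqintB sf sg).
have [sp sq] := (sqint_pt t0 sf, sqint_pt t0 sg).
rewrite (@nrm_eq_ae _ _ _ mu _ (pt t f - pt t g))//.
- by case: (sqint_pt t0 (sqintB sf sg)).
- by case: (sqintB sp sq).
- by apply: filterS (ptB_ae t0 (sqint_rint sf) (sqint_rint sg)) => x ->.
Qed.

Lemma nrm_pt_shift a r f : 0 <= a -> 0 <= r -> sqint f ->
  nrm (pt (a + r) f - pt a f) <= nrm (pt r f - f).
Proof.
move=> a0 r0 sf; have srf := sqint_pt r0 sf.
apply: le_trans (nrm_ptB a0 srf sf).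
have sarf := sqint_pt (addr_ge0 a0 r0) sf.
have saf := sqint_pt a0 sf.
rewrite le_eqVlt; apply/orP; left; apply/eqP; apply: nrm_eq_ae.
- exact: sqint_measurable (sqintB sarf saf).
- exact: sqint_measurable (sqintB (sqint_pt a0 srf) saf).
by apply: filterS (pt_add_ae a0 r0 (sqint_rint sf)) => x;
  rewrite !pointwiseE => ->.
Qed.

(** [L f = g] for the generator [L] of the semigroup in L2; a relation, because
    [g] is determined only up to null sets. *)
Definition is_gen f g := [/\ sqint f, sqint g & forall e : R, 0 < e ->
  \forall t \near 0^'+, nrm (pt t f - f - t *: g) <= e * t].

Lemma is_gen_unique f g g' : is_gen f g -> is_gen f g' -> nrm (g - g') = 0.
Proof.
move=> [sf sg fg] [_ sg' fg']; apply/eqP; rewrite eq_le nrm_ge0 andbT.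
apply/ler_addgt0Pr => e e0; rewrite add0r.
have e2 : 0 < e / 2 by rewrite divr_gt0.
have [t [t0 _ A B]] := near_right0_min (fg _ e2) (fg' _ e2) ltr01.
have spt := sqint_pt (ltW t0) sf.
have s1 : sqint (pt t f - f - t *: g).
  by apply: sqintB; [exact: sqintB|exact: sqintZ].
have s2 : sqint (pt t f - f - t *: g').
  by apply: sqintB; [exact: sqintB|exact: sqintZ].
rewrite -(ler_pM2l t0) -[t in t * _]gtr0_norm// -nrmZ; last exact: sqintB.
have -> : t *: (g - g') = (pt t f - f - t *: g') - (pt t f - f - t *: g).
  by apply/funext => x; rewrite !pointwiseE; ring.
apply: le_trans (nrmB s2 s1) _; lra.
Qed.

Lemma is_genD f g f1 g1 c : is_gen f f1 -> is_gen g g1 ->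
  is_gen (f + c *: g) (f1 + c *: g1).
Proof.
move=> [sf sf1 ff1] [sg sg1 gg1]; split.
- by apply: sqintD => //; exact: sqintZ.
- by apply: sqintD => //; exact: sqintZ.
move=> e e0; pose e' := e / (1 + `|c|).
have c1 : 0 < 1 + `|c| by rewrite ltr_pwDl.
have e'0 : 0 < e' by rewrite divr_gt0.
near=> t; have t0 : 0 < t by near: t; exact: nbhs_right_gt.
have A : nrm (pt t f - f - t *: f1) <= e' * t by near: t; exact: ff1.
have B : nrm (pt t g - g - t *: g1) <= e' * t by near: t; exact: gg1.
have [pf pg] := (sqint_pt (ltW t0) sf, sqint_pt (ltW t0) sg).
have scg := sqintZ c sg.
have s1 : sqint (pt t f - f - t *: f1).
  by apply: sqintB; [exact: sqintB|exact: sqintZ].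
have s2 : sqint (pt t g - g - t *: g1).
  by apply: sqintB; [exact: sqintB|exact: sqintZ].
rewrite (@nrm_eq_ae _ _ _ mu _
    ((pt t f - f - t *: f1) + c *: (pt t g - g - t *: g1))).
- apply: le_trans (nrmD s1 (sqintZ c s2)) _; rewrite nrmZ//.
  have -> : e * t = e' * t + `|c| * (e' * t) by rewrite /e'; field; rewrite gt_eqF.
  by rewrite lerD// ler_wpM2l.
- apply: (proj1 (_ : sqint _)); apply: sqintB.
    by apply: sqintB; [apply: (sqint_pt (ltW t0))|]; exact: sqintD.
  by apply: sqintZ; apply: sqintD => //; exact: sqintZ.
- by apply: (proj1 (_ : sqint _)); apply: sqintD => //; exact: sqintZ.
- apply: filterS2 (ptD_ae (ltW t0) (sqint_rint sf) (sqint_rint scg))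
    (ptZ_ae c (ltW t0) (sqint_rint sg)) => x E1 E2.
  by rewrite !pointwiseE E1 E2; ring.
Unshelve. all: by end_near. Qed.

Lemma is_gen_pt b f g : 0 <= b -> is_gen f g -> is_gen (pt b f) (pt b g).
Proof.
move=> b0 [sf sg fg]; have [pf pg] := (sqint_pt b0 sf, sqint_pt b0 sg).
split=> // e e0; near=> t; have t0 : 0 < t by near: t; exact: nbhs_right_gt.
have A : nrm (pt t f - f - t *: g) <= e * t by near: t; exact: fg.
apply: le_trans A; have ptf := sqint_pt (ltW t0) sf.
have sfg := sqintB ptf sf; have stg := sqintZ t sg.
apply: le_trans (nrm_pt b0 (sqintB sfg stg)).
rewrite le_eqVlt; apply/orP; left; apply/eqP; apply: nrm_eq_ae.
- apply: (proj1 (_ : sqint _)); apply: sqintB; last exact: sqintZ.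
  by apply: sqintB => //; exact: (sqint_pt (ltW t0)).
- by apply: (proj1 (_ : sqint _)); apply: sqint_pt => //; exact: sqintB.
have E1 := ptB_ae b0 (sqint_rint sfg) (sqint_rint stg).
have E2 := ptB_ae b0 (sqint_rint ptf) (sqint_rint sf).
have E3 := ptZ_ae t b0 (sqint_rint sg).
have E4 := pt_add_ae (ltW t0) b0 (sqint_rint sf).
have E5 := pt_add_ae b0 (ltW t0) (sqint_rint sf).
apply: filterS2 E1 (filterI E2 (filterI E3 (filterI E4 E5))) => x e1 [e2 [e3 [e4 e5]]].
by rewrite e1 !pointwiseE e2 e3 -e4 -e5 (addrC t b).
Unshelve. all: by end_near. Qed.

Hypothesis strong : forall f, sqint f -> forall e : R, 0 < e ->
  \forall t \near 0^'+, nrm (pt t f - f) <= e.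

Local Ltac sq := solve [repeat (first [assumption | exact: ltW | apply: sqintB
  | apply: sqintD | apply: sqintZ | apply: sqint_pt])].
Local Ltac mq := apply: (proj1 (_ : sqint _)); sq.

(** The first order smallness that starts the halving argument of [taylor2]. *)
Lemma is_gen_remainder w w1 w2 e : sqint w2 -> is_gen w w1 -> 0 < e ->
  \forall t \near 0^'+,
    nrm (pt t w - w - t *: w1 - (t ^+ 2 / 2) *: w2) <= e * t.
Proof.
move=> sw2 [sw sw1 ww1] e0; have e2 : 0 < e / 2 by rewrite divr_gt0.
have c1 : 0 < nrm w2 + 1 by rewrite ltr_pwDr// nrm_ge0.
near=> t; have t0 : 0 < t by near: t; exact: nbhs_right_gt.
have A : nrm (pt t w - w - t *: w1) <= e / 2 * t by near: t; exact: ww1.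
have B : t <= e / (nrm w2 + 1).
  by near: t; apply: nbhs_right_le; rewrite divr_gt0.
rewrite ler_pdivlMr// in B.
have s1 : sqint (pt t w - w - t *: w1) by sq.
apply: le_trans (nrmB s1 (sqintZ (t ^+ 2 / 2) sw2)) _.
rewrite nrmZ// ger0_norm ?divr_ge0 ?sqr_ge0//.
have n2 := nrm_ge0 mu w2.
have : t * (t * (nrm w2 + 1)) <= t * e by rewrite ler_pM2l.
have : 0 <= t ^+ 2 by rewrite sqr_ge0.
nra.
Unshelve. all: by end_near. Qed.

(** Writing the remainder over [2 d] as the sum of the remainder over [d] and
    of its image under [pt d] makes it quasi-additive, so that
    [halving_second_order] applies. *)
Lemma taylor2 w w1 w2 e : is_gen w w1 -> is_gen w1 w2 -> 0 < e ->
  \forall t \near 0^'+,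
    nrm (pt t w - w - t *: w1 - (t ^+ 2 / 2) *: w2) <= e * t ^+ 2.
Proof.
move=> ww1 w12 e0; have [sw sw1 _] := ww1; have [_ sw2 cvg1] := w12.
apply: (@halving_second_order _ (fun t =>
  nrm (pt t w - w - t *: w1 - (t ^+ 2 / 2) *: w2))); first exact: ltW.
  have e4 : 0 < e / 2 by rewrite divr_gt0.
  have [a a0 Ha] := (near_right0P _).1 (cvg1 _ e4).
  have [b b0 Hb] := (near_right0P _).1 (strong sw2 e4).
  apply/near_right0P; exists (Num.min a b); first by rewrite lt_min a0.
  move=> t; rewrite lt_min => t0 /andP[ta tb].
  set h := t / 2; have h0 : 0 < h by rewrite divr_gt0.
  have hE : t = h + h by rewrite -splitr.
  have A : nrm (pt h w1 - w1 - h *: w2) <= e / 2 * h by apply: Ha => //; lra.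
  have B : nrm (pt h w2 - w2) <= e / 2 by apply: Hb => //; lra.
  set r := pt h w - w - h *: w1 - (h ^+ 2 / 2) *: w2.
  have sr : sqint r by rewrite /r; sq.
  have ht := ltW h0; have spr := sqint_pt ht sr.
  have sA : sqint (pt h w1 - w1 - h *: w2) by sq.
  have sB : sqint (pt h w2 - w2) by sq.
  rewrite (@nrm_eq_ae _ _ _ mu _ ((r + pt h r)
      + (h *: (pt h w1 - w1 - h *: w2) + (h ^+ 2 / 2) *: (pt h w2 - w2)))).
  - apply: le_trans (nrmD (sqintD sr spr) _) _; first by sq.
    apply: le_trans (lerD (nrmD sr spr) (nrmD (sqintZ h sA) (sqintZ _ sB))) _.
    rewrite !nrmZ// !ger0_norm ?divr_ge0 ?sqr_ge0//.
    have C := nrm_pt ht sr.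
    have D : h * nrm (pt h w1 - w1 - h *: w2) <= h * (e / 2 * h).
      by rewrite ler_pM2l.
    have E : h ^+ 2 / 2 * nrm (pt h w2 - w2) <= h ^+ 2 / 2 * (e / 2).
      by rewrite ler_wpM2l// divr_ge0// sqr_ge0.
    have -> : t ^+ 2 = 4 * h ^+ 2 by rewrite hE; ring.
    have : 0 <= e * h ^+ 2 by rewrite mulr_ge0 ?sqr_ge0// ltW.
    lra.
  - exact: ltW.
  - by mq.
  - by mq.
  have E1 := pt_add_ae ht ht (sqint_rint sw).
  have s1 : sqint (w + h *: w1) by sq.
  have s2 : sqint (w + h *: w1 + (h ^+ 2 / 2) *: w2) by sq.
  have E2 := ptD_ae ht (sqint_rint s2) (sqint_rint sr).
  have E3 := ptD_ae ht (sqint_rint s1) (sqint_rint (sqintZ (h ^+ 2 / 2) sw2)).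
  have E4 := ptD_ae ht (sqint_rint sw) (sqint_rint (sqintZ h sw1)).
  have E5 := ptZ_ae h ht (sqint_rint sw1).
  have E6 := ptZ_ae (h ^+ 2 / 2) ht (sqint_rint sw2).
  apply: filterS2 (filterI E1 (filterI E2 E3)) (filterI E4 (filterI E5 E6)) => x.
  move=> [e1 [e2 e3]] [e4' [e5 e6]].
  have hw : pt h w = w + h *: w1 + (h ^+ 2 / 2) *: w2 + r.
    by apply/funext => y; rewrite /r !pointwiseE; ring.
  have e7 : pt t w x = pt h w x + h * pt h w1 x + h ^+ 2 / 2 * pt h w2 x
      + pt h r x.
    by rewrite hE e1 [in LHS]hw e2 e3 e4' e5 e6.
  have rx : r x = pt h w x - w x - h * w1 x - h ^+ 2 / 2 * w2 x by [].
  by rewrite !pointwiseE e7 rx hE; field.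
move=> e' e'0; exact: is_gen_remainder.
Qed.

(** If [G = Gamma g], then [V = L G], [W = L (g * L g)] and the second order
    coefficient is [Gamma_2 g]. The terms of order 0 and 1 cancel when [pt t g]
    and [pt t (g * g)] are expanded; the error is only in L1 because it contains
    the square of the remainder of [pt t g]. *)
Lemma second_order M g g1 g2 G V W e :
  0 <= M -> bounded_by M g -> is_gen g g1 -> is_gen g1 g2 ->
  is_gen (g * g) (G + 2 *: (g * g1)) -> is_gen G V -> is_gen (g * g1) W ->
  0 < e -> \forall t \near 0^'+,
  nrm1 mu (pt t g * pt t g - pt t (g * g) + t *: pt t G
    - t ^+ 2 *: (2^-1 *: V - W + g1 * g1 + g * g2)) <= e * t ^+ 2.
Proof.
move=> M0 bg gg1 g12 gg GV gW e0.
have [sg sg1 _] := gg1; have [_ sg2 _] := g12; have [sG sV GV'] := GV.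
have [sgg1 sW _] := gW; have [sgg sw1 _] := gg.
have w12 := is_genD 2 GV gW.
pose C := 2 * M + 2 * nrm g1 + 3.
have C0 : 0 < C by rewrite /C; have := nrm_ge0 mu g1; lra.
pose k := Num.min 1 (e / C).
have k0 : 0 < k by rewrite lt_min ltr01 divr_gt0.
have k1 : k <= 1 by rewrite ge_min lexx.
have kC : k * C <= e by rewrite -ler_pdivlMr// ge_min lexx orbT.
near=> t; have t0 : 0 < t by near: t; exact: nbhs_right_gt.
have tt := ltW t0.
have : nrm (pt t g - g - t *: g1 - (t ^+ 2 / 2) *: g2) <= k * t ^+ 2.
  by near: t; exact: (taylor2 gg1 g12 k0).
have : nrm (pt t (g * g) - g * g - t *: (G + 2 *: (g * g1))
    - (t ^+ 2 / 2) *: (V + 2 *: W)) <= k * t ^+ 2.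
  by near: t; exact: (taylor2 gg w12 k0).
have : nrm (pt t g - g - t *: g1) <= k * t.
  by near: t; case: gg1 => _ _; exact.
have : nrm (pt t G - G - t *: V) <= k * t by near: t; exact: GV'.
set a := pt t g; set s := (pt t G - _ - _); set q := a - g - t *: g1.
set r1 := (pt t (g * g) - _ - _ - _); set r := (q - _) => Hs Hq Hr1 Hr.
have sa : sqint a by rewrite /a; sq.
have sq' : sqint q by rewrite /q; sq.
have sr : sqint r by rewrite /r; sq.
have sr1 : sqint r1 by rewrite /r1; sq.
have ss : sqint s by rewrite /s; sq.
have -> : a * a - pt t (g * g) + t *: pt t G
    - t ^+ 2 *: (2^-1 *: V - W + g1 * g1 + g * g2)
  = 2 *: (g * r) + (q * (q + (2 * t) *: g1) + ((t *: s) - r1)).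
  by apply/funext => x; rewrite /r1 /s /r /q !pointwiseE; field.
have rgr := sqint_mul sg sr.
have rq := sqint_mul sq' (sqintD sq' (sqintZ (2 * t) sg1)).
have s3 : sqint (t *: s - r1) by sq.
apply: le_trans (nrm1D (rintZ 2 rgr) (rintD rq (sqint_rint s3))) _.
apply: le_trans (lerD (lexx _) (nrm1D rq (sqint_rint s3))) _.
rewrite nrm1Z// ger0_norm//.
have A1 : nrm1 mu (g * r) <= M * (k * t ^+ 2).
  apply: le_trans (nrm1_mulM bg (sqint_rint sr)) _.
  by rewrite ler_wpM2l// (le_trans (nrm1_le_nrm sr)).
have A2 : nrm1 mu (q * (q + (2 * t) *: g1)) <= k * t * (k * t + 2 * t * nrm g1).
  apply: le_trans (nrm1_mul sq' (sqintD sq' (sqintZ (2 * t) sg1))) _.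
  apply: ler_pM => //; try exact: nrm_ge0.
  apply: le_trans (nrmD sq' (sqintZ (2 * t) sg1)) _.
  by rewrite nrmZ// ger0_norm ?mulr_ge0// lerD.
have A3 : nrm1 mu (t *: s - r1) <= t * (k * t) + k * t ^+ 2.
  apply: le_trans (nrm1_le_nrm s3) _; apply: le_trans (nrmB (sqintZ t ss) sr1) _.
  by rewrite nrmZ// gtr0_norm// lerD// ler_pM2l.
have t2 : 0 <= t ^+ 2 by rewrite sqr_ge0.
have : k * C * t ^+ 2 <= e * t ^+ 2 by rewrite ler_wpM2r.
have : k * k * t ^+ 2 <= 1 * k * t ^+ 2 by rewrite !ler_wpM2r// ltW.
rewrite /C; nra.
Unshelve. all: by end_near. Qed.

End Operators.

(** * The reverse local Poincare inequality *)

Section ReversePoincare.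
Context {d} {T : measurableType d} {R : realType}.
Variables (Q : R -> T -> giry T R) (QP : transition_kernels Q).
Variable mu : probability T R.
Hypothesis inv : forall t (B : set T), 0 <= t -> measurable B ->
  (\int[mu]_x Q t x B = mu B)%E.
Local Notation pt := (pt Q).
Local Notation law := (law QP).
Local Notation nrm := (nrm mu).
Local Notation sqint := (sqint mu).
Local Notation is_gen := (is_gen Q mu).
Hypothesis strong : forall f, sqint f -> forall e : R, 0 < e ->
  \forall t \near 0^'+, nrm (pt t f - f) <= e.
Implicit Types (f g w : T -> R) (s t c M : R).

(** [Gamma_2 g >= rho * Gamma g] with [G = Gamma g], stated through witnesses for
    the values of the generator: [g1 = L g], [g2 = L g1], [V = L G] and
    [W = L (g * g1)], for which [Gamma (g, L g) = W - g * g2 - g1 ^+ 2]. *)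
Definition bakry_emery (rho : R) g G := exists g1 g2 V W,
  [/\ is_gen g g1, is_gen g1 g2, is_gen (g * g) (G + 2 *: (g * g1)),
      is_gen G V /\ is_gen (g * g1) W
    & {ae mu, forall x,
        rho * G x <= (2^-1 *: V - W + g1 * g1 + g * g2) x}].

Variables (c : R) (p : giry T R) (dom : majorized c p mu).

Lemma rint_law a w : 0 <= a -> rint mu w -> rint (law p a) w.
Proof. by move=> a0; exact: (majorized_rint (majorized_law QP inv a0 dom)). Qed.

Lemma law_le a w w' : 0 <= a -> rint mu w -> rint mu w' ->
  `|\int[law p a]_x w x - \int[law p a]_x w' x| <= c * nrm1 mu (w - w').
Proof.
move=> a0 rw rw'; rewrite -Rint_sub; [|exact: rint_law..].
exact: (majorized_le (majorized_law QP inv a0 dom) (rintB rw rw')).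
Qed.

Lemma law_pt a r w : 0 <= a -> 0 <= r -> rint mu w ->
  \int[law p (a + r)]_x w x = \int[law p a]_x pt r w x.
Proof.
move=> a0 r0 rw; rewrite (integral_pt (QP := QP)).
  by congr fine; apply/esym; exact: law_add.
have [mw wy] := integrableP _ _ _ (rint_law (addr_ge0 a0 r0) rw).
apply/integrableP; split=> //; apply: le_lt_trans wy.
by rewrite le_eqVlt; apply/orP; left; apply/eqP; exact: law_add.
Qed.

Lemma law_shift a r w : 0 <= a -> 0 <= r -> sqint w ->
  `|\int[law p (a + r)]_x w x - \int[law p a]_x w x| <= c * nrm (pt r w - w).
Proof.
move=> a0 r0 sw; have sp := sqint_pt QP inv r0 sw.
rewrite (law_pt a0 r0 (sqint_rint sw)).
apply: le_trans (law_le a0 (sqint_rint sp) (sqint_rint sw)) _.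
rewrite ler_wpM2l//; first by case: dom.
exact: nrm1_le_nrm (sqintB sp sw).
Qed.

Lemma law_time0 w : measurable_fun setT w ->
  \int[law p 0]_x w x = \int[p]_x w x.
Proof.
move=> mw; congr fine; apply: eq_measure_integral => B mB _.
rewrite [LHS]lawE//; under eq_integral => x _ do rewrite (tk_0 QP)//.
by rewrite integral_indic// setIT.
Qed.

Variables (rho M : R) (f : T -> R) (G : R -> T -> R).
Hypothesis rho0 : 0 <= rho.
Hypothesis M0 : 0 <= M.
Hypothesis bf : bounded_by M f.
Hypothesis cd : forall s, 0 <= s -> bakry_emery rho (pt s f) (G s).

Let bpt s : bounded_by M (pt s f). Proof. exact: pt_bounded. Qed.
Let sf : sqint f. Proof. exact: bounded_sqint bf. Qed.
Let spt s : sqint (pt s f). Proof. exact: bounded_sqint (bpt s). Qed.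
Let spt2 s : sqint (pt s f * pt s f). Proof. exact: sqintM (bpt s) (spt s). Qed.
Let sG s : 0 <= s -> sqint (G s).
Proof. by move=> /cd[? [? [? [? [_ _ _ [[]]]]]]]. Qed.
Let c0 : 0 <= c. Proof. by case: dom. Qed.

Let pt_addE a b : 0 <= a -> 0 <= b -> pt (a + b) f = pt a (pt b f).
Proof.
move=> a0 b0; apply/funext => x; apply: (pt_add QP) => //.
exact: rint_bounded bf.
Qed.

Variable t : R.
Hypothesis t0 : 0 < t.

(* psi goes from the integral of (pt t f) ^+ 2 for p to that of f ^+ 2 for the
   law at time t; phi is its derivative. *)
Let psi s := \int[law p s]_x (pt (t - s) f * pt (t - s) f) x.
Let phi s := \int[law p s]_x G (t - s) x.

Let psi_before s h : s <= t -> 0 <= h -> psi (s - h)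
  = \int[law p (s - h)]_x (pt h (pt (t - s) f) * pt h (pt (t - s) f)) x.
Proof.
move=> st h0; rewrite /psi (_ : t - (s - h) = h + (t - s)); last by ring.
by rewrite pt_addE// subr_ge0.
Qed.

Let law_before s h w : 0 <= s - h -> 0 <= h -> rint mu w ->
  \int[law p s]_x w x = \int[law p (s - h)]_x pt h w x.
Proof.
move=> sh h0 rw; rewrite -(law_pt sh h0 rw).
by congr (\int[law p _]_x w x); rewrite subrK.
Qed.

(** Going back from [s] to [s - h] applies [pt h] to the function
    [g = pt (t - s) f], which has all the regularity that [second_order] asks
    for; the curvature bound is applied to its second order coefficient. *)
Lemma psi_left : left_superquadratic rho psi phi t.
Proof.
move=> s /andP[s0 st] e e0.
have ts : 0 <= t - s by rewrite subr_ge0.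
have [g1 [g2 [V [W [gg1 g12 gg [GV gW] ineq]]]]] := cd ts.
pose k := e / (2 * (c + 1)); pose k' := e / (2 * (rho * c + 1)).
have k0 : 0 < k by rewrite divr_gt0// mulr_gt0// ltr_pwDr.
have k'0 : 0 < k' by rewrite divr_gt0// mulr_gt0// ltr_pwDr// mulr_ge0.
have near1 := second_order QP inv strong M0 (bpt _) gg1 g12 gg GV gW k0.
near=> h; have h0 : 0 < h by near: h; exact: nbhs_right_gt.
have hs : h < s by near: h; exact: nbhs_right_lt.
have H1 : nrm1 mu (pt h (pt (t - s) f) * pt h (pt (t - s) f)
    - pt h (pt (t - s) f * pt (t - s) f) + h *: pt h (G (t - s))
    - h ^+ 2 *: (2^-1 *: V - W + g1 * g1 + pt (t - s) f * g2)) <= k * h ^+ 2.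
  by near: h; exact: near1.
have H2 : nrm (pt h (G (t - s)) - G (t - s)) <= k'.
  by near: h; exact: strong (sG ts) _ k'0.
have h0' := ltW h0; have a0 : 0 <= s - h by rewrite subr_ge0 ltW.
move: H1 H2; set g := pt (t - s) f => H1 H2.
set gam := (_ + g * g2) in H1 ineq.
have sg := spt (t - s); rewrite -/g in sg.
have sgh := sqint_pt QP inv h0' sg.
have [_ sg1 _] := gg1; have [_ sg2 _] := g12.
have [_ sV _] := GV; have [_ sW _] := gW.
have rgam : rint mu gam.
  apply: rintD; last exact: sqint_mul.
  apply: rintD; last exact: sqint_mul.
  by apply: sqint_rint; apply: sqintB => //; exact: sqintZ.
have r1 : rint mu (pt h g * pt h g) by exact: sqint_mul.
have s2 : sqint (pt h (g * g)) by apply: sqint_pt => //; exact: spt2.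
have r2 := sqint_rint s2.
have s3 : sqint (pt h (G (t - s))) by apply: sqint_pt => //; exact: sG.
have r3 := sqint_rint s3.
have rG := sqint_rint (sG ts).
have L := rint_law a0.
have B1 : `|psi (s - h) - psi s + h * phi s
    - h ^+ 2 * \int[law p (s - h)]_x gam x| <= c * (k * h ^+ 2).
  rewrite psi_before// /phi /psi -/g !(law_before a0 h0')//; last exact: sqint_rint (spt2 _).
  rewrite -Rint_sub ?L// -Rint_scale ?L//.
  rewrite -Rint_add; [|exact/L/rintB|exact/L/rintZ].
  rewrite -Rint_scale ?L// -Rint_sub.
  - apply: le_trans (majorized_le (majorized_law QP inv a0 dom) _) _.
      by apply: rintB; [apply: rintD; [exact: rintB|exact: rintZ]|exact: rintZ].
    by rewrite ler_wpM2l.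
  - by apply: L; apply: rintD; [exact: rintB|exact: rintZ].
  - by apply: L; exact: rintZ.
have B2 : rho * \int[law p (s - h)]_x G (t - s) x
    <= \int[law p (s - h)]_x gam x.
  rewrite -Rint_scale ?L//; apply: Rint_le_ae; [exact/L/rintZ|exact: L|].
  by apply: (majorized_ae (majorized_law QP inv a0 dom)); exact: ineq.
have B3 : `|phi s - \int[law p (s - h)]_x G (t - s) x| <= c * k'.
  rewrite /phi (law_before a0 h0' rG); apply: le_trans (law_le a0 r3 rG) _.
  rewrite ler_wpM2l//; apply: le_trans H2.
  by apply: nrm1_le_nrm; apply: sqintB => //; exact: sG.
have C1 : c * k <= e / 2.
  rewrite /k mulrA ler_pdivrMr ?mulr_gt0 ?ltr_pwDr//.
  have -> : e / 2 * (2 * (c + 1)) = c * e + e by field.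
  by rewrite lerDl ltW.
have C2 : rho * c * k' <= e / 2.
  rewrite /k' mulrA ler_pdivrMr ?mulr_gt0 ?ltr_pwDr ?mulr_ge0//.
  have -> : e / 2 * (2 * (rho * c + 1)) = rho * c * e + e by field.
  by rewrite lerDl ltW.
set A := \int[law p (s - h)]_x G (t - s) x in B2 B3.
set D := \int[law p (s - h)]_x gam x in B1 B2.
move: B1; rewrite ler_norml => /andP[B1 _].
move: B3; rewrite ler_norml => /andP[_ B3].
have B4 : rho * (phi s - A) <= rho * (c * k') by rewrite ler_wpM2l.
have B5 : rho * phi s - e / 2 <= D by lra.
have h2 : 0 <= h ^+ 2 by rewrite sqr_ge0.
have B6 : h ^+ 2 * (rho * phi s - e / 2) <= h ^+ 2 * D by rewrite ler_wpM2l.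
have B7 : h ^+ 2 * (c * k) <= h ^+ 2 * (e / 2) by rewrite ler_wpM2l.
lra.
Unshelve. all: by end_near. Qed.

Lemma psi_continuous : continuous_upto psi t.
Proof.
move=> s /andP[s0 st] e e0; set g := pt (t - s) f.
have ts : 0 <= t - s by rewrite subr_ge0.
have sg : sqint g by exact: spt.
have cM : 0 < 2 * (c * (2 * M) + 1) by rewrite mulr_gt0 ?ltr_pwDr ?mulr_ge0.
have cc : 0 < 2 * (c + 1) by rewrite mulr_gt0 ?ltr_pwDr.
pose k := e / (2 * (c * (2 * M) + 1)); pose k' := e / (2 * (c + 1)).
have k0 : 0 < k by rewrite divr_gt0.
have k'0 : 0 < k' by rewrite divr_gt0.
have C1 : c * (2 * M * k) <= e / 2.
  rewrite /k mulrA mulrA ler_pdivrMr//.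
  have -> : e / 2 * (2 * (c * (2 * M) + 1)) = c * (2 * M) * e + e by field.
  by rewrite lerDl ltW.
have C2 : c * k' <= e / 2.
  rewrite /k' mulrA ler_pdivrMr//.
  have -> : e / 2 * (2 * (c + 1)) = c * e + e by field.
  by rewrite lerDl ltW.
have [a a0 Ha] := (near_right0P _).1 (strong sf k0).
have [b b0 Hb] := (near_right0P _).1 (strong (spt2 (t - s)) k'0).
exists (Num.min a b) => [|u /andP[u0 ut]]; first by rewrite lt_min a0.
have [->|us] := eqVneq u s; first by rewrite !subrr normr0 => _; exact: ltW.
rewrite lt_min => /andP[ua ub]; set r := `|u - s| in ua ub.
have r0 : 0 < r by rewrite normr_gt0 subr_eq0.
have tu : 0 <= t - u by rewrite subr_ge0.
have A : nrm (pt (t - u) f - g) <= k.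
  apply: le_trans (Ha _ r0 ua); rewrite /g.
  have [us'|us'] := ltP u s.
    have -> : t - u = (t - s) + r by rewrite /r ltr0_norm ?subr_lt0//; ring.
    by apply: (nrm_pt_shift QP inv) => //; exact: ltW.
  have -> : t - s = (t - u) + r by rewrite /r ger0_norm ?subr_ge0//; ring.
  by rewrite nrmBC; apply: (nrm_pt_shift QP inv) => //; exact: ltW.
have B : `|\int[law p u]_x (g * g) x - \int[law p s]_x (g * g) x| <= c * k'.
  apply: (@le_trans _ _ (c * nrm (pt r (g * g) - g * g))); last first.
    by rewrite ler_wpM2l// Hb.
  have [us'|us'] := ltP u s.
    have -> : s = u + r by rewrite /r ltr0_norm ?subr_lt0//; ring.
    by rewrite distrC; apply: law_shift; [|exact: ltW|exact: spt2].
  have -> : u = s + r by rewrite /r ger0_norm ?subr_ge0//; ring.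
  by apply: law_shift; [|exact: ltW|exact: spt2].
have C : `|psi u - \int[law p u]_x (g * g) x| <= c * (2 * M * k).
  have sh := spt (t - u).
  apply: le_trans (law_le u0 (sqint_rint (spt2 _)) (sqint_rint (spt2 _))) _.
  rewrite ler_wpM2l// -/g.
  rewrite (_ : _ - _ = (pt (t - u) f + g) * (pt (t - u) f - g)); last first.
    by apply/funext => x; rewrite !pointwiseE; ring.
  have bsum : bounded_by (2 * M) (pt (t - u) f + g).
    have [m1 b1] := bpt (t - u); have [m2 b2] := bpt (t - s).
    split=> [|x]; first exact: measurable_funD.
    rewrite !pointwiseE (le_trans (ler_normD _ _))// mulr2n mulrDl mul1r.
    by rewrite lerD// b2.
  have sd := sqintB sh sg.
  apply: le_trans (nrm1_mulM bsum (sqint_rint sd)) _.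
  by rewrite ler_wpM2l ?mulr_ge0// (le_trans (nrm1_le_nrm sd)).
have -> : psi u - psi s = (psi u - \int[law p u]_x (g * g) x)
  + (\int[law p u]_x (g * g) x - \int[law p s]_x (g * g) x) by rewrite /psi; ring.
apply: le_trans (ler_normD _ _) _; lra.
Qed.

(** To the right of [s] the function [pt (t - s - h) f] is not obtained from
    [g = pt (t - s) f] by applying a kernel; its first order expansion is pulled
    back from that of [f]. *)
Lemma pt_backward b f1 g1 e : 0 < b -> is_gen f f1 -> is_gen (pt b f) g1 ->
  0 < e -> \forall h \near 0^'+,
    nrm (pt (b - h) f - pt b f + h *: g1) <= e * h.
Proof.
move=> b0 ff1 gg1 e0; have [_ sf1 cvf] := ff1; have [_ sg1 _] := gg1.
have e2 : 0 < e / 2 by rewrite divr_gt0.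
have E0 : nrm (pt b f1 - g1) <= 0.
  rewrite le_eqVlt (is_gen_unique QP inv (is_gen_pt QP inv (ltW b0) ff1) gg1) eqxx//.
near=> h; have h0 : 0 < h by near: h; exact: nbhs_right_gt.
have hb : h < b by near: h; exact: nbhs_right_lt.
have A : nrm (pt h f - f - h *: f1) <= e / 2 * h by near: h; exact: cvf.
have B : nrm (pt h f1 - f1) <= e / 2 by near: h; exact: strong.
have a0 : 0 <= b - h by rewrite subr_ge0 ltW.
have h0' := ltW h0; have bE : b = (b - h) + h by rewrite subrK.
have shf := sqint_pt QP inv h0' sf.
have shf1 := sqint_pt QP inv h0' sf1.
have sbf1 := sqint_pt QP inv (ltW b0) sf1.
have sdiff := sqintB (sqintB shf sf) (sqintZ h sf1).
have s1 := sqint_pt QP inv a0 sdiff.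
have sh1 := sqintB shf1 sf1.
have s2 := sqint_pt QP inv a0 sh1.
have s3 := sqintB sbf1 sg1.
rewrite (@nrm_eq_ae _ _ _ mu _ ((h *: pt (b - h) (pt h f1 - f1)
    - pt (b - h) (pt h f - f - h *: f1)) - h *: (pt b f1 - g1))).
- apply: le_trans (nrmB (sqintB (sqintZ h s2) s1) (sqintZ h s3)) _.
  apply: le_trans (lerD (nrmB (sqintZ h s2) s1) (lexx _)) _.
  rewrite !nrmZ// gtr0_norm//.
  have : h * nrm (pt b f1 - g1) <= 0 by rewrite pmulr_rle0.
  have A' := nrm_pt QP inv a0 sdiff.
  have B' : h * nrm (pt (b - h) (pt h f1 - f1)) <= h * (e / 2).
    rewrite ler_pM2l//; apply: le_trans B; exact: (nrm_pt QP inv a0 sh1).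
  lra.
- exact: sqint_measurable (sqintD (sqintB (spt (b - h)) (spt b)) (sqintZ h sg1)).
- exact: sqint_measurable (sqintB (sqintB (sqintZ h s2) s1) (sqintZ h s3)).
have F1 := ptB_ae QP inv a0 (sqint_rint shf1) (sqint_rint sf1).
have F2 := ptB_ae QP inv a0 (sqint_rint (sqintB shf sf))
  (sqint_rint (sqintZ h sf1)).
have F3 := ptB_ae QP inv a0 (sqint_rint shf) (sqint_rint sf).
have F4 := ptZ_ae QP inv h a0 (sqint_rint sf1).
have F5 := pt_add_ae QP inv a0 h0' (sqint_rint sf1).
have F6 := pt_add_ae QP inv a0 h0' (sqint_rint sf).
apply: filterS2 (filterI F1 (filterI F2 F3)) (filterI F4 (filterI F5 F6)) => x.
rewrite -!bE => -[e1 [e2' e3]] [e4 [e5 e6]].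
by rewrite !pointwiseE e1 e2' e3 e4 -e5 -e6; ring.
Unshelve. all: by end_near. Qed.

Lemma psi_right : right_derivable psi phi t.
Proof.
move=> s /andP[s0 st] e e0.
have ts : 0 < t - s by rewrite subr_gt0.
have ts' := ltW ts.
have [g1 [g2 [V [W [gg1 g12 gg [GV gW] ineq]]]]] := cd ts'.
move: gg1 g12 gg GV gW ineq; set g := pt (t - s) f => gg1 g12 gg GV gW ineq.
have [f1 ff1] : exists f1, is_gen f f1.
  have [f1 [? [? [? [ff1 _ _ _ _]]]]] := cd (lexx 0).
  exists f1; move: ff1; congr is_gen; apply/funext => x.
  by apply: (pt0 QP); case: bf.
have [_ sg1 _] := gg1; have [sgg sw1 cvgg] := gg.
have [sgg1 sW _] := gW; have [sG' _ _] := GV.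
pose n := nrm g1; have n0 : 0 <= n by exact: nrm_ge0.
pose K := 2 * M + 4.
have K0 : 0 < K by rewrite /K ltr_wpDl// mulr_ge0.
have cK : 0 < c * K + 1 by rewrite ltr_pwDr// mulr_ge0// ltW.
pose k := e / (c * K + 1).
have k0 : 0 < k by rewrite divr_gt0.
have cKk : c * K * k <= e.
  rewrite /k mulrA ler_pdivrMr//.
  have -> : e * (c * K + 1) = c * K * e + e by ring.
  by rewrite lerDl ltW.
clearbody k.
have kn : 0 < (k + n) ^+ 2 by apply: exprn_gt0; exact: ltr_wpDr.
have near1 := pt_backward ts ff1 gg1 k0.
near=> h; have h0 : 0 < h by near: h; exact: nbhs_right_gt.
have h0' := ltW h0.
have hts : h < t - s by near: h; exact: nbhs_right_lt.
have H1 : nrm (pt (t - s - h) f - g + h *: g1) <= k * h.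
  by near: h; exact: near1.
have H2 : nrm (pt h (g * g1) - g * g1) <= k.
  by near: h; exact: strong.
have H3 : nrm (pt h (g * g) - g * g
    - h *: (G (t - s) + 2 *: (g * g1))) <= k * h.
  by near: h; exact: cvgg.
have H4 : h * (k + n) ^+ 2 <= k.
  rewrite -ler_pdivlMr//; near: h; apply: nbhs_right_le; rewrite divr_gt0//.
set u := pt (t - s - h) f in H1.
have sg : sqint g by exact: spt.
have su : sqint u by exact: spt.
have bg : bounded_by M g by exact: bpt.
have sh0 : 0 <= s + h by rewrite addr_ge0.
pose w := g * g - (2 * h) *: (g * g1).
have sw : sqint w by apply: sqintB => //; exact: sqintZ.
(* Expansion of the function u in L2. *)
have D1 : `|psi (s + h) - \int[law p (s + h)]_x w x| <= c * (2 * M * k * h + k * h).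
  rewrite /psi opprD addrA.
  apply: le_trans (law_le sh0 (sqint_rint (spt2 _)) (sqint_rint sw)) _.
  rewrite ler_wpM2l// -/u.
  have sv : sqint (u - g + h *: g1).
    by apply: sqintD; [exact: sqintB|exact: sqintZ].
  have sug : sqint (u - g) by exact: sqintB.
  have rgv := sqint_mul sg sv; have ruu := sqint_mul sug sug.
  rewrite (_ : _ - _ = 2 *: (g * (u - g + h *: g1)) + (u - g) * (u - g)); last first.
    by apply/funext => x; rewrite /w !pointwiseE; ring.
  apply: le_trans (nrm1D (rintZ 2 rgv) ruu) _; apply: lerD.
    rewrite nrm1Z// ger0_norm// -!mulrA ler_pM2l//.
    apply: le_trans (nrm1_mulM bg (sqint_rint sv)) _.
    by rewrite ler_wpM2l// (le_trans (nrm1_le_nrm sv)).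
  have ug : nrm (u - g) <= h * (k + n).
    rewrite (_ : u - g = (u - g + h *: g1) - h *: g1); last by rewrite addrK.
    apply: le_trans (nrmB sv (sqintZ h sg1)) _.
    by rewrite nrmZ// gtr0_norm// mulrDr lerD// mulrC.
  apply: le_trans (nrm1_mul sug sug) _.
  apply: (@le_trans _ _ (h * (k + n) * (h * (k + n)))).
    by apply: ler_pM => //; exact: nrm_ge0.
  rewrite (_ : _ * _ = h * (h * (k + n) ^+ 2)); last by ring.
  by rewrite mulrC ler_pM2r.
(* Expansion of the law between s and s + h. *)
have D2 : `|\int[law p (s + h)]_x w x
    - \int[law p s]_x (g * g + h *: G (t - s)) x| <= c * (k * h + 2 * h * k).
  rewrite law_pt//; last exact: sqint_rint.
  have spw := sqint_pt QP inv h0' sw.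
  have sGG : sqint (g * g + h *: G (t - s)) by apply: sqintD => //; exact: sqintZ.
  apply: le_trans (law_le s0 (sqint_rint spw) (sqint_rint sGG)) _.
  rewrite ler_wpM2l//; apply: le_trans (nrm1_le_nrm (sqintB spw sGG)) _.
  have sp1 := sqint_pt QP inv h0' sgg; have sp2 := sqint_pt QP inv h0' sgg1.
  have sa := sqintB (sqintB sp1 sgg) (sqintZ h sw1).
  have sb := sqintB sp2 sgg1.
  rewrite (@nrm_eq_ae _ _ _ mu _ ((pt h (g * g) - g * g
      - h *: (G (t - s) + 2 *: (g * g1))) - (2 * h) *: (pt h (g * g1) - g * g1))).
  - apply: le_trans (nrmB sa (sqintZ _ sb)) _.
    by rewrite nrmZ// ger0_norm ?mulr_ge0// lerD// ler_wpM2l ?mulr_ge0.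
  - exact: sqint_measurable (sqintB spw sGG).
  - exact: sqint_measurable (sqintB sa (sqintZ (2 * h) sb)).
  apply: filterS2 (ptB_ae QP inv h0' (sqint_rint sgg)
      (sqint_rint (sqintZ (2 * h) sgg1)))
    (ptZ_ae QP inv (2 * h) h0' (sqint_rint sgg1)) => x e1 e2.
  by rewrite !pointwiseE e1 e2; ring.
have D3 : \int[law p s]_x (g * g + h *: G (t - s)) x = psi s + h * phi s.
  rewrite Rint_add ?Rint_scale//; [exact/rint_law/sqint_rint|
    exact/rint_law/sqint_rint|apply: rintZ; exact/rint_law/sqint_rint].
rewrite D3 in D2.
move: D1 D2; rewrite !ler_norml => /andP[D1 _] /andP[D2 _].
have : h * (c * K * k) <= h * e by rewrite ler_pM2l.
by rewrite /K; lra.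
Unshelve. all: by end_near. Qed.

(** The increment of [psi] over [0, t] is at least [kappa rho t] times its initial
    slope, which is the integral of the gradient of [pt t f]. *)
Theorem reverse_poincare :
  kappa rho t * \int[p]_x G t x <=
  \int[law p t]_x f x ^+ 2 - \int[p]_x pt t f x ^+ 2.
Proof.
have psi0E : psi 0 = \int[p]_x pt t f x ^+ 2.
  rewrite /psi subr0 law_time0; last exact: sqint_measurable (spt2 t).
  by apply: eq_Rintegral => x _; rewrite expr2.
have psitE : psi t = \int[law p t]_x f x ^+ 2.
  rewrite /psi subrr; apply: eq_Rintegral => x _.
  by rewrite pointwiseE (pt0 QP) ?expr2//; case: bf.
have phi0E : phi 0 = \int[p]_x G t x.
  by rewrite /phi subr0 law_time0//; case: (sG (ltW t0)).
rewrite -phi0E -psi0E -psitE; apply: growth_of_left_superquadratic => //.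
- exact: psi_left.
- exact: psi_right.
- exact: psi_continuous.
rewrite psi0E psitE.
have r2 : rint (law p t) (fun x => f x ^+ 2).
  exact: (rint_law (ltW t0) (sqint_sqr sf)).
rewrite -(integral_pt r2); have rp := rint_pt r2.
apply: Rint_le_ae => //.
  exact: (majorized_rint dom (sqint_sqr (spt t))).
apply: (majorized_ae dom).
exact: (pt_sqr_le_ae QP inv (ltW t0) sf).
Qed.

End ReversePoincare.

(** * Density of the domain of the generator *)

Section RieszFischer.
Context {d} {T : measurableType d} {R : realType} (mu : probability T R).
Local Notation nrm := (nrm mu).
Local Notation sqint := (sqint mu).
Variable u : nat -> T -> R.
Hypothesis su : forall n, sqint (u n).
Hypothesis u_close : forall n, nrm (u n.+1 - u n) <= (2 ^+ n)^-1.

Let mu_n n : measurable_fun setT (u n). Proof. exact: sqint_measurable (su n). Qed.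

Lemma u_tail n m : nrm (u (n + m)%N - u n) <= 2 * (2 ^+ n)^-1 - 2 * (2 ^+ (n + m))^-1.
Proof.
elim: m => [|m IH].
  rewrite addn0 !subrr (_ : 0 = cst 0 :> (T -> R))// nrm_cst normr0 lexx//.
rewrite addnS; apply: le_trans (nrm_triangle (su _) (su (n + m)%N) (su _)) _.
have := u_close (n + m)%N; rewrite (exprS 2 (n + m)) invfM; lra.
Qed.

Let u_cvg_ae : {ae mu, forall x, cvgn (fun n => u n x)}.
Proof.
pose D n x : R := `|u n.+1 x - u n x|.
have mD n : measurable_fun setT (fun x => (D n x)%:E).
  by apply/measurable_EFinP; apply: measurableT_comp => //; exact: measurable_funB.
have sD n : sqint (u n.+1 - u n) by exact: sqintB.
have intD n : (\int[mu]_x (D n x)%:E <= ((2 ^+ n)^-1)%:E)%E.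
  rewrite (rintE (rint_norm (sqint_rint (sD n)))) lee_fin.
  exact: le_trans (nrm1_le_nrm (sD n)) (u_close n).
have D0 n x : (0 <= (D n x)%:E)%E by rewrite lee_fin normr_ge0.
have mS : measurable_fun setT (fun x => \sum_(n <oo) (D n x)%:E)%E.
  exact: ge0_emeasurable_sum.
have /integrable_ae : mu.-integrable setT (fun x => \sum_(n <oo) (D n x)%:E)%E.
  apply/integrableP; split=> //.
  under eq_integral => x _ do rewrite gee0_abs ?nneseries_ge0//.
  rewrite integral_nneseries//; apply: (@le_lt_trans _ _ 2%:E); last exact: ltry.
  apply: lime_le; first by apply: is_cvg_nneseries => n _ _; exact: integral_ge0.
  apply: nearW => N.
  apply: (@le_trans _ _ (2 - 2 * (2 ^+ N)^-1)%:E); last first.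
    by rewrite lee_fin gerBl mulr_ge0// invr_ge0 exprn_ge0.
  elim: N => [|N IH]; first by rewrite big_geq// expr0 invr1 mulr1 subrr.
  rewrite big_nat_recr//=; apply: le_trans (leeD IH (intD N)) _.
  rewrite -EFinD lee_fin (exprS 2 N) invfM; lra.
move=> /(_ measurableT); apply: filterS => x /(_ I) Sfin.
have : cvgn [normed series (fun n => u n.+1 x - u n x)].
  apply: nondecreasing_is_cvgn.
    by apply: nondecreasing_series => n _ _ /=.
  exists (fine (\sum_(n <oo) (D n x)%:E)%E) => _ [n _ <-].
  rewrite -lee_fin fineK//= /series/= -sumEFin.
  by apply: nneseries_lim_ge => k _ _.
move=> /normed_cvg cvgS.
rewrite (_ : (fun n => u n x) =
  cst (u 0%N x) \+ series (fun n => u n.+1 x - u n x)).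
  by apply: is_cvgD => //; exact: is_cvg_cst.
apply/funext => n /=; rewrite /series/= telescope_sumr//; ring.
Qed.

(** The increments are summable, so the sequence converges almost everywhere;
    Fatou's lemma bounds the distance of the limit to each term. *)
Lemma riesz_fischer : exists2 v, sqint v &
  forall n, nrm (u n - v) <= 2 * (2 ^+ n)^-1.
Proof.
pose v x := fine (limn_esup (fun n => (u n x)%:E)).
have mv : measurable_fun setT v.
  apply: measurableT_comp => //; apply: measurable_fun_limn_esup => n.
  exact/measurable_EFinP.
have cvgv : {ae mu, forall x, u n x @[n --> \oo] --> v x}.
  apply: filterS u_cvg_ae => x /cvg_ex[l ul].
  suff -> : v x = l by [].
  have /cvg_limn_einf_sup[_ E] : (u n x)%:E @[n --> \oo] --> l%:E.
    by apply: cvg_EFin => //; exact: nearW.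
  by rewrite /v E.
have key n : (\int[mu]_x ((v x - u n x) ^+ 2)%:E <= ((2 * (2 ^+ n)^-1) ^+ 2)%:E)%E.
  pose f m x := ((u (n + m)%N x - u n x) ^+ 2)%:E.
  have mf m : measurable_fun setT (f m).
    by apply/measurable_EFinP; apply: measurable_funX; exact: measurable_funB.
  have f0 m x : [set: T] x -> (0 <= f m x)%E by move=> _; rewrite lee_fin sqr_ge0.
  have := fatou mu measurableT mf f0.
  rewrite (@ae_eq_integral _ _ _ mu setT (fun x => ((v x - u n x) ^+ 2)%:E)).
  - move=> /le_trans; apply; rewrite limn_einf_lim.
    apply: lime_le; first exact: is_cvg_einfs.
    apply: nearW => m; apply: (@le_trans _ _ (\int[mu]_x f m x)%E).
      by apply: ereal_inf_lbound; exists m => //=.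
    have sB := sqintB (su (n + m)%N) (su n).
    rewrite (rintE (sqint_sqr sB)) lee_fin -nrm_sqr.
    rewrite lerXn2r ?nnegrE ?nrm_ge0 ?mulr_ge0 ?invr_ge0 ?exprn_ge0//.
    apply: le_trans (u_tail n m) _.
    by rewrite gerBl mulr_ge0// invr_ge0 exprn_ge0.
  - exact: measurableT.
  - rewrite (_ : (fun _ => _) = (fun x => - limn_esup (fun m => - f m x))%E).
      apply: measurableT_comp => //; apply: measurable_fun_limn_esup => m.
      exact: measurableT_comp.
    by apply/funext => x; rewrite /limn_einf.
  - by apply/measurable_EFinP; apply: measurable_funX; exact: measurable_funB.
  apply: filterS cvgv => x ux _.
  suff /cvg_limn_einf_sup[E _] : f m x @[m --> \oo] --> ((v x - u n x) ^+ 2)%:E by [].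
  apply: cvg_EFin; first exact: nearW.
  have : (u (n + m)%N x - u n x) @[m --> \oo] --> v x - u n x.
    apply: cvgB; last exact: cvg_cst.
    by under eq_fun do rewrite addnC; move: ux; rewrite -(cvg_shiftn n).
  by move=> uv; exact: (cvgM uv uv).
have sBn n : sqint (v - u n).
  split; first exact: measurable_funB.
  apply/integrableP; split.
    by apply/measurable_EFinP; apply: measurable_funX; exact: measurable_funB.
  under eq_integral => x _ do rewrite gee0_abs ?lee_fin ?sqr_ge0//.
  exact: le_lt_trans (key n) (ltry _).
exists v; first by rewrite -[v](subrK (u 0%N)); exact: sqintD.
move=> n; rewrite nrmBC -ler_sqr ?nnegrE ?nrm_ge0//.
rewrite nrm_sqr -lee_fin -(rintE (sqint_sqr (sBn n))).
exact: key.
Qed.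

End RieszFischer.

Section DenseDomain.
Context {d} {T : measurableType d} {R : realType}.
Variables (Q : R -> T -> giry T R) (QP : transition_kernels Q).
Variable mu : probability T R.
Hypothesis inv : forall t (B : set T), 0 <= t -> measurable B ->
  (\int[mu]_x Q t x B = mu B)%E.
Local Notation pt := (pt Q).
Local Notation nrm := (nrm mu).
Local Notation sqint := (sqint mu).
Local Notation is_gen := (is_gen Q mu).
Hypothesis strong : forall f, sqint f -> forall e : R, 0 < e ->
  \forall t \near 0^'+, nrm (pt t f - f) <= e.
Implicit Types (f g w : T -> R) (s t c h r : R).

Definition halfway h f := 2^-1 *: (f + pt h f).

Lemma sqint_halfway h f : 0 <= h -> sqint f -> sqint (halfway h f).
Proof.
move=> h0 sf; apply: sqintZ; apply: sqintD => //.
exact: (sqint_pt QP inv h0 sf).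
Qed.

Lemma pt_halfway r h f : 0 <= r -> 0 <= h -> sqint f ->
  {ae mu, forall x,
    pt r (halfway h f) x = 2^-1 * (pt r f x + pt (r + h) f x)}.
Proof.
move=> r0 h0 sf; have shf := sqint_pt QP inv h0 sf.
apply: filterS2 (ptZ_ae QP inv 2^-1 r0 (sqint_rint (sqintD sf shf)))
  (filterI (ptD_ae QP inv r0 (sqint_rint sf) (sqint_rint shf))
           (pt_add_ae QP inv r0 h0 (sqint_rint sf))) => x e1 [e2 e3].
by rewrite e1 e2 e3.
Qed.

Lemma nrm_pt_halfway r h f g : 0 <= r -> 0 <= h -> sqint f -> sqint g ->
  nrm (pt r (halfway h f) - g)
  <= 2^-1 * (nrm (pt r f - g) + nrm (pt (r + h) f - g)).
Proof.
move=> r0 h0 sf sg; have s1 := sqint_pt QP inv r0 sf.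
have s2 := sqint_pt QP inv (addr_ge0 r0 h0) sf.
have s3 := sqint_pt QP inv r0 (sqint_halfway h0 sf).
have [s4 s5] := (sqintB s1 sg, sqintB s2 sg).
rewrite (@nrm_eq_ae _ _ _ mu _ (2^-1 *: ((pt r f - g) + (pt (r + h) f - g)))).
- by rewrite nrmZ ?ger0_norm ?ler_pM2l ?nrmD//; exact: sqintD.
- by case: (sqintB s3 sg).
- by case: (sqintZ 2^-1 (sqintD s4 s5)).
by apply: filterS (pt_halfway r0 h0 sf) => x e; rewrite !pointwiseE e; field.
Qed.

Variables (f : T -> R) (sf : sqint f) (a : R) (a0 : 0 < a).

(** The average of [pt s f] over the [2 ^ m] points [s = i * a / 2 ^ m] of [0, a[.
    It stands for the mean of [pt s f] over [0, a], whose definition as an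
    integral would require measurability in [s]. *)
Fixpoint dyadic_average (m : nat) : T -> R :=
  if m is k.+1 then halfway (a / 2 ^+ k.+1) (dyadic_average k) else f.
Local Notation S := dyadic_average.

Let eta (m : nat) := a / 2 ^+ m.
Let eta_gt0 m : 0 < eta m. Proof. by rewrite divr_gt0// exprn_gt0. Qed.
Let eta_ge0 m : 0 <= eta m. Proof. exact: ltW. Qed.
Let etaS m : eta m = eta m.+1 + eta m.+1.
Proof. by rewrite /eta exprS; field; rewrite gt_eqF// exprn_gt0. Qed.

Lemma sqint_dyadic m : sqint (S m).
Proof. by elim: m => [|m IH] //=; apply: sqint_halfway => //; exact: eta_ge0. Qed.

Let e_pt r (r0 : 0 <= r) m := sqint_pt QP inv r0 (sqint_dyadic m).

Lemma dyadic_shift r m : 0 <= r -> nrm (pt r (S m) - S m) <= nrm (pt r f - f).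
Proof.
move=> r0; elim: m => [//|m IH]; have h0 := eta_ge0 m.+1.
have sm := sqint_dyadic m; have smh := e_pt h0 m; have smr := e_pt r0 m.
have srh := e_pt (addr_ge0 r0 h0) m.
have s1 := sqintB smr sm; have s2 := sqintB srh smh.
rewrite (@nrm_eq_ae _ _ _ mu _ (2^-1 *: ((pt r (S m) - S m)
   + (pt (r + eta m.+1) (S m) - pt (eta m.+1) (S m))))).
- rewrite nrmZ ?ger0_norm//; last exact: sqintD.
  have A := nrmD s1 s2.
  have B := nrm_pt_shift QP inv h0 r0 sm; rewrite [_ + r]addrC in B.
  lra.
- by case: (sqintB (e_pt r0 m.+1) (sqint_dyadic m.+1)).
- by case: (sqintZ 2^-1 (sqintD s1 s2)).
apply: filterS (pt_halfway r0 h0 sm) => x e.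
by rewrite !pointwiseE [S m.+1]/(halfway (eta m.+1) (S m)) e !pointwiseE; field.
Qed.

(** With [h = a / 2 ^ m], this is the telescoping factorization of [P_a - 1] as
    [(P_h - 1) (P_h + 1) (P_2h + 1) (P_4h + 1) ... (P_(a/2) + 1)]. *)
Lemma dyadic_step m :
  nrm (pt (eta m) (S m) - S m - (2 ^+ m)^-1 *: (pt a f - f)) <= 0.
Proof.
elim: m => [|m IH].
  rewrite /eta expr0 divr1 invr1 scale1r subrr (_ : 0 = cst 0 :> (T -> R))//.
  by rewrite nrm_cst normr0.
have h0 := eta_ge0 m.+1; have sm := sqint_dyadic m.
have sz := sqintB (sqint_pt QP inv (ltW a0) sf) sf.
have s1 := sqintB (sqintB (e_pt (eta_ge0 m) m) sm) (sqintZ (2 ^+ m)^-1 sz).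
rewrite (@nrm_eq_ae _ _ _ mu _ (2^-1 *: (pt (eta m) (S m) - S m
    - (2 ^+ m)^-1 *: (pt a f - f)))).
- by rewrite nrmZ// pmulr_rle0// normr_gt0 invr_eq0.
- have s2 := sqintB (e_pt h0 m.+1) (sqint_dyadic m.+1).
  by case: (sqintB s2 (sqintZ (2 ^+ m.+1)^-1 sz)).
- by case: (sqintZ 2^-1 s1).
apply: filterS (pt_halfway h0 h0 sm) => x e; rewrite -etaS in e.
rewrite !pointwiseE [S m.+1]/(halfway (eta m.+1) (S m)) e !pointwiseE.
by rewrite (exprS 2 m); field; rewrite gt_eqF// exprn_gt0.
Qed.

Lemma dyadic_steps m n k : 0 <= k ->
  (forall r, 0 <= r -> r <= n%:R * eta m ->
     nrm (pt r (pt a f - f) - (pt a f - f)) <= k) ->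
  nrm (pt (n%:R * eta m) (S m) - S m - (n%:R * (2 ^+ m)^-1) *: (pt a f - f))
  <= n%:R * (2 ^+ m)^-1 * k.
Proof.
set z := pt a f - f => k0; have sz : sqint z.
  by apply: sqintB => //; exact: (sqint_pt QP inv (ltW a0) sf).
have c0 : 0 <= (2 ^+ m)^-1 :> R by rewrite invr_ge0 exprn_ge0.
have sm := sqint_dyadic m.
elim: n => [|n IH] Hk.
  rewrite !mul0r scale0r subr0.
  rewrite (_ : pt 0 (S m) = S m); last first.
    by apply/funext => x; apply: (pt0 QP); case: sm.
  by rewrite subrr (_ : 0 = cst 0 :> (T -> R))// nrm_cst normr0.
have n0 : 0 <= n%:R * eta m by rewrite mulr_ge0.
have nn : n%:R * eta m <= n.+1%:R * eta m by rewrite ler_wpM2r// ler_nat.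
have {}IH : nrm (pt (n%:R * eta m) (S m) - S m - (n%:R / 2 ^+ m) *: z)
    <= n%:R / 2 ^+ m * k.
  by apply: IH => r r0 rn; apply: Hk => //; exact: le_trans rn nn.
set c := (2 ^+ m)^-1 in c0 *; set s := n%:R * eta m in n0 IH nn *.
rewrite -/c in IH.
have E : n.+1%:R * eta m = s + eta m by rewrite /s -natr1 mulrDl mul1r.
have sS := e_pt n0 m; have sE := e_pt (eta_ge0 m) m.
have sEE := sqint_pt QP inv n0 sE.
have sSz := sqintD sm (sqintZ c sz); have spz := sqint_pt QP inv n0 sz.
have sSz' := sqint_pt QP inv n0 sSz.
have s1 := sqintB sEE sSz'; have s2 := sqintB (sqintB sS sm) (sqintZ (n%:R * c) sz).
have s3 := sqintB spz sz.
rewrite E (@nrm_eq_ae _ _ _ mu _ ((pt s (pt (eta m) (S m)) - pt s (S m + c *: z))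
  + ((pt s (S m) - S m - (n%:R * c) *: z) + c *: (pt s z - z)))).
- apply: le_trans (nrmD s1 (sqintD s2 (sqintZ c s3))) _.
  have A : nrm (pt s (pt (eta m) (S m)) - pt s (S m + c *: z)) <= 0.
    apply: le_trans (nrm_ptB QP inv n0 sE sSz) _.
    rewrite (_ : _ - _ = pt (eta m) (S m) - S m - c *: z); last by rewrite opprD addrA.
    exact: dyadic_step.
  have B := nrmD s2 (sqintZ c s3).
  have C : c * nrm (pt s z - z) <= c * k by rewrite ler_wpM2l// Hk.
  rewrite nrmZ// ger0_norm// in B.
  have -> : n.+1%:R * c * k = n%:R * c * k + c * k by rewrite -natr1; ring.
  lra.
- have s4 := sqintB (e_pt (addr_ge0 n0 (eta_ge0 m)) m) sm.
  by case: (sqintB s4 (sqintZ (n.+1%:R * c) sz)).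
- by case: (sqintD s1 (sqintD s2 (sqintZ c s3))).
apply: filterS2 (pt_add_ae QP inv n0 (eta_ge0 m) (sqint_rint sm))
  (filterI (ptD_ae QP inv n0 (sqint_rint sm) (sqint_rint (sqintZ c sz)))
           (ptZ_ae QP inv c n0 (sqint_rint sz))) => x e1 [e2 e3].
by rewrite !pointwiseE e1 e2 e3 -natr1; ring.
Qed.

(** [S (m + k)] is an average of functions [pt r (S m)] with [0 <= r < eta m]. *)
Lemma dyadic_close m k e : (forall r, 0 <= r -> r <= eta m -> nrm (pt r f - f) <= e) ->
  nrm (S (m + k)%N - S m) <= e.
Proof.
move=> He.
have gen : forall r, 0 <= r -> r <= eta (m + k)%N ->
    nrm (pt r (S (m + k)%N) - S m) <= e.
  elim: k => [|k IH] r r0.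
    by rewrite addn0 => rm; apply: le_trans (dyadic_shift m r0) (He _ r0 rm).
  rewrite addnS => rk; have h0 := eta_ge0 (m + k)%N.+1.
  apply: le_trans (nrm_pt_halfway r0 h0 (sqint_dyadic _) (sqint_dyadic _)) _.
  have A : nrm (pt r (S (m + k)%N) - S m) <= e.
    by apply: IH => //; rewrite (etaS (m + k)%N) (le_trans rk)// lerDl.
  have B : nrm (pt (r + eta (m + k)%N.+1) (S (m + k)%N) - S m) <= e.
    by apply: IH; [exact: addr_ge0|rewrite (etaS (m + k)%N) lerD2r].
  move: A B; lra.
have := gen 0 (lexx 0) (eta_ge0 _).
rewrite (_ : pt 0 (S (m + k)%N) = S (m + k)%N)//.
by apply/funext => x; apply: (pt0 QP); case: (sqint_dyadic (m + k)).
Qed.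

Lemma strong0 w e : sqint w -> 0 < e ->
  exists2 b : R, 0 < b & forall r, 0 <= r -> r < b -> nrm (pt r w - w) <= e.
Proof.
move=> sw e0; have [b b0 Hb] := (near_right0P _).1 (strong sw e0).
exists b => // r; rewrite le_eqVlt => /predU1P[<- _|]; last exact: Hb.
rewrite (_ : pt 0 w = w); last by apply/funext => x; apply: (pt0 QP); case: sw.
by rewrite subrr (_ : 0 = cst 0 :> (T -> R))// nrm_cst normr0 ltW.
Qed.

(** The mean of [pt s f] over [0, a] is in the domain, as for any strongly
    continuous semigroup. It is obtained as the limit of the dyadic averages
    along a subsequence with summable increments; the increment of the mean over
    a time [t] is read off on the multiples of [eta m] by [dyadic_steps]. *)
Lemma mean_in_domain e :
  (forall r, 0 <= r -> r <= a -> nrm (pt r f - f) <= e) ->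
  exists v, is_gen v (a^-1 *: (pt a f - f)) /\ nrm (v - f) <= e.
Proof.
move=> He; set z := pt a f - f; have sz : sqint z.
  by apply: sqintB => //; exact: (sqint_pt QP inv (ltW a0) sf).
have p2 n : 0 < 2 ^+ n :> R by rewrite exprn_gt0.
have [N HN] : exists N : nat -> nat, forall j, (j <= N j)%N /\
    forall r, 0 <= r -> r <= eta (N j) -> nrm (pt r f - f) <= (2 ^+ j)^-1.
  suff /choice[N HN] : forall j, exists n, (j <= n)%N /\
      forall r, 0 <= r -> r <= eta n -> nrm (pt r f - f) <= (2 ^+ j)^-1.
    by exists N.
  move=> j.
  have e0 : 0 < (2 ^+ j)^-1 :> R by rewrite invr_gt0.
  have [b b0 Hb] := strong0 sf e0.
  have [n nb] := half_pow_lt (divr_gt0 b0 a0).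
  exists (n + j)%N; split=> [|r r0 rn]; first exact: leq_addl.
  apply: Hb => //; apply: le_lt_trans rn _.
  rewrite ltr_pdivlMr// mulrC in nb; apply: le_lt_trans nb.
  by rewrite ler_pM2l// lef_pV2 ?posrE// ler_eXn2l ?ltr1n// leq_addr.
pose M := fix M j := if j is i.+1 then (M i + N i.+1)%N else N 0%N.
have MN j : (N j <= M j)%N by case: j => [|j] //=; exact: leq_addl.
have MH j r : 0 <= r -> r <= eta (M j) -> nrm (pt r f - f) <= (2 ^+ j)^-1.
  move=> r0 rM; apply: (HN j).2 => //; apply: le_trans rM _.
  by rewrite ler_pM2l// lef_pV2 ?posrE// ler_eXn2l ?ltr1n.
have uc j : nrm (S (M j.+1) - S (M j)) <= (2 ^+ j)^-1.
  by apply: dyadic_close => r; exact: MH.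
have [v sv uv] := riesz_fischer (fun j => sqint_dyadic (M j)) uc.
have small (C e' : R) : 0 <= C -> 0 < e' -> exists j, (2 ^+ j)^-1 * C <= e'.
  move=> C0 e'0; have C1 : 0 < C + 1 by rewrite ltr_wpDl.
  have [j jlt] := half_pow_lt (divr_gt0 e'0 C1); exists j.
  rewrite ltr_pdivlMr// in jlt; apply: le_trans (ltW jlt).
  by rewrite ler_pM2l ?invr_gt0// lerDl.
exists v; split; last first.
  apply/ler_addgt0Pr => e' e'0; have [j Hj] := small 2 e' (ler0n R 2) e'0.
  have H0 : nrm (S (0 + M j)%N - S 0%N) <= e.
    by apply: dyadic_close => r r0; rewrite /eta expr0 divr1; exact: He.
  rewrite add0n in H0.
  apply: le_trans (nrm_triangle sv (sqint_dyadic (M j)) sf) _.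
  rewrite nrmBC addrC lerD//; apply: le_trans (uv j) _; rewrite mulrC//.
split=> //; first exact: sqintZ.
move=> e1 e10; have ea0 : 0 < e1 * a by rewrite mulr_gt0.
have [b b0 Hb] := strong0 sz ea0.
apply/near_right0P; exists b => // t t0 tb.
have t0' := ltW t0.
apply/ler_addgt0Pr => e' e'0.
have C0 : 0 <= 5 + nrm z by rewrite addr_ge0 ?nrm_ge0.
have [j Hj] := small _ e' C0 e'0; apply: le_trans (lerD (lexx _) Hj).
set m := M j; have jm : (j <= m)%N by rewrite (leq_trans (HN j).1).
have sm := sqint_dyadic m; have uvj := uv j.
have te : 0 <= t / eta m by rewrite divr_ge0.
pose n := Num.truncn (t / eta m); pose r := t - n%:R * eta m.
have /andP[nlo nhi] := truncn_itv te.
have r0 : 0 <= r by rewrite subr_ge0 -ler_pdivlMr.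
have rE : r < eta m.
  by move: nhi; rewrite ltr_pdivrMr// -natr1 mulrDl mul1r /r; lra.
have n0 : 0 <= n%:R * eta m by rewrite mulr_ge0.
have nt : n%:R * eta m <= t by rewrite -ler_pdivlMr.
have X3 : nrm (pt t (S m) - pt (n%:R * eta m) (S m)) <= (2 ^+ j)^-1.
  rewrite (_ : t = n%:R * eta m + r); last by rewrite /r; ring.
  apply: le_trans (nrm_pt_shift QP inv n0 r0 sm) _.
  by apply: le_trans (dyadic_shift m r0) _; apply: MH => //; exact: ltW.
have X4 : nrm (pt (n%:R * eta m) (S m) - S m - (n%:R * (2 ^+ m)^-1) *: z)
    <= t * e1.
  have := @dyadic_steps m n (e1 * a) (ltW ea0).
  move=> /(_ _)/le_trans; apply.
    by move=> q q0 qn; apply: Hb => //; apply: le_lt_trans qn _; exact: le_lt_trans tb.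
  have -> : n%:R * (2 ^+ m)^-1 * (e1 * a) = n%:R * eta m * e1 by rewrite /eta; ring.
  by rewrite ler_pM2r.
have X5 : nrm ((n%:R * (2 ^+ m)^-1 - t / a) *: z) <= (2 ^+ j)^-1 * nrm z.
  rewrite nrmZ// ler_wpM2r ?nrm_ge0//.
  have -> : n%:R * (2 ^+ m)^-1 - t / a = - (r / a).
    by rewrite /r /eta; field; rewrite !gt_eqF.
  rewrite normrN ger0_norm; last by rewrite divr_ge0// ltW.
  rewrite ler_pdivrMr//; apply: le_trans (ltW rE) _.
  by rewrite mulrC /eta ler_pM2l// lef_pV2 ?posrE// ler_eXn2l ?ltr1n.
have spv := sqint_pt QP inv t0' sv; have sps := e_pt t0' m; have spn := e_pt n0 m.
have X1 := nrm_ptB QP inv t0' sv sm; rewrite [nrm (v - _)]nrmBC in X1.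
have q1 := sqintB spv sps; have q2 := sqintB sm sv; have q3 := sqintB sps spn.
have q4 := sqintB (sqintB spn sm) (sqintZ (n%:R * (2 ^+ m)^-1) sz).
have q5 := sqintZ (n%:R * (2 ^+ m)^-1 - t / a) sz.
rewrite (_ : _ - _ = (pt t v - pt t (S m)) + (S m - v)
   + ((pt t (S m) - pt (n%:R * eta m) (S m))
     + ((pt (n%:R * eta m) (S m) - S m - (n%:R * (2 ^+ m)^-1) *: z)
     + (n%:R * (2 ^+ m)^-1 - t / a) *: z))); last first.
  by apply/funext => x; rewrite !pointwiseE; ring.
have Y1 := nrmD (sqintD q1 q2) (sqintD q3 (sqintD q4 q5)).
have Y2 := nrmD q1 q2; have Y3 := nrmD q3 (sqintD q4 q5).
have Y4 := nrmD q4 q5.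
rewrite -/m in uvj.
have -> : (2 ^+ j)^-1 * (5 + nrm z) = 5 * (2 ^+ j)^-1 + (2 ^+ j)^-1 * nrm z by ring.
lra.
Qed.

End DenseDomain.

Section DenseDomain2.
Context {d} {T : measurableType d} {R : realType}.
Variables (Q : R -> T -> giry T R) (QP : transition_kernels Q).
Variable mu : probability T R.
Hypothesis inv : forall t (B : set T), 0 <= t -> measurable B ->
  (\int[mu]_x Q t x B = mu B)%E.
Hypothesis strong : forall f, sqint mu f -> forall e : R, 0 < e ->
  \forall t \near 0^'+, nrm mu (pt Q t f - f) <= e.

Theorem domain_dense f (e : R) : sqint mu f -> 0 < e ->
  exists v w, is_gen Q mu v w /\ nrm mu (v - f) <= e.
Proof.
move=> sf e0; have [b b0 Hb] := strong0 QP strong sf e0.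
have a0 : 0 < b / 2 by rewrite divr_gt0.
have [|v [vw ve]] := @mean_in_domain _ _ _ Q QP mu inv strong f sf _ a0 e.
  by move=> r r0 ra; apply: Hb => //; apply: le_lt_trans ra _; lra.
by exists v; eexists; split; [exact: vw|].
Qed.

End DenseDomain2.

(** * The L1 norm through test functions from an algebra *)

Section Clip.
Context {T : Type} {R : realType}.
Implicit Types (f g : T -> R).

(** Polynomials in [y] that increase to [|y|] on [-1, 1], with an error of at most
    [2 / (n + 1)]. *)
Fixpoint abs_iter (y : R) (n : nat) : R :=
  if n is k.+1 then abs_iter y k + 2^-1 * (y ^+ 2 - abs_iter y k ^+ 2) else 0.

Lemma abs_iterP y n : `|y| <= 1 ->
  0 <= abs_iter y n <= `|y| /\ (`|y| - abs_iter y n) * n.+1%:R <= 2.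
Proof.
move=> y1; have y0 := normr_ge0 y; elim: n => [|n [/andP[q0 qy] IH]] /=.
  by rewrite lexx y0 subr0 mulr1; split=> //; lra.
rewrite -(real_normK (num_real y)); set a := `|y| in y0 y1 qy IH *.
set q := abs_iter y n in q0 qy IH *.
have q'y : q + 2^-1 * (a ^+ 2 - q ^+ 2) <= a by nra.
split; first by apply/andP; split=> //; nra.
set e := a - q in IH *; have e0 : 0 <= e by rewrite /e subr_ge0.
have -> : a - (q + 2^-1 * (a ^+ 2 - q ^+ 2)) = e * (1 - (a + q) / 2).
  by rewrite /e; field.
have e1 : e <= 1 by rewrite /e; lra.
set e' := e * _; have e'0 : 0 <= e' by rewrite /e' mulr_ge0//; lra.
have le' : e' * (2 + e) <= 2 * e.
  have : e' <= e * (1 - e / 2) by rewrite /e' ler_wpM2l//; rewrite /e; lra.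
  move=> h; have : e' * (2 + e) <= e * (1 - e / 2) * (2 + e).
    by rewrite ler_wpM2r// addr_ge0.
  have : 0 <= e * e ^+ 2 by rewrite mulr_ge0// sqr_ge0.
  lra.
have [->|eN] := eqVneq e' 0; first by rewrite mul0r.
have ep : 0 < e.
  rewrite lt_neqAle e0 andbT eq_sym; apply: contraNN eN => /eqP eE.
  by rewrite /e' eE mul0r.
rewrite -(ler_pM2r ep) -natr1.
have : e' * (e * n.+1%:R) <= e' * 2 by rewrite ler_wpM2l.
lra.
Qed.

Definition function_algebra (N : set (T -> R)) :=
  [/\ forall c, N (cst c), forall f g, N f -> N g -> N (f \+ g)
    & forall f g, N f -> N g -> N (f \* g)].

Variable N : set (T -> R).
Hypothesis NA : function_algebra N.

Lemma algebra_scale c f : N f -> N (fun x => c * f x).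
Proof. by case: NA => Nc _ NM Nf; exact: (NM (cst c) f). Qed.

Lemma abs_approx f K e : N f -> 0 < K -> (forall x, `|f x| <= K) -> 0 < e ->
  exists2 g, N g & forall x, `|g x - `|f x| | <= e.
Proof.
move=> Nf K0 fK e0; have [Nc ND NM] := NA.
have Nq n : N (fun x => abs_iter (K^-1 * f x) n).
  elim: n => [|n IH]; first exact: (Nc 0).
  apply: (ND _ (fun x => 2^-1 * ((K^-1 * f x) ^+ 2
    - abs_iter (K^-1 * f x) n ^+ 2)) IH).
  apply: algebra_scale.
  apply: (ND (fun x => (K^-1 * f x) ^+ 2) (fun x => - abs_iter (K^-1 * f x) n ^+ 2)).
    by apply: (NM (fun x => K^-1 * f x) (fun x => K^-1 * f x)); exact: algebra_scale.
  rewrite (_ : (fun _ => _) = (fun x => -1 * (abs_iter (K^-1 * f x) n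
    * abs_iter (K^-1 * f x) n))); last by apply/funext => x; rewrite mulN1r expr2.
  by apply: algebra_scale; exact: (NM _ _ IH IH).
have [n nlt] : exists n, K * 2 / n.+1%:R <= e.
  have K2 : 0 < K * 2 by rewrite mulr_gt0.
  have [n _ Hn] := near_infty_natSinv_lt (PosNum (divr_gt0 e0 K2)).
  exists n; have /= := Hn n (leqnn n); rewrite ltr_pdivlMr// => h.
  by rewrite mulrC; exact: ltW.
exists (fun x => K * abs_iter (K^-1 * f x) n); first exact: algebra_scale.
move=> x; set y := K^-1 * f x.
have fE : `|f x| = K * `|y|.
  by rewrite normrM gtr0_norm ?invr_gt0// mulrA divff ?mul1r// gt_eqF.
have y1 : `|y| <= 1.
  by have := fK x; rewrite fE -[leRHS]mulr1 ler_pM2l.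
have [/andP[q0 qy] qn] := abs_iterP n y1.
rewrite fE -mulrBr normrM gtr0_norm// distrC ger0_norm ?subr_ge0//.
apply: le_trans nlt; rewrite -mulrA ler_pM2l// ler_pdivlMr//.
Qed.

(** The truncation to [-1, 1], written with absolute values so that [abs_approx]
    applies. *)
Definition clip (y : R) := (`|y + 1| - `|y - 1|) / 2.

Lemma clip_id y : `|y| <= 1 -> clip y = y.
Proof.
rewrite ler_norml => /andP[a b]; rewrite /clip ger0_norm ?ler0_norm; last 2 first.
- by rewrite subr_le0.
- by lra.
by field.
Qed.

Lemma clip_norm y : `|clip y| <= 1.
Proof.
have [y1|y1] := leP `|y| 1; first by rewrite clip_id.
rewrite /clip; have [y0|y0] := leP 0 y.
  have [a b] : 0 <= y + 1 /\ 0 <= y - 1 by move: y1; rewrite ger0_norm//; lra.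
  rewrite (ger0_norm a) (ger0_norm b) ler_norml; lra.
have [a b] : y + 1 <= 0 /\ y - 1 <= 0 by move: y1; rewrite ltr0_norm//; lra.
rewrite (ler0_norm a) (ler0_norm b) ler_norml; lra.
Qed.

Lemma clip_lipschitz y z : `|clip y - clip z| <= `|y - z|.
Proof.
rewrite /clip.
have A := lerB_dist (y + 1) (z + 1); have B := lerB_dist (z + 1) (y + 1).
have C := lerB_dist (y - 1) (z - 1); have D := lerB_dist (z - 1) (y - 1).
have E : y + 1 - (z + 1) = y - z by ring.
have F : y - 1 - (z - 1) = y - z by ring.
rewrite distrC in B; rewrite [leRHS]distrC in D.
rewrite E in A B; rewrite F in C D.
by rewrite ler_norml; lra.
Qed.

Lemma clip_approx f K e : N f -> 0 < K -> (forall x, `|f x| <= K) -> 0 < e ->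
  exists2 g, N g & (forall x, `|g x| <= 1) /\ (forall x, `|g x - clip (f x)| <= e).
Proof.
move=> Nf K0 fK e0; have [Nc ND NM] := NA; have e2 : 0 < e / 2 by rewrite divr_gt0.
have Np : N (fun x => f x + 1) by exact: (ND f (cst 1)).
have Nm : N (fun x => f x - 1) by exact: (ND f (cst (- 1))).
have K1 : 0 < K + 1 by rewrite addr_gt0.
have [|g1 Ng1 g1P] := abs_approx Np K1 _ e2.
  by move=> x; rewrite (le_trans (ler_normD _ _))// normr1 lerD2r.
have [|g2 Ng2 g2P] := abs_approx Nm K1 _ e2.
  by move=> x; rewrite (le_trans (ler_normB _ _))// normr1 lerD2r.
(* The approximation may exceed 1 by e / 2; dividing by q restores the bound. *)
pose q := 1 + e / 2; have q0 : 0 < q by rewrite /q; lra.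
exists (fun x => (2 * q)^-1 * (g1 x + (-1) * g2 x)).
  apply: algebra_scale; apply: (ND g1 (fun x => -1 * g2 x)) => //.
  exact: algebra_scale.
have main x : `|(g1 x + (-1) * g2 x) / 2 - clip (f x)| <= e / 2.
  have := g1P x; have := g2P x; rewrite /clip !ler_norml => /andP[? ?] /andP[? ?].
  lra.
have qE x : (2 * q)^-1 * (g1 x + (-1) * g2 x) = (g1 x + (-1) * g2 x) / 2 / q.
  by field; rewrite gt_eqF.
have bound (w c : R) : `|c| <= 1 -> `|w - c| <= e / 2 ->
    `|w / q| <= 1 /\ `|w / q - c| <= e.
  move=> c1 wc; split.
    rewrite normrM normfV [`|q|]gtr0_norm// ler_pdivrMr// mul1r /q.
    by rewrite -[w](subrK c) (le_trans (ler_normD _ _))//; lra.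
  rewrite (_ : w / q - c = (w - c * q) / q); last by field; rewrite gt_eqF.
  rewrite normrM normfV [`|q|]gtr0_norm// ler_pdivrMr//.
  apply: (@le_trans _ _ e); last by rewrite /q; nra.
  rewrite (_ : w - c * q = (w - c) - c * (e / 2)); last by rewrite /q; ring.
  rewrite (le_trans (ler_normB _ _))// normrM [`|e / 2|]gtr0_norm//.
  have : `|c| * (e / 2) <= 1 * (e / 2) by rewrite ler_pM2r.
  lra.
by split=> x; rewrite qE; have [] := bound _ _ (clip_norm (f x)) (main x).
Qed.

End Clip.

Section TestFunctions.
Context {d} {T : measurableType d} {R : realType} (mu : probability T R).
Local Notation nrm := (nrm mu).
Implicit Types (f g v : T -> R) (e C M : R).

Lemma clip_sign (y : R) : `|y| - 1 <= y * clip y.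
Proof.
have [y1|y1] := leP `|y| 1.
  by rewrite clip_id//; have := sqr_ge0 y; lra.
rewrite /clip; have [y0|y0] := leP 0 y.
  have [a b] : 0 <= y + 1 /\ 0 <= y - 1 by move: y1; rewrite ger0_norm//; lra.
  by rewrite !ger0_norm//; lra.
have [a b] : y + 1 <= 0 /\ y - 1 <= 0 by move: y1; rewrite ltr0_norm//; lra.
by rewrite (ltr0_norm y0) !ler0_norm//; lra.
Qed.

Lemma measurable_clip f : measurable_fun setT f -> measurable_fun setT (clip \o f).
Proof.
move=> mf; apply: measurable_funM; last exact: measurable_cst.
apply: measurable_funB; apply: measurableT_comp => //.
  by apply: measurable_funD.
by apply: measurable_funB.
Qed.

Lemma tail_small v e : rint mu v -> 0 < e -> exists2 M, 0 <= M &
  rint mu (fun x => Num.max (`|v x| - M) 0) /\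
  \int[mu]_x Num.max (`|v x| - M) 0 <= e.
Proof.
move=> rv e0; have mv := rint_measurable rv.
pose t n x := Num.max (`|v x| - n%:R) 0.
have mt n : measurable_fun setT (t n).
  by apply: measurable_maxr => //; apply: measurable_funB => //; exact: measurableT_comp.
have t0 n x : 0 <= t n x by rewrite le_max lexx orbT.
have tv n x : t n x <= `|v x|.
  by rewrite ge_max normr_ge0 gerBl ler0n.
have rt n : rint mu (t n).
  by apply: rint_le rv _ => // x; rewrite ger0_norm.
have [_ _] : [/\ mu.-integrable setT (cst 0%E : T -> \bar R),
    (\int[mu]_x `|(t n x)%:E - cst 0 x|)%E @[n --> \oo] --> 0%E &
    (\int[mu]_x (t n x)%:E)%E @[n --> \oo] --> (\int[mu]_x (cst 0 x))%E].
  apply: (@dominated_convergence _ T R mu setT measurableT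
    (fun n x => (t n x)%:E) (cst 0%E) (fun x => `|v x|%:E)).
  - by move=> n; exact/measurable_EFinP.
  - exact: measurable_cst.
  - apply: aeW => x _; apply: cvg_near_cst; near=> n.
    have vn : `|v x| <= n%:R by near: n; exact: nbhs_infty_ger.
    by congr EFin; apply/eqP; rewrite /t eq_le ge_max subr_le0 vn lexx t0.
  - exact: rint_norm.
  - by apply: aeW => x n _; rewrite /= lee_fin ger0_norm.
rewrite integral0 => cv0.
have /cvgrPdist_le/(_ e e0)[n _ Hn] : (\int[mu]_x t n x) @[n --> \oo] --> (0 : R).
  exact: (@fine_cvg _ _ _ _ (fun n => (\int[mu]_x (t n x)%:E)%E) 0).
exists n%:R => //; split; first exact: rt.
have := Hn n (leqnn n); rewrite /= sub0r normrN ger0_norm//.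
exact: Rintegral_ge0.
Unshelve. all: by end_near. Qed.

Variable N : set (T -> R).
Hypothesis NA : function_algebra N.
Hypothesis Nb : forall f, N f -> exists M, bounded_by M f.
Hypothesis Nd : forall f e, sqint mu f -> 0 < e ->
  exists2 u, N u & nrm (u - f) <= e.

Lemma test_approx (s : T -> R) e : measurable_fun setT s -> (forall x, `|s x| <= 1) ->
  0 < e -> exists2 g, N g & (forall x, `|g x| <= 1) /\ nrm (g - s) <= e.
Proof.
move=> ms s1 e0; have e2 : 0 < e / 2 by rewrite divr_gt0.
have ss : sqint mu s by apply: (@bounded_sqint _ _ _ _ 1); split.
have [u Nu us] := Nd ss e2; have [K [mu' uK]] := Nb Nu.
have [|g Ng [g1 gu]] := clip_approx NA Nu (ltr_pwDl ltr01 (normr_ge0 K)) _ e2.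
  by move=> x; apply: le_trans (uK x) _; rewrite (le_trans (ler_norm K))// lerDr.
exists g => //; split=> //.
have [? [mg _]] := Nb Ng.
have sg : sqint mu g by apply: (@bounded_sqint _ _ _ _ 1); split.
have su : sqint mu u by apply: (@bounded_sqint _ _ _ _ K); split.
have scu : sqint mu (clip \o u).
  apply: (@bounded_sqint _ _ _ _ 1); split; first exact: measurable_clip.
  by move=> x; exact: clip_norm.
apply: le_trans (nrm_triangle sg scu ss) _.
have A : nrm (g - (clip \o u)) <= e / 2.
  rewrite -[leRHS]gtr0_norm// -(nrm_cst mu); apply: nrm_le.
  - by apply: measurable_funB => //; exact: measurable_clip.
  - exact: sqint_cst.
  - by move=> x; rewrite !pointwiseE [leRHS]gtr0_norm//; exact: (gu x).
have B : nrm ((clip \o u) - s) <= e / 2.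
  apply: le_trans us; apply: nrm_le; last 2 first.
  - exact: sqintB.
  - move=> x; rewrite !pointwiseE /= -{1}(clip_id (s1 x)).
    exact: clip_lipschitz.
  - by apply: measurable_funB => //; exact: measurable_clip.
lra.
Qed.

(** [v * clip (v / e)] is at least [|v| - e], and [clip (v / e)] is close in L2 to
    an element of [N] bounded by 1. As [v] is only in L1, the error is split
    between the part of [|v|] below a level [M], where the L2 bound is used, and
    the part above, whose integral is small. *)
Lemma nrm1_le_test v C : rint mu v ->
  (forall g, N g -> (forall x, `|g x| <= 1) -> \int[mu]_x (g x * v x) <= C) ->
  nrm1 mu v <= C.
Proof.
move=> rv HC; have mv := rint_measurable rv.
suff main e : 0 < e -> nrm1 mu v <= C + 4 * e.
  apply/ler_addgt0Pr => e e0; have e4 : 0 < e / 4 by rewrite divr_gt0.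
  by apply: le_trans (main _ e4) _; lra.
move=> e0; have [M M0 [rt te]] := tail_small rv e0.
have M1 : 0 < M + 1 by rewrite ltr_wpDl.
pose s x := clip (e^-1 * v x).
have ms : measurable_fun setT s.
  by apply: (@measurable_clip (fun x => e^-1 * v x)); exact: measurable_funM.
have s1 x : `|s x| <= 1 by exact: clip_norm.
have [g Ng [g1 gs]] := test_approx ms s1 (divr_gt0 e0 M1).
have [? [mg _]] := Nb Ng.
have b1 : bounded_by 1 g by [].
have rgv : rint mu (g * v) := rintM b1 rv.
have sgs : sqint mu (g - s).
  apply: sqintB; first exact: bounded_sqint b1.
  by apply: (@bounded_sqint _ _ _ _ 1); split.
have rgs := rint_norm (sqint_rint sgs).
have rt2 := rintZ 2 rt; have rM := rintZ M rgs.
have re : rint mu (cst e) := rint_cst mu e.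
have pt x : `|v x| <= ((g * v) + (M *: (fun y => `|(g - s) y|)
    + (2 *: (fun y => Num.max (`|v y| - M) 0) + cst e))) x.
  rewrite !pointwiseE; set t := Num.max _ _.
  have t0 : 0 <= t by rewrite le_max lexx orbT.
  have tM : `|v x| - M <= t by rewrite le_max lexx.
  have sv : `|v x| - e <= s x * v x.
    have := clip_sign (e^-1 * v x); rewrite normrM gtr0_norm ?invr_gt0// -/(s x).
    rewrite -(ler_pM2l e0) mulrBr mulr1 mulrA divff ?gt_eqF// mul1r.
    suff -> : e * (e^-1 * v x * s x) = s x * v x by [].
    by field; rewrite gt_eqF.
  have gs2 : `|g x - s x| <= 2.
    by rewrite (le_trans (ler_normB _ _))// (_ : 2 = 1 + 1)// lerD.
  have : (s x - g x) * v x <= `|g x - s x| * `|v x|.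
    by rewrite -normrM -normrN -mulNr opprB ler_norm.
  have : `|g x - s x| * `|v x| <= `|g x - s x| * (M + t).
    by rewrite ler_wpM2l//; lra.
  have : `|g x - s x| * t <= 2 * t by rewrite ler_wpM2r.
  lra.
have r1 := rintD rt2 re; have r2 := rintD rM r1.
apply: le_trans (Rint_le (rint_norm rv) (rintD rgv r2) pt) _.
rewrite (Rint_add rgv r2) (Rint_add rM r1) (Rint_add rt2 re).
rewrite (Rint_scale M rgs) (Rint_scale 2 rt).
have -> : \int[mu]_x cst e x = e.
  by rewrite Rintegral_cst// [X in fine X]probability_setT mulr1.
have A := HC g Ng g1.
have B : M * (\int[mu]_x `|(g - s) x|) <= e.
  have : \int[mu]_x `|(g - s) x| <= e / (M + 1) := le_trans (nrm1_le_nrm sgs) gs.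
  rewrite ler_pdivlMr//; have : 0 <= \int[mu]_x `|(g - s) x|.
    exact: Rintegral_ge0.
  lra.
have -> : \int[mu]_x (g * v) x = \int[mu]_x (g x * v x) by [].
lra.
Qed.

End TestFunctions.

(** * Change of density and the dual semigroup *)

Section Density.
Context {d} {T : measurableType d} {R : realType} (mu : probability T R).
Variable h : T -> R.
Hypothesis mh : measurable_fun setT h.

(** [h] is almost everywhere the Radon-Nikodym derivative of [nu]. *)
Lemma integral_density (nu : {finite_measure set T -> \bar R}) (f : T -> \bar R) :
  (forall B, measurable B -> nu B = \int[mu]_(x in B) (h x)%:E)%E ->
  measurable_fun setT f -> (forall x, 0 <= f x)%E ->
  (\int[nu]_x f x = \int[mu]_x (f x * (h x)%:E))%E.
Proof.
move=> nuE mf f0.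
have dom : nu `<< mu.
  apply/null_content_dominatesP => A mA A0; rewrite nuE//.
  by apply: null_set_integral => //; exact/measurable_EFinP/measurable_funTS.
have iRN := Radon_Nikodym_SigmaFinite.f_integrable dom.
rewrite -(Radon_Nikodym_SigmaFinite.change_of_variables dom f0 measurableT mf).
have RNh : ae_eq mu setT (Radon_Nikodym_SigmaFinite.f nu mu) (EFin \o h).
  apply: integral_ae_eq => //; first exact/measurable_EFinP.
  by move=> A _ mA; rewrite -nuE//; exact/esym/(Radon_Nikodym_SigmaFinite.f_integral dom).
apply: ae_eq_integral => //.
- by apply: emeasurable_funM => //; exact: measurable_int iRN.
- by apply: emeasurable_funM => //; exact/measurable_EFinP.
- exact: ae_eqe_mul2l.
Qed.

Lemma Rint_density (nu : {finite_measure set T -> \bar R}) M f :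
  (forall B, measurable B -> nu B = \int[mu]_(x in B) (h x)%:E)%E ->
  rint mu h -> bounded_by M f -> \int[nu]_x f x = \int[mu]_x (f x * h x).
Proof.
move=> nuE rh bf; have [mf fM] := bf.
have rf : rint nu f := rint_bounded nu bf.
have rfh : rint mu (f * h) := rintM bf rh.
have rc := rint_cst nu M; have rMh := rintZ M rh.
have fM0 x : 0 <= f x + M by have := fM x; rewrite ler_norml => /andP[]; lra.
have : (\int[nu]_x ((f + cst M) x)%:E = \int[mu]_x ((f * h + M *: h) x)%:E)%E.
  rewrite integral_density//.
  - by apply: eq_integral => x _; rewrite -EFinM !pointwiseE mulrDl.
  - by apply/measurable_EFinP; exact: measurable_funD.
rewrite (rintE (rintD rf rc)) (rintE (rintD rfh rMh)).
rewrite (Rint_add rf rc) (Rint_add rfh rMh) (Rint_scale M rh) => -[].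
have -> : \int[nu]_x cst M x = M * \int[mu]_x h x.
  by rewrite Rintegral_cst//; congr (_ * fine _); exact: nuE.
by move=> /addIr.
Qed.

End Density.

Section DensityMeasure.
Context {d} {T : measurableType d} {R : realType} (mu : probability T R).
Variable h : T -> R.
Hypotheses (mh : measurable_fun setT h) (h0 : forall x, 0 <= h x).
Hypothesis h1 : (\int[mu]_x (h x)%:E = 1)%E.

Definition density_measure (B : set T) : \bar R := (\int[mu]_(x in B) (h x)%:E)%E.

Let density0 : density_measure set0 = 0%E. Proof. exact: integral_set0. Qed.

Let density_ge0 B : (0 <= density_measure B)%E.
Proof. by apply: integral_ge0 => x _; rewrite lee_fin. Qed.

Let density_sigma_additive : semi_sigma_additive density_measure.
Proof.
move=> F mF tF mU; rewrite /density_measure ge0_integral_bigcup//.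
- apply: is_cvg_nneseries => n _ _; exact: density_ge0.
- by apply/measurable_EFinP; exact: measurable_funTS.
- by move=> x _; rewrite lee_fin.
Qed.

HB.instance Definition _ := isMeasure.Build _ _ _ density_measure
  density0 density_ge0 density_sigma_additive.

Let density_setT : density_measure setT = 1%E. Proof. exact: h1. Qed.

HB.instance Definition _ :=
  Measure_isProbability.Build _ _ _ density_measure density_setT.

Definition density_probability : probability T R := density_measure.

End DensityMeasure.

Section DualSemigroup.
Context {d} {T : measurableType d} {R : realType}.
Variables (Q : R -> T -> giry T R) (QP : transition_kernels Q).
Variable mu : probability T R.
Hypothesis inv : forall t (B : set T), 0 <= t -> measurable B ->
  (\int[mu]_x Q t x B = mu B)%E.
Variable h : T -> R.
Hypotheses (mh : measurable_fun setT h) (h0 : forall x, 0 <= h x).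
Hypothesis h1 : (\int[mu]_x (h x)%:E = 1)%E.

Lemma rint_density : rint mu h.
Proof.
apply/integrableP; split; first exact/measurable_EFinP.
under eq_integral => x _ do rewrite gee0_abs ?lee_fin//.
by rewrite h1 ltry.
Qed.

(** [P_t^* h] is the density of the law at time [t] when the initial law is
    [h mu]: this law is dominated by [mu], since [mu] is invariant. *)
Lemma dual_exists t : 0 <= t -> exists g, rint mu g /\
  forall M f, bounded_by M f ->
    \int[mu]_x (f x * g x) = \int[mu]_x (pt Q t f x * h x).
Proof.
move=> t0; pose nu : probability T R := density_probability mh h0 h1.
pose lt := law QP nu t.
have dom : lt `<< mu.
  apply/null_content_dominatesP => A mA A0.
  rewrite /lt [LHS]lawE// (integral_density (mu := mu) mh (nu := nu))//; last first.
    exact: measurable_kernel_set.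
  have : (\int[mu]_x Q t x A = 0)%E by rewrite inv.
  have mQ : measurable_fun setT (fun x => Q t x A) by exact: measurable_kernel_set.
  under eq_integral => x _ do rewrite -(gee0_abs (measure_ge0 (Q t x) A)).
  move=> /(ae_eq_integral_abs mu measurableT mQ) ae0.
  rewrite (@ae_eq_integral _ _ _ mu setT (cst 0%E)) ?integral0//.
  - by apply: emeasurable_funM => //; exact/measurable_EFinP.
  - by apply: filterS ae0 => x /= /(_ Logic.I) -> _; rewrite mul0e.
have ir := Radon_Nikodym_SigmaFinite.f_integrable dom.
pose g x := fine (Radon_Nikodym_SigmaFinite.f lt mu x).
have gE x : ((g x)%:E = Radon_Nikodym_SigmaFinite.f lt mu x)%E.
  by rewrite fineK// Radon_Nikodym_SigmaFinite.f_fin_num.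
have rg : rint mu g by apply: eq_integrable ir => // x _; rewrite /= gE.
exists g; split=> // M f bf; have [mf fM] := bf.
have rl : rint lt f := rint_bounded lt bf.
rewrite -(@Rint_density _ _ _ mu g (rint_measurable rg) lt M)//; last first.
  move=> B mB; rewrite (Radon_Nikodym_SigmaFinite.f_integral dom)//.
  by apply: eq_integral => x _; rewrite gE.
rewrite -(integral_pt rl); apply: (Rint_density mh (nu := nu) (M := M)) => //.
  exact: rint_density.
exact: pt_bounded.
Qed.

End DualSemigroup.

(** * Kernels and generator of a Markov process *)

Section SubProbability.
Context {d} {T : measurableType d} {R : realType}.
Variables (m : {measure set T -> \bar R}) (m1 : (m setT <= 1)%E).

Definition subprobability_of (B : set T) : \bar R := m B.

HB.instance Definition _ := isMeasure.Build _ _ _ subprobability_of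
  (measure0 m) (measure_ge0 m) (@measure_semi_sigma_additive _ _ _ m).

HB.instance Definition _ :=
  Measure_isSubProbability.Build _ _ _ subprobability_of m1.

(** [m] with the structure that [giry_map] asks for. *)
Definition giry_of : giry T R := subprobability_of.

End SubProbability.

Section Process.
Context {R : realType} {E : puniformType} {d : measure_display}
  {Omega : measurableType d}.
Variables (P : R.-pker (borel E) ~> Omega) (X : R -> Omega -> borel E).
Hypothesis process : markov_process P X.

(** Negative times are sent to 0, where the process is measurable. *)
Let mX t : measurable_fun setT (X (Num.max 0 t)).
Proof. by apply: (mp_measurable process); rewrite le_max lexx. Qed.

Let mass_le1 x : (P x setT <= 1)%E. Proof. by rewrite prob_kernel. Qed.

Definition kernel_of (t : R) (x : borel E) : giry (borel E) R :=
  giry_map (mX t) (giry_of (mass_le1 x)).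

Lemma kernel_ofE t x (B : set (borel E)) : 0 <= t ->
  kernel_of t x B = P x (X t @^-1` B).
Proof. by move=> t0; rewrite /kernel_of /= max_r. Qed.

Lemma measurable_hit t (B : set (borel E)) : 0 <= t -> measurable B ->
  measurable_fun setT (fun x => P x (X t @^-1` B)).
Proof.
move=> t0 mB; apply: measurable_kernel.
by rewrite -[_ @^-1` _]setTI; exact: (mp_measurable process).
Qed.

Lemma kernel_of_integral t x (f : borel E -> \bar R) : 0 <= t ->
  measurable_fun setT f -> (forall y, 0 <= f y)%E ->
  (\int[kernel_of t x]_y f y = \int[P x]_w f (X t w))%E.
Proof.
move=> t0 mf f0; by rewrite [LHS](giry_int_map (mX t))// /giry_int max_r.
Qed.

(** Chapman-Kolmogorov is the Markov property for the trivial event. *)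
Lemma transition_kernels_of : transition_kernels kernel_of.
Proof.
split=> [t|t x|x B mB|s t x B s0 t0 mB].
- apply: measurable_giry_codensity => // B mB.
  have -> : (fun x => kernel_of t x B) =
      (fun x => P x (X (Num.max 0 t) @^-1` B)) by [].
  by apply: measurable_hit => //; rewrite le_max lexx.
- by rewrite /kernel_of /= [LHS]prob_kernel.
- by rewrite kernel_ofE// mp_start.
- rewrite kernel_ofE ?addr_ge0// -[X in P x X]setTI (mp_markov process)//.
    rewrite kernel_of_integral//.
    + by apply: eq_integral => w _; rewrite kernel_ofE.
    + by under eq_fun do rewrite kernel_ofE//; exact: measurable_hit.
  exact: (@measurableT _ (g_sigma_algebraType _)).
Qed.

Lemma semigroupE t (f : borel E -> R) : 0 <= t -> measurable_fun setT f ->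
  semigroup P X t f = pt kernel_of t f.
Proof.
move=> t0 mf; apply/funext => x; congr fine.
have mf' : measurable_fun setT (EFin \o f) by exact/measurable_EFinP.
rewrite [LHS]integralE [RHS]integralE.
congr (_ - _)%E; apply/esym.
  apply: etrans (kernel_of_integral x t0 (measurable_funepos mf') _) _ => //.
  by apply: eq_integral => w _; rewrite !funeposE.
apply: etrans (kernel_of_integral x t0 (measurable_funeneg mf') _) _ => //.
by apply: eq_integral => w _; rewrite !funenegE.
Qed.

End Process.

Section Generator.
Context {R : realType} {E : puniformType} {d : measure_display}
  {Omega : measurableType d}.
Variables (P : R.-pker (borel E) ~> Omega) (X : R -> Omega -> borel E).
Variables (mu : probability (borel E) R).
Hypothesis process : markov_process P X.
Hypothesis invar : Defs.invariant P X mu.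
Local Notation Q := (kernel_of process).
Local Notation QP := (transition_kernels_of process).
Implicit Types (f g v : borel E -> R).

Lemma kernel_invariant t (B : set (borel E)) : 0 <= t -> measurable B ->
  (\int[mu]_x Q t x B = mu B)%E.
Proof.
move=> t0 mB; rewrite -(invar t0 mB).
by apply: eq_integral => x _; rewrite kernel_ofE.
Qed.

Lemma L2norm_cvg0 {T} (F : set_system T) {FF : Filter F} (u : T -> borel E -> R) :
  (\forall t \near F, sqint mu (u t)) ->
  (L2norm mu (u t) @[t --> F] --> 0%E) <->
  (forall e : R, 0 < e -> \forall t \near F, nrm mu (u t) <= e).
Proof.
move=> su; have uE : {near F, (fun t => L2norm mu (u t)) =1 (fun t => (nrm mu (u t))%:E)}.
  by apply: filterS su => t st; rewrite /L2norm LnormE.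
split.
  move=> /fine_cvgP[_ /cvgrPdist_le H] e e0.
  apply: filterS2 (H e e0) uE => t /= + tE; rewrite tE sub0r normrN.
  exact: le_trans (ler_norm _).
move=> H.
have cv : (nrm mu (u t))%:E @[t --> F] --> 0%E; last first.
  apply: cvg_trans cv; apply: near_eq_cvg.
  by apply: filterS uE => t /= ->.
apply/fine_cvgP; split; first exact: nearW.
apply/cvgrPdist_le => e e0; apply: filterS (H e e0) => t /=.
by rewrite sub0r normrN ger0_norm// nrm_ge0.
Qed.

Hypothesis scont : strongly_continuous P X mu.

Lemma kernel_strong f : sqint mu f -> forall e : R, 0 < e ->
  \forall t \near 0^'+, nrm mu (pt Q t f - f) <= e.
Proof.
move=> sf; have mf := sqint_measurable sf.
apply/(L2norm_cvg0 (u := fun t => pt Q t f - f)); last first.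
  apply: cvg_trans (scont ((sqint_Lfun mu f).2 sf)); apply: near_eq_cvg.
  by near=> t; rewrite (semigroupE process).
by near=> t; apply: sqintB => //; apply: (sqint_pt QP kernel_invariant).
Unshelve. all: by end_near. Qed.

Let difference_quotient f g t : borel E -> R :=
  t^-1 *: (pt Q t f - f) - g.

Let sqint_quotient f g : sqint mu f -> sqint mu g ->
  \forall t \near 0^'+, sqint mu (difference_quotient f g t).
Proof.
move=> sf sg; near=> t; apply: sqintB => //; apply: sqintZ; apply: sqintB => //.
exact: (sqint_pt QP kernel_invariant).
Unshelve. all: by end_near. Qed.

Let nrm_quotient f g t : 0 < t -> sqint mu f -> sqint mu g ->
  nrm mu (pt Q t f - f - t *: g) = t * nrm mu (difference_quotient f g t).
Proof.
move=> t0 sf sg; rewrite -[X in _ = X * _]gtr0_norm// -nrmZ; last first.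
  apply: sqintB => //; apply: sqintZ; apply: sqintB => //.
  exact: (sqint_pt QP kernel_invariant (ltW t0)).
congr nrm; apply/funext => x; rewrite /difference_quotient !pointwiseE.
by field; rewrite gt_eqF.
Qed.

Let quotient_eq f g : sqint mu f -> \forall t \near 0^'+,
  (fun x => (semigroup P X t f x - f x) / t - g x) = difference_quotient f g t.
Proof.
move=> sf; have mf := sqint_measurable sf.
near=> t; rewrite (semigroupE process)//.
by apply/funext => x; rewrite /difference_quotient !pointwiseE mulrC.
Unshelve. all: by end_near. Qed.

Lemma gen_rel_is_gen f g : gen_rel P X mu f g <-> is_gen Q mu f g.
Proof.
split=> [[/sqint_Lfun sf /sqint_Lfun sg cv]|[sf sg H]].
  split=> // e e0.
  have /(L2norm_cvg0 (sqint_quotient sf sg))/(_ _ e0) :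
      L2norm mu (difference_quotient f g t) @[t --> 0^'+] --> 0%E.
    by apply: cvg_trans cv; apply: near_eq_cvg; apply: filterS (quotient_eq g sf) => t /= ->.
  move=> He; near=> t.
  have t0 : 0 < t by [].
  rewrite nrm_quotient// mulrC ler_pM2r//.
  near: t; exact: He.
split; [exact/sqint_Lfun|exact/sqint_Lfun|].
have cv : L2norm mu (difference_quotient f g t) @[t --> 0^'+] --> 0%E.
  apply/(L2norm_cvg0 (sqint_quotient sf sg)) => e e0; near=> t.
  have t0 : 0 < t by [].
  rewrite -(ler_pM2l t0) -nrm_quotient// mulrC.
  near: t; exact: H.
apply: cvg_trans cv; apply: near_eq_cvg.
by apply: filterS (quotient_eq g sf) => t /= ->.
Unshelve. all: by end_near. Qed.

Lemma gen_domP f : gen_dom P X mu f -> is_gen Q mu f (gen P X mu f).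
Proof.
move=> [g fg]; apply/gen_rel_is_gen.
exact: (@xgetPex _ (cst 0) [set g | gen_rel P X mu f g] (ex_intro _ g fg)).
Qed.

Variable N : set (E -> R).
Hypothesis nice : nice_class P X mu N.

Lemma nice_bounded_by f : N f -> exists M, bounded_by M f.
Proof.
move=> Nf; have [M fM] := nice_bounded nice Nf; exists M; split=> //.
exact: (nice_measurable nice).
Qed.

Lemma nice_sqint f : N f -> sqint mu f.
Proof. by move=> /nice_bounded_by[M]; exact: bounded_sqint. Qed.

Lemma nice_pt t f : 0 <= t -> N f -> N (pt Q t f).
Proof.
move=> t0 Nf; rewrite -(semigroupE process)//.
  exact: (nice_semigroup nice).
exact: (nice_measurable nice).
Qed.

(** The domain is dense in L2, and a core approximates the elements of the
    domain. *)
Lemma nice_dense f (e : R) : sqint mu f -> 0 < e ->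
  exists2 u : borel E -> R, N u & nrm mu (u - f) <= e.
Proof.
move=> sf e0; have e2 : 0 < e / 2 by rewrite divr_gt0.
have [v [w [vw vf]]] := domain_dense QP kernel_invariant kernel_strong sf e2.
have sv : sqint mu v by case: vw.
have [_ /(_ v w)] := nice_core nice.
case; first exact/gen_rel_is_gen.
move=> u [Nu uv _].
have su n : sqint mu (u n : borel E -> R) := nice_sqint (Nu n).
have : \forall n \near \oo, sqint mu ((u n : borel E -> R) - v).
  by apply: nearW => n; exact: sqintB.
move=> /L2norm_cvg0[/(_ uv _ e2)[n _ Hn] _].
exists (u n) => //; apply: le_trans (nrm_triangle (su n) sv sf) _.
by have := Hn n (leqnn n); rewrite /=; lra.
Qed.

Lemma carre2_bakry_emery (rho : R) f : N f ->
  {ae mu, forall x, rho * carre P X mu f f x <= carre2 P X mu f f x} ->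
  bakry_emery Q mu rho f (carre P X mu f f).
Proof.
move=> Nf cd; have [[_ Df Dff] DG [Df1 _ Df1f] _] := nice_carre2 nice Nf.
set f1 := gen P X mu f in Df1 Df1f *.
have ff1 : f1 \* f = f \* f1 by apply/funext => x /=; rewrite mulrC.
exists f1, (gen P X mu f1), (gen P X mu (carre P X mu f f)), (gen P X mu (f \* f1)).
split=> //.
- exact: gen_domP.
- exact: gen_domP.
- rewrite (_ : carre P X mu f f + _ = gen P X mu (f \* f)).
    exact: (gen_domP (f := f \* f)).
  by apply/funext => x; rewrite !pointwiseE /carre -/f1; ring.
- split; first exact: gen_domP.
  by apply: (gen_domP (f := f \* f1)); rewrite -ff1.
- have -> : 2^-1 *: gen P X mu (carre P X mu f f) - gen P X mu (f \* f1)
     + f1 * f1 + f * gen P X mu f1 = carre2 P X mu f f.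
    apply/funext => x; rewrite !pointwiseE /carre2 -/f1.
    rewrite [carre _ _ _ f1 f]/carre [carre _ _ _ f f1]/carre ff1 -/f1.
    by field.
  exact: cd.
Qed.

End Generator.

(** * Decay of the total variation *)

Section BoundedDensity.
Context {d} {T : measurableType d} {R : realType} (mu nu : probability T R).
Variables (k : T -> R) (c : R).
Hypothesis mk : measurable_fun setT k.
Hypothesis k_ge : forall x, 2^-1 <= k x.
Hypothesis k_le : forall x, k x <= c.
Hypothesis nuE : forall B : set T, measurable B ->
  (nu B = \int[mu]_(x in B) (k x)%:E)%E.

Let k_gt0 x : 0 < k x. Proof. by apply: lt_le_trans (k_ge x). Qed.
Let k_ge0 x : 0 <= k x. Proof. exact: ltW. Qed.

Lemma majorized_density : majorized c nu mu.
Proof.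
have c0 : 0 <= c := le_trans (k_ge0 point) (k_le point).
split=> // B mB; rewrite [leLHS]nuE// -integral_cst//.
apply: ge0_le_integral => //.
- by move=> x _; rewrite lee_fin.
- by apply/measurable_EFinP; exact: measurable_funTS.
- by move=> x _; rewrite lee_fin.
Qed.

Let k_bounded : bounded_by c k.
Proof. by split=> // x; rewrite gtr0_norm. Qed.

Let Rint_k : \int[mu]_x k x = 1.
Proof.
have := nuE measurableT.
by rewrite probability_setT (rintE (rint_bounded mu k_bounded)) => -[].
Qed.

(** Writing [(k - 1) mu] as [(1 - 1/k) nu] and centring [g] for [nu], this is
    the Cauchy-Schwarz inequality in L2(nu), as [|1 - 1/k| <= 1]. *)
Lemma density_covariance M g : bounded_by M g ->
  `|\int[mu]_x (g x * (k x - 1))| <= nrm nu (g - cst (\int[nu]_y g y)).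
Proof.
move=> bg; have [mg gM] := bg; set m := \int[nu]_y g y.
pose q : T -> R := fun x => 1 - (k x)^-1.
have q1 x : `|q x| <= 1.
  have : 0 < (k x)^-1 by rewrite invr_gt0.
  have : (k x)^-1 <= 2 by rewrite -[2]invrK lef_pV2 ?posrE ?invr_gt0.
  by rewrite ler_norml /q; lra.
have mq : measurable_fun setT q.
  apply: measurable_funB => //.
  under eq_fun do rewrite -powR_inv1//.
  exact: (measurableT_comp (measurable_powR (-1))).
have bc : bounded_by (M + `|m|) (g - cst m).
  split; first exact: measurable_funB.
  by move=> x; rewrite !pointwiseE (le_trans (ler_normB _ _))// lerD2r.
have sc : sqint nu (g - cst m) := bounded_sqint nu bc.
have sq : sqint nu q by apply: (@bounded_sqint _ _ _ _ 1); split.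
have bcq : bounded_by (M + `|m|) ((g - cst m) * q).
  split; first by apply: measurable_funM => //; case: bc.
  move=> x; rewrite !pointwiseE normrM.
  rewrite -[leRHS]mulr1; apply: ler_pM => //.
  by case: bc => _ /(_ x); rewrite !pointwiseE.
have E : \int[nu]_x ((g - cst m) * q) x = \int[mu]_x (g x * (k x - 1)).
  rewrite (Rint_density mk nuE (rint_bounded mu k_bounded) bcq).
  have rk : rint mu (k - cst 1).
    by apply: (rintB (rint_bounded mu k_bounded)); exact: rint_cst.
  have rg : rint mu (g * (k - cst 1)) := rintM bg rk.
  transitivity (\int[mu]_x (g * (k - cst 1) - m *: (k - cst 1)) x).
    apply: eq_Rintegral => x _; rewrite !pointwiseE /q.
    by field; rewrite gt_eqF.
  rewrite (Rint_sub rg (rintZ m rk)) (Rint_scale m rk).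
  rewrite (Rint_sub (rint_bounded mu k_bounded) (rint_cst mu 1)) Rint_k.
  by rewrite Rintegral_cst// [X in fine X]probability_setT mulr1 subrr mulr0 subr0.
rewrite -E; apply: le_trans (Rint_norm_le (sqint_rint (sqintM bc sq))) _.
apply: le_trans (cauchy_schwarz sc sq) _.
rewrite -[leRHS]mulr1 ler_wpM2l ?nrm_ge0//.
rewrite -[leRHS]normr1 -(nrm_cst nu); apply: nrm_le => //.
  exact: sqint_cst.
by move=> x; rewrite [leRHS]normr1.
Qed.

End BoundedDensity.

Lemma osc_le {R : realType} {E : puniformType} (f : E -> R) M :
  (forall x, `|f x| <= M) -> 0 <= osc f <= 2 * M.
Proof.
move=> fM; have ne : range f !=set0 by exists (f point), point.
have ub : ubound (range f) M.
  by move=> _ [x _ <-]; rewrite (le_trans (ler_norm _)).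
have lb : lbound (range f) (- M).
  by move=> _ [x _ <-]; rewrite lerNl (le_trans _ (fM x))// -normrN ler_norm.
have A : sup (range f) <= M by exact: ge_sup.
have B : - M <= inf (range f) by exact: lb_le_inf.
have C : inf (range f) <= f point by apply: ge_inf => //; exists (- M).
have D : f point <= sup (range f) by apply: ub_le_sup => //; exists M.
by rewrite /osc; apply/andP; split; lra.
Qed.

Lemma varianceE_nrm {d} {T : measurableType d} {R : realType}
    (nu : probability T R) (g : T -> R) : sqint nu g ->
  variance nu g = (nrm nu (g - cst (\int[nu]_y g y)) ^+ 2)%:E /\
  nrm nu (g - cst (\int[nu]_y g y)) ^+ 2
    = \int[nu]_x g x ^+ 2 - (\int[nu]_x g x) ^+ 2.
Proof.
move=> sg; set m := \int[nu]_y g y.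
have sc := sqintB sg (sqint_cst nu m).
have E : nrm nu (g - cst m) ^+ 2 = \int[nu]_x g x ^+ 2 - m ^+ 2.
  rewrite nrm_sqr.
  transitivity (\int[nu]_x ((fun x => g x ^+ 2) + ((-2 * m) *: g + cst (m ^+ 2))) x).
    by apply: eq_Rintegral => x _; rewrite !pointwiseE; ring.
  have r1 := rintZ (-2 * m) (sqint_rint sg); have r2 := rint_cst nu (m ^+ 2).
  rewrite (Rint_add (sqint_sqr sg) (rintD r1 r2)) (Rint_add r1 r2).
  rewrite (Rint_scale _ (sqint_rint sg)) -/m.
  rewrite Rintegral_cst// [X in fine X]probability_setT mulr1.
  by ring.
split=> //; rewrite varianceE; last exact/sqint_Lfun.
rewrite E EFinB unlock (rintE (sqint_sqr sg)) EFin_expe.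
by rewrite (rintE (sqint_rint sg)).
Qed.

Lemma decay_quotientE {R : realType} (rho t b : R) : 0 <= rho -> 0 < t -> 0 < b ->
  decay_quotient rho t b = b / (kappa rho t + b).
Proof.
move=> rho0 t0 b0; rewrite /decay_quotient /kappa.
have [//|rhoN] := eqVneq rho 0.
have rp : 0 < rho by rewrite lt_neqAle eq_sym rhoN.
have : 1 < expR (rho * t) by rewrite expR_gt1 mulr_gt0.
move=> e1; have ? : 0 < rho * b by rewrite mulr_gt0.
field; rewrite rhoN /= gt_eqF//; lra.
Qed.

Lemma decay_quotient_bounds {R : realType} (rho t b : R) :
  0 <= rho -> 0 < t -> 0 < b -> 0 <= decay_quotient rho t b <= 1.
Proof.
move=> rho0 t0 b0; rewrite decay_quotientE//.
have k0 := kappa_gt0 rho0 t0; have kb : 0 < kappa rho t + b by exact: addr_gt0.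
by apply/andP; split; [exact: ltW (divr_gt0 b0 kb)|
  rewrite ler_pdivrMr// mul1r lerDr ltW].
Qed.

Section Decay.
Context {R : realType} {E : puniformType} {d : measure_display}
  {Omega : measurableType d}.
Variables (P : R.-pker (borel E) ~> Omega) (X : R -> Omega -> borel E).
Variables (mu : probability (borel E) R).
Hypothesis process : markov_process P X.
Hypothesis invar : Defs.invariant P X mu.
Hypothesis scont : strongly_continuous P X mu.
Local Notation Q := (kernel_of process).
Local Notation QP := (transition_kernels_of process).
Local Notation inv := (kernel_invariant process invar).
Local Notation strong := (kernel_strong process invar scont).
Variables (N : set (E -> R)) (rho : R).
Hypothesis nice : nice_class P X mu N.
Hypothesis rho0 : 0 <= rho.
Hypothesis curv : forall f, N f ->
  {ae mu, forall x, rho * carre P X mu f f x <= carre2 P X mu f f x}.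
Implicit Types (f g v : borel E -> R).

Variable beta : R -> R.
Hypothesis beta0 : forall s, 0 < s -> 0 < beta s.

Section FixedDensity.
Variables (nu : probability (borel E) R) (k : borel E -> R) (c : R).
Hypothesis mk : measurable_fun setT k.
Hypothesis k_ge : forall x, 2^-1 <= k x.
Hypothesis k_le : forall x, k x <= c.
Hypothesis nuE : has_density mu nu k.
Hypothesis wp : weak_poincare P X mu nu beta.

Let dom : majorized c nu mu := majorized_density mk k_ge k_le nuE.

Lemma gradient_bound f t : N f -> (forall x, `|f x| <= 1) -> 0 < t ->
  kappa rho t * \int[nu]_x carre P X mu (pt Q t f) (pt Q t f) x
    <= 1 - \int[nu]_x pt Q t f x ^+ 2.
Proof.
move=> Nf f1 t0; have bf : bounded_by 1 f.
  by split=> //; exact: (nice_measurable nice).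
have cd s : 0 <= s -> bakry_emery Q mu rho (pt Q s f)
    (carre P X mu (pt Q s f) (pt Q s f)).
  move=> s0; have Ns := nice_pt process nice s0 Nf.
  exact: (carre2_bakry_emery process invar nice Ns (curv Ns)).
have rp := reverse_poincare (G := fun s => carre P X mu (pt Q s f) (pt Q s f))
  QP inv strong dom rho0 ler01 bf cd t0.
apply: le_trans rp _.
rewrite lerD2r.
have -> : (1 : R) = \int[law QP nu t]_x cst 1 x.
  by rewrite Rintegral_cst// [X in fine X](law_mass QP t (probability_setT nu)) mulr1.
apply: Rint_le; [|exact: rint_cst|].
  apply: (@rint_bounded _ _ _ _ 1); split.
    by apply: measurable_funX; case: bf.
  by move=> x; rewrite normrX expr_le1.
move=> x; rewrite -(real_normK (num_real (f x))) /=.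
by rewrite expr_le1.
Qed.

(** Let [V] be the variance, [I] the integral of the gradient and [J] that of
    [(pt t f) ^+ 2]. Then [V <= beta s * I + 4 * s] by the weak Poincare inequality,
    as the oscillation is at most 2, and [kappa * I <= 1 - J <= 1 - V] by the
    reverse one; [I] is eliminated. *)
Lemma variance_bound f t s : N f -> (forall x, `|f x| <= 1) -> 0 < t -> 0 < s ->
  nrm nu (pt Q t f - cst (\int[nu]_y pt Q t f y)) ^+ 2
    <= decay_quotient rho t (beta s) + 4 * s.
Proof.
move=> Nf f1 t0 s0; have Ng := nice_pt process nice (ltW t0) Nf.
have [mg g1] : bounded_by 1 (pt Q t f).
  by apply: (pt_bounded QP); split=> //; exact: (nice_measurable nice).
have sg : sqint nu (pt Q t f) by apply: (@bounded_sqint _ _ _ _ 1); split.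
have [VE V2] := varianceE_nrm sg.
have [Dg DG _ _] := nice_carre2 nice Ng.
have rG : rint nu (carre P X mu (pt Q t f) (pt Q t f)).
  apply: (majorized_rint dom); apply: sqint_rint.
  by case: (gen_domP process invar DG).
have := wp s0 mg (ex_intro _ 1 g1) Dg.
rewrite VE (rintE rG) -EFinM -EFinD lee_fin.
have gb := gradient_bound Nf f1 t0.
have /andP[os0 os2] := osc_le g1.
have k0 := kappa_gt0 rho0 t0; have b0 := beta0 s0.
have m0 := sqr_ge0 (\int[nu]_x pt Q t f x).
rewrite decay_quotientE// => wps.
move: VE V2 gb m0 wps os0 os2; clear -k0 b0 s0.
set V := nrm _ _ ^+ 2; set I := \int[nu]_x carre _ _ _ _ _ x.
set m := \int[nu]_x pt Q t f x; set J := \int[nu]_x _ ^+ 2; set o := osc _.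
clearbody V I m J o => _ V2 gb m0 wps os0 os2.
have os4 : s * o ^+ 2 <= s * 4.
  by rewrite ler_wpM2l ?(ltW s0)//; nra.
have kb : 0 < kappa rho t + beta s by rewrite addr_gt0.
rewrite -lerBlDr ler_pdivlMr//.
have : kappa rho t * (V - 4 * s) <= kappa rho t * (beta s * I).
  by rewrite ler_pM2l//; lra.
have : beta s * (kappa rho t * I) <= beta s * (1 - V).
  by rewrite ler_pM2l//; lra.
have : 0 <= s * beta s by rewrite mulr_ge0// ltW.
lra.
Qed.

Lemma test_bound_density f t s :
  N f -> (forall x, `|f x| <= 1) -> 0 < t -> 0 < s ->
  `|\int[mu]_x (pt Q t f x * (k x - 1))|
    <= Num.sqrt (decay_quotient rho t (beta s) + 4 * s).
Proof.
move=> Nf f1 t0 s0.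
have bg : bounded_by 1 (pt Q t f).
  by apply: (pt_bounded QP); split=> //; exact: (nice_measurable nice).
apply: le_trans (density_covariance mk k_ge k_le nuE bg) _.
rewrite -[leLHS]ger0_norm ?nrm_ge0// -sqrtr_sqr; apply: ler_wsqrtr.
exact: variance_bound.
Qed.

End FixedDensity.
Variables (h : borel E -> R) (hn : nat -> borel E -> R).
Hypothesis dens_h : density mu h.
Hypothesis dens_hn : forall n, (0 < n)%N -> density mu (hn n).
Hypothesis bound_hn : forall n, (0 < n)%N -> forall x, 2^-1 <= hn n x <= n%:R.
Hypothesis wp_hn : forall n, (0 < n)%N -> exists2 nu : probability (borel E) R,
  has_density mu nu (hn n) & weak_poincare P X mu nu beta.
Hypothesis cvg_hn : (\int[mu]_x `|hn n x - (1 + h x) / 2|%:E)%E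
  @[n --> \oo] --> 0%E.

Let rh : rint mu h.
Proof. by case: dens_h => mh h0 h1; exact: rint_density. Qed.

Let rhn n : (0 < n)%N -> rint mu (hn n).
Proof. by move=> /dens_hn[mh h0 h1]; exact: rint_density. Qed.

Let half_h : borel E -> R := 2^-1 *: (cst 1 + h).

Let rhalf : rint mu half_h.
Proof. by apply: rintZ; apply: rintD => //; exact: rint_cst. Qed.

Let nrm1_hn e : 0 < e -> exists2 n, (0 < n)%N & nrm1 mu (hn n - half_h) <= e.
Proof.
move=> e0; have /fine_cvgP[_ /cvgrPdist_le/(_ e e0)[n _ Hn]] := cvg_hn.
exists n.+1 => //; have := Hn n.+1 (leqnSn n).
rewrite /= sub0r normrN; apply: le_trans; apply: le_trans (ler_norm _).
rewrite le_eqVlt; apply/orP; left; apply/eqP; congr fine.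
by apply: eq_integral => x _; rewrite /half_h !pointwiseE [2^-1 * _]mulrC.
Qed.

(** [h - 1] is twice [(1 + h) / 2 - 1], which [hn n - 1] approaches in L1. *)
Lemma test_bound f t s :
  N f -> (forall x, `|f x| <= 1) -> 0 < t -> 0 < s ->
  `|\int[mu]_x (pt Q t f * (h - cst 1)) x|
    <= 2 * Num.sqrt (decay_quotient rho t (beta s) + 4 * s).
Proof.
move=> Nf f1 t0 s0; set D := Num.sqrt _.
have bg : bounded_by 1 (pt Q t f).
  by apply: (pt_bounded QP); split=> //; exact: (nice_measurable nice).
set g := pt Q t f in bg *.
apply/ler_addgt0Pr => e e0; have e2 : 0 < e / 2 by rewrite divr_gt0.
have [n n0 ne] := nrm1_hn e2.
have [nu nuE wpn] := wp_hn n0.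
have [mk k0 k1] := dens_hn n0.
have kb := bound_hn n0.
have Dn : `|\int[mu]_x (g * (hn n - cst 1)) x| <= D.
  apply: (@test_bound_density nu (hn n) n%:R mk) => //.
  - by move=> x; have /andP[] := kb x.
  - by move=> x; have /andP[] := kb x.
have r1 := rintM bg (rintB (rhn n0) (rint_cst mu 1)).
have r2 := rintM bg (rintB (rhn n0) rhalf).
have -> : \int[mu]_x (g * (h - cst 1)) x =
    2 * (\int[mu]_x (g * (hn n - cst 1)) x - \int[mu]_x (g * (hn n - half_h)) x).
  rewrite -(Rint_sub r1 r2) -(Rint_scale 2 (rintB r1 r2)).
  by apply: eq_Rintegral => x _; rewrite /half_h !pointwiseE; field.
rewrite normrM gtr0_norm//.
have : `|\int[mu]_x (g * (hn n - half_h)) x| <= e / 2.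
  apply: le_trans (Rint_norm_le r2) _; apply: le_trans ne.
  have := nrm1_mulM bg (rintB (rhn n0) rhalf).
  by rewrite mul1r.
have := ler_normB (\int[mu]_x (g * (hn n - cst 1)) x)
  (\int[mu]_x (g * (hn n - half_h)) x).
lra.
Qed.

Lemma dual_semigroupP t : 0 <= t -> rint mu (dual_semigroup P X mu t h) /\
  forall M f, bounded_by M f ->
    \int[mu]_x (f x * dual_semigroup P X mu t h x)
      = \int[mu]_x (pt Q t f x * h x).
Proof.
move=> t0; have [mh h0 h1] := dens_h.
pose good g := g \in Lfun (mu : {measure set (borel E) -> \bar R}) 1 /\
    forall f : borel E -> R, measurable_fun setT f -> bounded_function f ->
      \int[mu]_x (f x * g x) = \int[mu]_x (semigroup P X t f x * h x).
have [g [rg gE]] := dual_exists QP inv mh h0 h1 t0.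
have gg : good g.
  split; first exact/Lfun1_integrable.
  move=> f mf [M fM]; rewrite (semigroupE process)//.
  by apply: (gE M); split.
have [Lg fE] : good (dual_semigroup P X mu t h).
  exact: (@xgetPex _ (cst 0) [set g | good g] (ex_intro _ g gg)).
split; first exact/Lfun1_integrable.
move=> M f [mf fM]; rewrite fE ?(semigroupE process)//.
by exists M.
Qed.

(** For a test function [f], the integral of [f * (P_t^* h - 1)] is that of
    [pt t f * (h - 1)], by duality for [h] and by invariance for 1. *)
Lemma tv_dist_decay t s : 0 < t -> 0 < s ->
  (tv_dist mu (dual_semigroup P X mu t h)
     <= (2 * Num.sqrt (decay_quotient rho t (beta s) + 4 * s))%:E)%E.
Proof.
move=> t0 s0; have [rg gE] := dual_semigroupP (ltW t0).
set g := dual_semigroup P X mu t h in rg gE *.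
have rv : rint mu (g - cst 1) by apply: rintB => //; exact: rint_cst.
rewrite /tv_dist [leLHS](rintE (rint_norm rv)) lee_fin.
have [Nc ND NM] := nice_algebra nice.
apply: (@nrm1_le_test _ _ _ mu N _ (nice_bounded_by nice)
  (nice_dense process invar scont nice)) => // f Nf f1.
have [M bf] := nice_bounded_by nice Nf.
have bg := pt_bounded QP t bf.
have E1 : \int[mu]_x (f x * (g - cst 1) x) =
    \int[mu]_x (pt Q t f * (h - cst 1)) x.
  transitivity (\int[mu]_x (f * g - f) x).
    by apply: eq_Rintegral => x _; rewrite !pointwiseE; ring.
  transitivity (\int[mu]_x (pt Q t f * h - pt Q t f) x); last first.
    by apply: eq_Rintegral => x _; rewrite !pointwiseE; ring.
  rewrite (Rint_sub (rintM bf rg) (rint_bounded mu bf)).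
  rewrite (Rint_sub (rintM bg rh) (rint_bounded mu bg)).
  rewrite (integral_pt_mu QP inv (ltW t0) (rint_bounded mu bf)).
  by rewrite (gE M f bf).
by rewrite E1; apply: le_trans (ler_norm _) (test_bound Nf f1 t0 s0).
Qed.

Lemma tv_dist_wp_rate t : 0 < t ->
  (tv_dist mu (dual_semigroup P X mu t h)
     <= (2 * Num.sqrt (wp_rate rho beta t))%:E)%E.
Proof.
move=> t0; have [rg _] := dual_semigroupP (ltW t0).
have rv : rint mu (dual_semigroup P X mu t h - cst 1).
  by apply: rintB => //; exact: rint_cst.
have tvE : tv_dist mu (dual_semigroup P X mu t h) =
    (nrm1 mu (dual_semigroup P X mu t h - cst 1))%:E.
  exact: (rintE (rint_norm rv)).
have H s := @tv_dist_decay t s t0; move: H; rewrite tvE => H.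
rewrite lee_fin; set y := nrm1 _ _ in H *.
have y0 : 0 <= y by exact: Rintegral_ge0.
rewrite -ler_pdivrMl// -[leLHS]ger0_norm ?mulr_ge0// -sqrtr_sqr.
apply: ler_wsqrtr; apply: lb_le_inf.
  by exists (decay_quotient rho t (beta 1) + 4 * 1), 1 => //=.
move=> _ [s /= s0 <-]; have := H s s0; rewrite lee_fin -ler_pdivrMl//.
have q0 : 0 <= decay_quotient rho t (beta s) + 4 * s.
  have /andP[q0 _] := decay_quotient_bounds rho0 t0 (beta0 s0).
  by rewrite addr_ge0// mulr_ge0// ltW.
rewrite -{2}(sqr_sqrtr q0) => le; rewrite lerXn2r ?nnegrE ?sqrtr_ge0//.
by rewrite mulr_ge0.
Qed.

End Decay.

(** * Explicit rates *)

Section Rates.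
Context {R : realType}.
Variables (rho : R) (beta : R -> R).
Hypothesis rho0 : 0 < rho.
Hypothesis betaP : wp_function beta.

Let beta0 s : 0 < s -> 0 < beta s. Proof. by case: betaP => + _; exact. Qed.

Lemma wp_rate_le t s : 0 < t -> 0 < s ->
  wp_rate rho beta t <= decay_quotient rho t (beta s) + 4 * s.
Proof.
move=> t0 s0; apply: ge_inf; last by exists s.
exists 0 => _ [r /= r0 <-].
have /andP[q0 _] := decay_quotient_bounds (ltW rho0) t0 (beta0 r0).
by rewrite addr_ge0// mulr_ge0// ltW.
Qed.

Lemma wp_rate_le1 t : 0 < t -> wp_rate rho beta t <= 1.
Proof.
move=> t0; apply/ler_addgt0Pr => e e0; have e4 : 0 < e / 4 by rewrite divr_gt0.
apply: le_trans (wp_rate_le t0 e4) _.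
have /andP[_ q1] := decay_quotient_bounds (ltW rho0) t0 (beta0 e4).
lra.
Qed.

(** As soon as [e^(rho t) >= 2], [e^(rho t) - 1] is comparable to [e^(rho t)]. *)
Lemma wp_rate_late t s : 0 < t -> 2 <= expR (rho * t) -> 0 < s ->
  wp_rate rho beta t <= 2 * rho * beta s / expR (rho * t) + 4 * s.
Proof.
move=> t0 u2 s0; apply: le_trans (wp_rate_le t0 s0) _; rewrite lerD2r.
rewrite /decay_quotient gt_eqF//; move: u2; set u := expR _ => u2.
have b0 := beta0 s0; have rb : 0 < rho * beta s by rewrite mulr_gt0.
have u0 : 0 < u by rewrite expR_gt0.
rewrite ler_pdivrMr; last lra.
rewrite mulrAC ler_pdivlMr//; nra.
Qed.

Let admissible u : set R := [set s | 0 < s /\ beta s / s <= 4 * u / rho].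

Let admissible_neq0 u : 0 < u -> admissible u !=set0.
Proof.
move=> u0; have b1 := beta0 ltr01.
pose s := Num.max 1 (rho * beta 1 / (4 * u)).
have s1 : 1 <= s by rewrite le_max lexx.
have s0 : 0 < s by apply: lt_le_trans s1.
exists s; split=> //; have [_ /(_ 1 s ltr01 s1) bs] := betaP.
have : rho * beta 1 / (4 * u) <= s by rewrite le_max lexx orbT.
rewrite ler_pdivrMr ?mulr_gt0// => H.
rewrite ler_pdivrMr// mulrAC ler_pdivlMr//.
by have : rho * beta s <= rho * beta 1; [rewrite ler_pM2l|lra].
Qed.

(** For an admissible [s] the quotient is at most [8 * s]. *)
Lemma wp_rate_theta t : 0 < t -> 2 <= expR (rho * t) ->
  wp_rate rho beta t <= 12 * theta rho beta (expR (rho * t)).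
Proof.
move=> t0 u2; rewrite -ler_pdivrMl//; apply: lb_le_inf.
  by apply: admissible_neq0; exact: expR_gt0.
move=> s [s0]; rewrite ler_pdivrMr// => bs.
rewrite ler_pdivrMl//; apply: le_trans (wp_rate_late t0 u2 s0) _.
have u0 : 0 < expR (rho * t) by exact: expR_gt0.
suff : 2 * rho * beta s / expR (rho * t) <= 8 * s by lra.
rewrite ler_pdivrMr//.
have : rho * beta s <= rho * (4 * expR (rho * t) / rho * s) by rewrite ler_pM2l.
rewrite (_ : rho * (4 * _ / rho * s) = 4 * expR (rho * t) * s); first lra.
by field; rewrite gt_eqF.
Qed.

Let theta0 : R := Num.min 1 (rho * beta 1 / 8).

Let theta0_gt0 : 0 < theta0.
Proof. by rewrite lt_min ltr01/= divr_gt0// mulr_gt0// beta0. Qed.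

Let theta_ge u : 0 < u -> u < 2 -> theta0 <= theta rho beta u.
Proof.
move=> u0 u2; apply: lb_le_inf; first exact: admissible_neq0.
move=> s [s0 bs]; rewrite ge_min; have [//|s1] := leP 1 s.
rewrite /=; have [_ /(_ s 1 s0 (ltW s1)) b1] := betaP.
move: bs; rewrite ler_pdivrMr// mulrAC ler_pdivlMr// => bs.
have : beta 1 * rho <= beta s * rho by rewrite ler_pM2r.
have : u * s <= 2 * s by rewrite ler_pM2r// ltW.
lra.
Qed.

(** While [e^(rho t) < 2], the rate is at most 1 and [theta] is at least [theta0];
    this accounts for the second term of the constant. *)
Lemma theta_rate : exists C, forall t, 0 < t ->
  2 * Num.sqrt (wp_rate rho beta t)
    <= C * Num.sqrt (theta rho beta (expR (rho * t))).
Proof.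
have q0 : 0 < Num.sqrt theta0 by rewrite sqrtr_gt0.
exists (8 + 2 / Num.sqrt theta0) => t t0.
have u0 : 0 < expR (rho * t) by exact: expR_gt0.
have c0 : 0 < 2 / Num.sqrt theta0 by rewrite divr_gt0.
rewrite [leRHS]mulrDl.
have [u2|u2] := leP 2 (expR (rho * t)).
  apply: le_trans (_ : 8 * Num.sqrt (theta rho beta (expR (rho * t))) <= _).
    have -> : (8 : R) = 2 * Num.sqrt (4 ^+ 2) by rewrite sqrtr_sqr ger0_norm//; ring.
    rewrite -mulrA ler_pM2l// -sqrtrM ?sqr_ge0//; apply: ler_wsqrtr.
    have R1 := wp_rate_theta t0 u2.
    have T0 : 0 <= theta rho beta (expR (rho * t)).
      by apply: lb_le_inf; [exact: admissible_neq0|move=> s [/ltW]].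
    lra.
  by rewrite lerDl mulr_ge0 ?sqrtr_ge0// ltW.
apply: (@le_trans _ _ (2 * 1)).
  by rewrite ler_pM2l// -[leRHS]sqrtr1; apply: ler_wsqrtr; exact: wp_rate_le1.
have : Num.sqrt theta0 <= Num.sqrt (theta rho beta (expR (rho * t))).
  by apply: ler_wsqrtr; exact: theta_ge.
move=> st; rewrite mulr1.
apply: (@le_trans _ _ (2 / Num.sqrt theta0 * Num.sqrt theta0)).
  by rewrite divfK ?gt_eqF.
rewrite -[leLHS]add0r; apply: lerD; first by rewrite mulr_ge0// sqrtr_ge0.
by rewrite ler_pM2l.
Qed.

(** Here [s = expR (- r)] with [r = rho * t / (1 + q)], for which the two terms of
    [wp_rate_late] have the same order. *)
Lemma power_rate c q : 0 <= q -> (forall s, 0 < s -> beta s <= c * s `^ (- q)) ->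
  exists C, forall t, 0 < t ->
  2 * Num.sqrt (wp_rate rho beta t) <= C * expR (- (rho * t / (2 * (1 + q)))).
Proof.
move=> q0 bc; exists (2 * Num.sqrt (2 * rho * c + 4) + 4) => t t0.
have q1 : 0 < 1 + q by lra.
pose r := rho * t / (1 + q).
have rE : rho * t / (2 * (1 + q)) = r / 2.
  by rewrite /r; field; rewrite gt_eqF.
have rt0 : 0 < rho * t by rewrite mulr_gt0.
have r0 : 0 < r by rewrite divr_gt0.
have rr : r * (1 + q) = rho * t by rewrite /r divfK// gt_eqF.
have e0 : 0 < expR (- (r / 2)) by exact: expR_gt0.
have c0 : 0 <= c.
  have := bc 1 ltr01; rewrite powR1 mulr1; apply: le_trans; exact: ltW (beta0 ltr01).
rewrite rE [leRHS]mulrDl.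
have [u2|u2] := leP 2 (expR (rho * t)).
  apply: (@le_trans _ _ (2 * Num.sqrt (2 * rho * c + 4) * expR (- (r / 2)))); last first.
    by rewrite lerDl mulr_ge0// ltW.
  have a0 : 0 <= 2 * rho * c + 4 by rewrite addr_ge0// !mulr_ge0// ltW.
  rewrite -mulrA ler_pM2l// -[expR _]gtr0_norm// -sqrtr_sqr -sqrtrM//.
  apply: ler_wsqrtr; rewrite expr2 -expRD.
  have -> : - (r / 2) - r / 2 = - r by field.
  apply: le_trans (wp_rate_late t0 u2 (expR_gt0 (- r))) _.
  rewrite [leRHS]mulrDl lerD2r.
  have u0 : 0 < expR (rho * t) by exact: expR_gt0.
  rewrite ler_pdivrMr// -[leRHS]mulrA -expRD -!mulrA ler_pM2l// ler_pM2l//.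
  have := bc _ (expR_gt0 (- r)).
  rewrite -expRM.
  by have -> : - r * - q = - r + rho * t by rewrite -rr; ring.
apply: (@le_trans _ _ (4 * expR (- (r / 2)))); last first.
  by rewrite lerDr mulr_ge0 ?mulr_ge0 ?sqrtr_ge0// ltW.
apply: (@le_trans _ _ (2 * 1)).
  by rewrite ler_pM2l// -[leRHS]sqrtr1; apply: ler_wsqrtr; exact: wp_rate_le1.
have : expR (r / 2) <= expR (rho * t).
  by rewrite ler_expR -rr; have : 0 <= r * q; [rewrite mulr_ge0// ltW|lra].
rewrite expRN => le; have e1 := expR_gt0 (r / 2).
by rewrite ler_pdivlMr//; lra.
Qed.

End Rates.

Theorem theorem5p19 (R : realType) (E : puniformType) (d : measure_display)
  (Omega : measurableType d)
  (P : R.-pker (borel E) ~> Omega) (X : R -> Omega -> borel E)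
  (mu : probability (borel E) R) (A : set (E -> R))
  (rho : R) (h : E -> R) (beta : R -> R) (hn : nat -> E -> R)
  (setting : markov_setting P X mu A)
  (rho_ge0 : 0 <= rho)
  (curv : curvature_ge P X mu rho)
  (dens_h : density mu h)
  (betaP : wp_function beta)
  (dens_hn : forall n, (0 < n)%N -> density mu (hn n))
  (bound_hn : forall n, (0 < n)%N -> forall x, 2^-1 <= hn n x <= n%:R)
  (wp_hn : forall n, (0 < n)%N ->
     exists2 nu : probability (borel E) R,
       has_density mu nu (hn n) & weak_poincare P X mu nu beta)
  (cvg_hn : (\int[mu]_x `|hn n x - (1 + h x) / 2|%:E)%E
              @[n --> \oo] --> 0%E) :
  (forall t, 0 < t ->
     (tv_dist mu (dual_semigroup P X mu t h)
        <= (2 * Num.sqrt (wp_rate rho beta t))%:E)%E)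
  /\ (0 < rho ->
      (exists2 s0, 0 < s0 & forall s s', 0 < s -> s <= s' -> s' <= s0 ->
         beta s' / s' <= beta s / s) ->
      exists C, forall t, 0 < t ->
        (tv_dist mu (dual_semigroup P X mu t h)
           <= (C * Num.sqrt (theta rho beta (expR (rho * t))))%:E)%E)
  /\ (0 < rho -> forall c q, 0 <= q ->
      (forall s, 0 < s -> beta s <= c * s `^ (- q)) ->
      exists C, forall t, 0 < t ->
        (tv_dist mu (dual_semigroup P X mu t h)
           <= (C * expR (- (rho * t / (2 * (1 + q)))))%:E)%E).
Proof.
have [process invar _ _ scont _ _ _ _ _] := setting.
have [N nice curvN] := curv; have [beta0 _] := betaP.
have main t : 0 < t -> (tv_dist mu (dual_semigroup P X mu t h)
    <= (2 * Num.sqrt (wp_rate rho beta t))%:E)%E.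
  exact: (tv_dist_wp_rate process invar scont nice rho_ge0 curvN beta0 dens_h
    dens_hn bound_hn wp_hn cvg_hn).
split=> //; split=> [rho0 _|rho0 c q q0 bc].
  have [C CP] := theta_rate rho0 betaP; exists C => t t0.
  by apply: le_trans (main t t0) _; rewrite lee_fin; exact: CP.
have [C CP] := power_rate rho0 betaP q0 bc; exists C => t t0.
by apply: le_trans (main t t0) _; rewrite lee_fin; exact: CP.
Qed.
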